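(* Let $\lambda > -1$ and a partition $\boldsymbol{k} \in \mathbb{Z}_+^m$ of $n$ be given, and consider the corresponding subgroup $\mathbb{T}^m$ of $\mathrm{U}(n)$. Then every $T \in \mathrm{End}_{\mathbb{T}^m}(\mathcal{A}^2_\lambda(\mathbb{B}^n))$ satisfies \[ T(\mathcal{P}_{\boldsymbol{\kappa}}(\mathbb{C}^n)) \subset \mathcal{P}_{\boldsymbol{\kappa}}(\mathbb{C}^n) \] for every $\boldsymbol{\kappa} \in \mathbb{N}^m$. Furthermore, the map \[ \mathrm{End}_{\mathbb{T}^m}(\mathcal{A}^2_\lambda(\mathbb{B}^n)) \rightarrow \bigoplus_{\boldsymbol{\kappa} \in \mathbb{N}^m} \mathrm{End}(\mathcal{P}_{\boldsymbol{\kappa}}(\mathbb{C}^n)), \qquad T \mapsto \bigoplus_{\boldsymbol{\kappa} \in \mathbb{N}^m} T|_{\mathcal{P}_{\boldsymbol{\kappa}}(\mathbb{C}^n)}, \] is an isomorphism of $C^*$-algebras.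
   Context: Here $\mathbb{N}=\{0,1,2,\dots\}$ and $\mathbb{Z}_+$ is the set of positive integers. $\mathbb{B}^n$ is the open unit ball of $\mathbb{C}^n$ with Lebesgue measure $v$. For $\lambda>-1$, $dv_\lambda(z) = c_\lambda (1-|z|^2)^\lambda dv(z)$ with $c_\lambda = \frac{\Gamma(n+\lambda+1)}{\pi^n\Gamma(\lambda+1)}$, and $\mathcal{A}^2_\lambda(\mathbb{B}^n)$ is the closed subspace of holomorphic functions in $L^2(\mathbb{B}^n,v_\lambda)$. $\pi_\lambda$ is the unitary representation of $\mathrm{U}(n)$ on $\mathcal{A}^2_\lambda(\mathbb{B}^n)$ given by $\pi_\lambda(A)f=f\circ A^{-1}$. For a subgroup $H\subset\mathrm{U}(n)$, $\mathrm{End}_H(\mathcal{A}^2_\lambda(\mathbb{B}^n))$ is the $C^*$-algebra of bounded operators $T$ on $\mathcal{A}^2_\lambda(\mathbb{B}^n)$ with $T\pi_\lambda(A)=\pi_\lambda(A)T$ for all $A\in H$. A partition of $n$ is $\boldsymbol{k}=(k_1,\dots,k_m)\in\mathbb{Z}_+^m$ with $k_1+\dots+k_m=n$. It gives $\mathbb{C}^n=\mathbb{C}^{k_1}\times\dots\times\mathbb{C}^{k_m}$, $z=(z_{(1)},\dots,z_{(m)})$ and, for multi-indices, $\alpha=(\alpha_{(1)},\dots,\alpha_{(m)})\in\mathbb{N}^n$ with $\alpha_{(j)}\in\mathbb{N}^{k_j}$. $\mathbb{T}^m=\{(t_1I_{(1)},\dots,t_mI_{(m)}) : t_j\in\mathbb{T}\}\subset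 \mathrm{U}(n)$, where $I_{(j)}$ is the identity on $\mathbb{C}^{k_j}$. For $\boldsymbol{\kappa}\in\mathbb{N}^m$, $\mathcal{P}_{\boldsymbol{\kappa}}(\mathbb{C}^n)$ is the linear span of the monomials $z^\alpha$ with $|\alpha_{(j)}|=\kappa_j$ for all $j$, considered as a (finite dimensional) subspace of $\mathcal{A}^2_\lambda(\mathbb{B}^n)$ with the induced inner product. The direct sum of $C^*$-algebras $\bigoplus_{\boldsymbol{\kappa}}\mathrm{End}(\mathcal{P}_{\boldsymbol{\kappa}}(\mathbb{C}^n))$ is the $C^*$-algebra of families $(T_{\boldsymbol{\kappa}})_{\boldsymbol{\kappa}}$ with $\sup_{\boldsymbol{\kappa}}\|T_{\boldsymbol{\kappa}}\|<\infty$, with componentwise operations and supremum norm. *)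

(* Defs.v *)
From HB Require Import structures.
From mathcomp Require Import all_boot all_order all_algebra.
From mathcomp Require Import complex.
From mathcomp Require Import all_classical all_reals all_analysis measurable_realfun.
From mathcomp Require Import lra.

Set Implicit Arguments.
Unset Strict Implicit.
Unset Printing Implicit Defensive.

Import Order.TTheory GRing.Theory Num.Theory.
Import numFieldNormedType.Exports.

Local Open Scope classical_set_scope.
Local Open Scope ring_scope.
Local Open Scope complex_scope.

Notation normc := Normc.normc.

Section LinearMaps.
Context (K : comNzRingType) (U V : lmodType K).
Implicit Types f g : {linear U -> V}.

Lemma linear_ext f g : f =1 g -> f = g.
Proof.
case: f g => [f [[Af] [Bf]]] [g [[Ag] [Bg]]] /= /funext fg; subst g.
by rewrite (Prop_irrelevance Af Ag) (Prop_irrelevance Bf Bg).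
Qed.

Let lin_add f g : {linear U -> V} := f \+ g.
Let lin_opp f : {linear U -> V} := \- f.
Let lin_zero : {linear U -> V} := \0.
Let lin_scale (a : K) f : {linear U -> V} := a \*: f.

Let lin_addA : associative lin_add.
Proof. by move=> f g h; apply: linear_ext => x /=; rewrite addrA. Qed.
Let lin_addC : commutative lin_add.
Proof. by move=> f g; apply: linear_ext => x /=; rewrite addrC. Qed.
Let lin_add0 : left_id lin_zero lin_add.
Proof. by move=> f; apply: linear_ext => x /=; rewrite add0r. Qed.
Let lin_addN : left_inverse lin_zero lin_opp lin_add.
Proof. by move=> f; apply: linear_ext => x /=; rewrite addNr. Qed.

HB.instance Definition _ :=
  GRing.isZmodule.Build {linear U -> V} lin_addA lin_addC lin_add0 lin_addN.

Let lin_scaleA a b f : lin_scale a (lin_scale b f) = lin_scale (a * b) f.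
Proof. by apply: linear_ext => x /=; rewrite scalerA. Qed.
Let lin_scale1 : left_id 1 lin_scale.
Proof. by move=> f; apply: linear_ext => x /=; rewrite scale1r. Qed.
Let lin_scaleDr : right_distributive lin_scale +%R.
Proof. by move=> a f g; apply: linear_ext => x /=; rewrite scalerDr. Qed.
Let lin_scaleDl f : {morph lin_scale^~ f : a b / a + b}.
Proof. by move=> a b; apply: linear_ext => x /=; rewrite scalerDl. Qed.

HB.instance Definition _ := GRing.Zmodule_isLmodule.Build K {linear U -> V}
  lin_scaleA lin_scale1 lin_scaleDr lin_scaleDl.

Lemma lin_addE f g x : (f + g) x = f x + g x. Proof. by []. Qed.
Lemma lin_scaleE a f x : (a *: f) x = a *: f x. Proof. by []. Qed.
Lemma lin_zeroE x : (0 : {linear U -> V}) x = 0. Proof. by []. Qed.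

End LinearMaps.

(* m1 \x m2 again: the library proves that it is sigma-finite, but canonical
   inference does not find this. *)
Section ProductMeasure.
Context d1 d2 (T1 : measurableType d1) (T2 : measurableType d2) (R : realType).
Context (m1 : {sigma_finite_measure set T1 -> \bar R}).
Context (m2 : {sigma_finite_measure set T2 -> \bar R}).

Definition product_measure : set (T1 * T2) -> \bar R := (m1 \x m2)%E.

HB.instance Definition _ := Measure.on product_measure.

Let product_measure_sigma_finite : sigma_finite setT product_measure.
Proof.
have /sigma_finiteP[F [TF ndF Foo]] := sigma_finiteT m1.
have /sigma_finiteP[G [TG ndG Goo]] := sigma_finiteT m2.
exists (fun n => F n `*` G n).
  rewrite -setXTT TF TG predeqE => -[x y]; split.
    move=> [/= [n _ Fnx] [k _ Gky]]; exists (maxn n k) => //; split.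
      by move: x Fnx; exact/subsetPset/ndF/leq_maxl.
    by move: y Gky; exact/subsetPset/ndG/leq_maxr.
  by move=> [n _ []/= ? ?]; split; exists n.
move=> k; have [? ?] := Foo k; have [? ?] := Goo k.
split; first exact: measurableX.
by rewrite /product_measure product_measure1E// lte_mul_pinfty// ge0_fin_numE.
Qed.

HB.instance Definition _ := Measure_isSigmaFinite.Build _ _ _ product_measure
  product_measure_sigma_finite.

End ProductMeasure.

Section LebesgueMeasure.
Context (R : realType).

Local Notation plane := (measurableTypeR R * measurableTypeR R)%type.

Definition plane_measure : {sigma_finite_measure set plane -> \bar R} :=
  product_measure (@lebesgue_measure R) (@lebesgue_measure R).

Definition tuple_cons n (p : plane * n.-tuple plane) : n.+1.-tuple plane :=
  [tuple of p.1 :: p.2].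

Lemma measurable_tuple_cons n : measurable_fun setT (@tuple_cons n).
Proof. by apply: measurable_cons; [exact: measurable_fst|exact: measurable_snd]. Qed.

Section Step.
Context n (mu : {sigma_finite_measure set (n.-tuple plane) -> \bar R}).

Definition lebesgue_step : set (n.+1.-tuple plane) -> \bar R :=
  pushforward (product_measure plane_measure mu) (@tuple_cons n).

Let step_measure := measure_function_pushforward__canonical__measure_function_Measure
  (product_measure plane_measure mu) (@measurable_tuple_cons n).

HB.instance Definition _ := isMeasure.Build _ _ _ lebesgue_step
  (measure0 step_measure) (measure_ge0 step_measure)
  (@measure_semi_sigma_additive _ _ _ step_measure).

Let lebesgue_step_sigma_finite : sigma_finite setT lebesgue_step.
Proof.
have [F FT mF] := sigma_finiteT (product_measure plane_measure mu).
pose uncons (t : n.+1.-tuple plane) := (thead t, [tuple of behead t]).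
have muncons : measurable_fun setT uncons.
  apply/measurable_fun_pairP; split.
    exact: measurable_tnth.
  exact: measurable_behead.
have consK p : uncons (tuple_cons p) = p.
  by case: p => x t; rewrite /uncons theadE; congr pair; exact/val_inj.
exists (fun i => uncons @^-1` F i).
  by rewrite -preimage_bigcup -FT preimage_setT.
move=> i; have [mFi Fioo] := mF i; split.
  by rewrite -[X in measurable X]setTI; exact: muncons.
rewrite /lebesgue_step /pushforward -comp_preimage.
rewrite (_ : uncons \o _ = id) ?preimage_id//.
by apply/funext => p /=.
Qed.

HB.instance Definition _ := Measure_isSigmaFinite.Build _ _ _ lebesgue_step
  lebesgue_step_sigma_finite.

End Step.

(* Lebesgue measure on C^n, in the real coordinates of (R^2)^n: the iterated
   product of the Lebesgue measure of the plane. *)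
Fixpoint lebesgue_Cn n : {sigma_finite_measure set (n.-tuple plane) -> \bar R} :=
  match n with
  | 0 => \d_ ([tuple] : 0.-tuple plane)
  | n'.+1 => lebesgue_step (lebesgue_Cn n')
  end.

End LebesgueMeasure.

HB.instance Definition _ (R : realType) := NormedModule.copy R[i] (R[i])^o.

Section BergmanSpace.
Context {R : realType}.
Local Notation C := R[i].
Local Notation plane := (measurableTypeR R * measurableTypeR R)%type.

Definition Gamma (x : R) : R :=
  \int[@lebesgue_measure R]_(t in `]0, +oo[) (t `^ (x - 1) * expR (- t)).

Section Ball.
Context {n : nat}.

Definition of_real_coords (t : n.-tuple plane) : 'cV[C]_n :=
  \col_j ((tnth t j).1 +i* (tnth t j).2).

Definition sqnorm (z : 'cV[C]_n) : R := \sum_j normc (z j 0) ^+ 2.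

Definition unit_ball : set 'cV[C]_n := [set z | sqnorm z < 1].

Definition ball_coords : set (n.-tuple plane) := of_real_coords @^-1` unit_ball.

(* Complex differentiability: the scalar field of 'cV[C]_n is C. *)
Definition holomorphic (f : 'cV[C]_n -> C) : Prop :=
  forall z, unit_ball z -> differentiable f z.

End Ball.

(* c_lambda (1 - |z|^2)^lambda *)
Definition bergman_density n (lambda : R) (z : 'cV[C]_n) : R :=
  Gamma (n%:R + lambda + 1) / (pi ^+ n * Gamma (lambda + 1))
  * (1 - sqnorm z) `^ lambda.

Definition integral_ball n lambda (h : 'cV[C]_n -> R) : \bar R :=
  (\int[lebesgue_Cn R n]_(t in ball_coords)
     (h (of_real_coords t) * bergman_density lambda (of_real_coords t))%:E)%E.

Definition square_integrable n lambda (f : 'cV[C]_n -> C) : Prop :=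
  [/\ measurable_fun ball_coords (fun t => complex.Re (f (of_real_coords t))),
      measurable_fun ball_coords (fun t => complex.Im (f (of_real_coords t))) &
      (integral_ball lambda (fun z => (normc (f z) ^+ 2)%R) < +oo)%E].

(* Functions on the ball are extended by 0, so that equality of functions on
   the whole of C^n is equality on the ball. *)
Definition bergman_pred n lambda : {pred 'cV[C]_n -> C} := fun f =>
  `[< [/\ forall z, ~ unit_ball z -> f z = 0,
          holomorphic f & square_integrable lambda f] >].

Lemma Gamma_ge0 x : 0 <= Gamma x.
Proof.
by apply: Rintegral_ge0 => t _; rewrite mulr_ge0 ?powR_ge0 ?expR_ge0.
Qed.

Lemma bergman_density_ge0 n lambda (z : 'cV[C]_n) : 0 <= bergman_density lambda z.
Proof.
rewrite mulr_ge0 ?powR_ge0// mulr_ge0 ?Gamma_ge0// invr_ge0.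
by rewrite mulr_ge0 ?Gamma_ge0// exprn_ge0// pi_ge0.
Qed.

Lemma sqr_normc_ReIm (x : C) : normc x ^+ 2 = complex.Re x ^+ 2 + complex.Im x ^+ 2.
Proof. by case: x => a b; rewrite /normc sqr_sqrtr// addr_ge0 ?sqr_ge0. Qed.

Lemma sqr_normc_combination (a x y : C) :
  normc (a * x + y) ^+ 2 <= 2 * normc a ^+ 2 * normc x ^+ 2 + 2 * normc y ^+ 2.
Proof.
rewrite -mulrA -exprMn -Normc.normcM; move: (a * x) => {a x}x.
rewrite !sqr_normc_ReIm; case: x y => [a b] [c d] /=.
by have := sqr_ge0 (a - c); have := sqr_ge0 (b - d); rewrite !expr2; lra.
Qed.

Lemma measurable_real_coord n (i : 'I_n) :
  measurable_fun setT (fun t : n.-tuple plane => (tnth t i).1) /\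
  measurable_fun setT (fun t : n.-tuple plane => (tnth t i).2).
Proof.
split; apply: measurableT_comp (measurable_tnth i).
  exact: measurable_fst.
exact: measurable_snd.
Qed.

Lemma measurable_sqnorm n :
  measurable_fun setT (fun t : n.-tuple plane => sqnorm (of_real_coords t)).
Proof.
rewrite /sqnorm; under eq_fun do under eq_bigr do rewrite mxE sqr_normc_ReIm /=.
apply: measurable_sum => i; have [m1 m2] := measurable_real_coord i.
by apply: measurable_funD; apply: measurable_funX.
Qed.

Lemma measurable_ball_coords n : measurable (@ball_coords n).
Proof.
have := @measurable_sqnorm n measurableT _ (measurable_itv `]-oo, 1[%R).
rewrite setTI; congr measurable; apply/seteqP; split => t /=;
  by rewrite /ball_coords /unit_ball /= in_itv.
Qed.

Lemma measurable_bergman_density n lambda (D : set (n.-tuple plane)) :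
  measurable_fun D (fun t => bergman_density lambda (of_real_coords t)).
Proof.
apply: measurable_funTS; apply: measurable_funM => //.
have m1 : measurable_fun setT (fun t : n.-tuple plane => 1 - sqnorm (of_real_coords t)).
  by apply: measurable_funB => //; exact: measurable_sqnorm.
exact: (measurableT_comp (measurable_powR lambda) m1).
Qed.

Lemma measurable_sqr_normc d (T : measurableType d) (D : set T) (f : T -> C) :
  measurable_fun D (fun t => complex.Re (f t)) ->
  measurable_fun D (fun t => complex.Im (f t)) ->
  measurable_fun D (fun t => normc (f t) ^+ 2).
Proof.
move=> mr mi; under eq_fun do rewrite sqr_normc_ReIm.
by apply: measurable_funD; apply: measurable_funX.
Qed.

Lemma Re_combination (a x y : C) : complex.Re (a * x + y) =
  complex.Re a * complex.Re x - complex.Im a * complex.Im x + complex.Re y.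
Proof. by case: a x y => [? ?] [? ?] [? ?]. Qed.

Lemma Im_combination (a x y : C) : complex.Im (a * x + y) =
  complex.Re a * complex.Im x + complex.Im a * complex.Re x + complex.Im y.
Proof. by case: a x y => [? ?] [? ?] [? ?]. Qed.

Lemma integral_combination n lambda (a : C) (f g : 'cV[C]_n -> C) :
  square_integrable lambda f -> square_integrable lambda g ->
  square_integrable lambda (a *: f + g) /\
  (integral_ball lambda (fun z => (normc ((a *: f + g) z) ^+ 2)%R) <=
   (2 * normc a ^+ 2)%R%:E * integral_ball lambda (fun z => (normc (f z) ^+ 2)%R) +
   2%R%:E * integral_ball lambda (fun z => (normc (g z) ^+ 2)%R))%E.
Proof.
move=> [rf jf ff] [rg ig fg].
have mD := @measurable_ball_coords n.
have rh : measurable_fun ball_coords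
    (fun t => complex.Re ((a *: f + g) (of_real_coords t))).
  rewrite (_ : (fun t => _) = (fun t => complex.Re a * complex.Re (f (of_real_coords t))
     - complex.Im a * complex.Im (f (of_real_coords t))
     + complex.Re (g (of_real_coords t)))); last first.
    by apply/funext => t; exact: Re_combination.
  by apply: measurable_funD => //; apply: measurable_funB; apply: measurable_funM.
have ih : measurable_fun ball_coords
    (fun t => complex.Im ((a *: f + g) (of_real_coords t))).
  rewrite (_ : (fun t => _) = (fun t => complex.Re a * complex.Im (f (of_real_coords t))
     + complex.Im a * complex.Re (f (of_real_coords t))
     + complex.Im (g (of_real_coords t)))); last first.
    by apply/funext => t; exact: Im_combination.
  by apply: measurable_funD => //; apply: measurable_funD; apply: measurable_funM.
have mw := @measurable_bergman_density n lambda ball_coords.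
have w0 (h : 'cV[C]_n -> C) (t : n.-tuple plane) :
    (0 <= (normc (h (of_real_coords t)) ^+ 2 *
           bergman_density lambda (of_real_coords t))%:E)%E.
  by rewrite lee_fin mulr_ge0 ?sqr_ge0 ?bergman_density_ge0.
have mI (h : 'cV[C]_n -> C) :
    measurable_fun ball_coords (fun t => complex.Re (h (of_real_coords t))) ->
    measurable_fun ball_coords (fun t => complex.Im (h (of_real_coords t))) ->
    measurable_fun ball_coords (fun t => (normc (h (of_real_coords t)) ^+ 2 *
           bergman_density lambda (of_real_coords t))%:E).
  move=> mr mi; apply/measurable_EFinP; apply: measurable_funM => //.
  exact: measurable_sqr_normc.
have k0 : 0 <= 2 * normc a ^+ 2 by rewrite mulr_ge0 ?sqr_ge0.
have mIf := mI _ rf jf; have mIg := mI _ rg ig; have mIh := mI _ rh ih.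
have le_h : (integral_ball lambda (fun z => (normc ((a *: f + g) z) ^+ 2)%R) <=
   (2 * normc a ^+ 2)%R%:E * integral_ball lambda (fun z => (normc (f z) ^+ 2)%R) +
   2%R%:E * integral_ball lambda (fun z => (normc (g z) ^+ 2)%R))%E.
  rewrite /integral_ball -!ge0_integralZl_EFin//.
  have pos c (h : 'cV[C]_n -> C) (t : n.-tuple plane) : 0 <= c ->
      (0 <= c%:E * (normc (h (of_real_coords t)) ^+ 2 *
        bergman_density lambda (of_real_coords t))%:E)%E.
    by move=> c0; rewrite mule_ge0.
  rewrite -ge0_integralD//; try by [move=> t _; exact: pos|exact: measurable_funeM].
  apply: ge0_le_integral => //.
    by apply: emeasurable_funD; exact: measurable_funeM.
  move=> t _; rewrite -!EFinM -EFinD lee_fin.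
  have /(ler_wpM2r (bergman_density_ge0 lambda (of_real_coords t))) :=
    sqr_normc_combination a (f (of_real_coords t)) (g (of_real_coords t)).
  by rewrite mulrDl -2!(mulrA 2) -(mulrA (normc a ^+ 2)) -!(mulrA 2).
split => //; split => //; apply: le_lt_trans le_h _.
by rewrite lte_add_pinfty// lte_mul_pinfty// lee_fin.
Qed.

Lemma square_integrable0 n lambda : square_integrable lambda (0 : 'cV[C]_n -> C).
Proof.
split; [exact: measurable_cst|exact: measurable_cst|].
rewrite /integral_ball integral0_eq// => t _.
by rewrite Normc.normc0 expr0n/= mul0r.
Qed.

Lemma bergman_pred_submod n lambda : submod_closed (@bergman_pred n lambda).
Proof.
split => [|a f g /asboolP[f0 df If] /asboolP[g0 dg Ig]]; apply/asboolP; split.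
- by [].
- by move=> z _; exact: differentiable_cst.
- exact: square_integrable0.
- by move=> z zB; rewrite -[LHS]/(a * f z + g z) (f0 _ zB) (g0 _ zB) mulr0 addr0.
- move=> z zB; apply: differentiableD; last exact: dg.
  by apply: differentiableZ; exact: df.
- by have [] := integral_combination a If Ig.
Qed.

HB.instance Definition _ n lambda :=
  GRing.isSubmodClosed.Build C ('cV[C]_n -> C) (@bergman_pred n lambda)
    (@bergman_pred_submod n lambda).

Record bergman n lambda := Bergman {
  bergman_fun :> 'cV[C]_n -> C;
  bergmanP : bergman_fun \in @bergman_pred n lambda }.

HB.instance Definition _ n lambda := [isSub for @bergman_fun n lambda].
HB.instance Definition _ n lambda := [Choice of @bergman n lambda by <:].
HB.instance Definition _ n lambda :=
  [SubChoice_isSubLmodule of @bergman n lambda by <:].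

End BergmanSpace.

(* A complex algebra with involution and norm; a C*-algebra is one satisfying
   the usual axioms. *)
Record star_algebra (R : realType) := StarAlgebra {
  star_carrier :> lmodType R[i];
  star_mul : star_carrier -> star_carrier -> star_carrier;
  star_adj : star_carrier -> star_carrier;
  star_norm : star_carrier -> R }.

Definition cstar_isomorphism (R : realType) (A B : star_algebra R)
    (Phi : A -> B) : Prop :=
  [/\ linear Phi, bijective Phi,
      {morph Phi : S T / star_mul S T >-> star_mul S T},
      {morph Phi : T / star_adj T >-> star_adj T} &
      forall T, star_norm (Phi T) = star_norm T].

(* Operators on a complex vector space U with norm N and inner product dot. *)
Section Operators.
Context (R : realType) (U : lmodType R[i]) (N : U -> R) (dot : U -> U -> R[i]).
Implicit Types S T : U -> U.

Definition bounded_by (M : R) T : Prop := forall u, N (T u) <= M * N u.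

Definition opnorm T : R := sup [set N (T u) | u in [set u | N u <= 1]].

Definition is_adjoint T S : Prop := forall u v, dot (T u) v = dot u (S v).

Hypothesis N_ge0 : forall u, 0 <= N u.
Hypothesis N_combination : forall a u v,
  N (a *: u + v) ^+ 2 <= 2 * normc a ^+ 2 * N u ^+ 2 + 2 * N v ^+ 2.

Lemma bounded_by_combination M1 M2 a S T : bounded_by M1 S -> bounded_by M2 T ->
  bounded_by (Num.sqrt (2 * normc a ^+ 2 * M1 ^+ 2 + 2 * M2 ^+ 2))
    (fun u => a *: S u + T u).
Proof.
move=> bS bT u; set K := 2 * _ * _ + _.
have K0 : 0 <= K.
  apply: addr_ge0; apply: mulr_ge0; rewrite ?sqr_ge0//.
  by apply: mulr_ge0; rewrite ?sqr_ge0.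
rewrite -(@ler_pXn2r _ 2%N)// ?nnegrE ?mulr_ge0 ?sqrtr_ge0//.
apply: (le_trans (N_combination _ _ _)); rewrite exprMn sqr_sqrtr// /K [leRHS]mulrDl.
have sq x y : 0 <= x -> x <= y -> x ^+ 2 <= y ^+ 2.
  by move=> x0 xy; rewrite ler_pXn2r ?nnegrE// (le_trans x0).
apply: lerD; rewrite -[leRHS]mulrA.
  apply: ler_wpM2l; first by apply: mulr_ge0; rewrite ?sqr_ge0.
  by rewrite -exprMn; exact: sq.
by apply: ler_wpM2l => //; rewrite -exprMn; exact: sq.
Qed.

Lemma bounded_by_comp M1 M2 S T : bounded_by M1 S -> bounded_by M2 T ->
  bounded_by (Num.max M1 0 * M2) (S \o T).
Proof.
move=> bS bT u /=; apply: (le_trans (bS _)).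
apply: (@le_trans _ _ (Num.max M1 0 * N (T u))).
  by rewrite ler_wpM2r// le_max lexx.
by rewrite -mulrA ler_wpM2l// le_max lexx orbT.
Qed.

End Operators.

Section BergmanOperators.
Context {R : realType} {n : nat} {lambda : R}.
Local Notation C := R[i].
Local Notation A2 := (@bergman R n lambda).

Definition bergman_norm (f : A2) : R :=
  Num.sqrt (fine (integral_ball lambda (fun z => normc (f z) ^+ 2))).

Definition bergman_dot (f g : A2) : C :=
  fine (integral_ball lambda (fun z => complex.Re (f z * (g z)^*%C))) +i*
  fine (integral_ball lambda (fun z => complex.Im (f z * (g z)^*%C))).

(* The graph of pi_lambda(A): g = f \o A^-1. *)
Definition unitary_action (A : 'M[C]_n) (f g : A2) : Prop :=
  forall z, g z = f (invmx A *m z).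

(* The bounded operators commuting with pi_lambda(A) for all A in H. For A
   unitary, v_lambda is invariant under A, so that unitary_action A is the graph
   of an everywhere defined map. *)
Definition endomorphism_pred (H : set 'M[C]_n) : {pred {linear A2 -> A2}} :=
  fun T => `[< (exists M, bounded_by bergman_norm M T) /\
    forall A, H A -> forall f g,
      unitary_action A f g -> unitary_action A (T f) (T g) >].

Lemma bergman_norm_ge0 (f : A2) : 0 <= bergman_norm f.
Proof. exact: sqrtr_ge0. Qed.

Lemma sqr_bergman_norm (f : A2) :
  (bergman_norm f ^+ 2)%:E =
  integral_ball lambda (fun z => normc (f z) ^+ 2) :> \bar R.
Proof.
have /asboolP[_ _ [_ _ fin]] := bergmanP f.
have I0 : (0 <= integral_ball lambda (fun z => (normc (f z) ^+ 2)%R))%E.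
  apply: integral_ge0 => t _.
  by rewrite lee_fin mulr_ge0 ?sqr_ge0 ?bergman_density_ge0.
by rewrite /bergman_norm sqr_sqrtr ?fine_ge0// fineK// ge0_fin_numE.
Qed.

Lemma bergman_norm_combination a (f g : A2) :
  bergman_norm (a *: f + g) ^+ 2 <=
  2 * normc a ^+ 2 * bergman_norm f ^+ 2 + 2 * bergman_norm g ^+ 2.
Proof.
have /asboolP[_ _ If] := bergmanP f; have /asboolP[_ _ Ig] := bergmanP g.
have [_] := integral_combination a If Ig.
rewrite -[X in (X <= _)%E]/(integral_ball lambda
  (fun z => (normc ((a *: f + g : A2) z) ^+ 2)%R)).
by rewrite -!sqr_bergman_norm -!EFinM -EFinD lee_fin.
Qed.

Lemma bergman_norm0 : bergman_norm 0 = 0.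
Proof.
apply/eqP; rewrite -sqrf_eq0 -eqe sqr_bergman_norm; apply/eqP.
apply: integral0_eq => t _.
have -> : normc ((0 : A2) (of_real_coords t)) = 0 by exact: Normc.normc0.
by rewrite expr0n/= mul0r.
Qed.

Section Endomorphisms.
Context (H : set 'M[C]_n).

Lemma endomorphism_pred_submod : submod_closed (endomorphism_pred H).
Proof.
split=> [|a S T /asboolP[[M1 bS] cS] /asboolP[[M2 bT] cT]]; apply/asboolP; split.
- by exists 0 => f; rewrite lin_zeroE bergman_norm0 mul0r.
- by [].
- exists (Num.sqrt (2 * normc a ^+ 2 * M1 ^+ 2 + 2 * M2 ^+ 2)).
  apply: bounded_by_combination bS bT; first exact: bergman_norm_ge0.
  exact: bergman_norm_combination.
- move=> A HA f g fg z.
  exact: (congr2 (fun x y => a * x + y) (cS A HA f g fg z) (cT A HA f g fg z)).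
Qed.

HB.instance Definition _ := GRing.isSubmodClosed.Build C {linear A2 -> A2}
  (endomorphism_pred H) endomorphism_pred_submod.

Record endomorphism := Endomorphism {
  endomorphism_fun :> {linear A2 -> A2};
  endomorphismP : endomorphism_fun \in endomorphism_pred H }.

HB.instance Definition _ := [isSub for endomorphism_fun].
HB.instance Definition _ := [Choice of endomorphism by <:].
HB.instance Definition _ := [SubChoice_isSubLmodule of endomorphism by <:].

Lemma endomorphism_comp_subproof (S T : endomorphism) :
  (S \o T : {linear A2 -> A2}) \in endomorphism_pred H.
Proof.
have /asboolP[[M1 bS] cS] := endomorphismP S.
have /asboolP[[M2 bT] cT] := endomorphismP T.
apply/asboolP; split; last by move=> A HA f g fg; apply: cS => //; exact: cT.
exists (Num.max M1 0 * M2); apply: bounded_by_comp bS bT.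
exact: bergman_norm_ge0.
Qed.

Definition endomorphism_comp (S T : endomorphism) : endomorphism :=
  Endomorphism (endomorphism_comp_subproof S T).

(* The adjoint exists because A2 is a Hilbert space and, for H a group of
   unitary matrices, it commutes with pi_lambda(H); it is unique. *)
Definition endomorphism_adj (T : endomorphism) : endomorphism :=
  xget 0 [set S : endomorphism | is_adjoint bergman_dot T S].

Definition endomorphism_algebra : star_algebra R :=
  StarAlgebra endomorphism_comp endomorphism_adj
    (fun T : endomorphism => opnorm bergman_norm T).

End Endomorphisms.
End BergmanOperators.

Arguments endomorphism {R n} lambda H.
Arguments endomorphism_algebra {R n} lambda H.

(* A partition k = (k_1, ..., k_m) of n = \sum_j k_j; coordinate i of C^n lies
   in the block tagnat.sig1 i. *)
Section Partition.
Context {R : realType} {m : nat} (k : 'I_m -> nat) (lambda : R).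
Local Notation C := R[i].
Local Notation n := (\sum_(j < m) k j)%N.
Local Notation A2 := (@bergman R n lambda).

Definition block_torus : set 'M[C]_n :=
  [set A | exists t : 'I_m -> C,
     (forall j, `|t j| = 1) /\ A = \mxdiag_(j < m) ((t j)%:M : 'M[C]_(k j))].

Definition block_degree (alpha : {ffun 'I_n -> nat}) : {ffun 'I_m -> nat} :=
  [ffun j => \sum_(i | tagnat.sig1 i == j) alpha i]%N.

Definition monomial (alpha : {ffun 'I_n -> nat}) (z : 'cV[C]_n) : C :=
  \prod_i z i 0 ^+ alpha i.

Section HomogeneousPolynomials.
Context (kappa : {ffun 'I_m -> nat}).

(* The linear combinations, on the ball, of the monomials z^alpha with block
   degree kappa. *)
Definition hpoly_pred : {pred A2} := fun f =>
  `[< exists2 s : seq (C * {ffun 'I_n -> nat}),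
        forall p, p \in s -> block_degree p.2 = kappa &
        forall z, unit_ball z -> f z = \sum_(p <- s) p.1 * monomial p.2 z >].

Lemma hpoly_pred_submod : submod_closed hpoly_pred.
Proof.
split=> [|a f g /asboolP[s sP sE] /asboolP[t tP tE]]; apply/asboolP.
  by exists [::] => // z _; rewrite big_nil.
exists ([seq (a * p.1, p.2) | p <- s] ++ t).
  move=> p; rewrite mem_cat => /orP[/mapP[q qs ->]|]; [exact: (sP q qs)|exact: tP].
move=> z zB; rewrite big_cat big_map /=.
transitivity (a * f z + g z) => //; rewrite (sE _ zB) (tE _ zB) mulr_sumr.
by congr (_ + _); apply: eq_bigr => p _; rewrite mulrA.
Qed.

HB.instance Definition _ :=
  GRing.isSubmodClosed.Build C A2 hpoly_pred hpoly_pred_submod.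

Record hpoly := Hpoly { hpoly_val :> A2; hpolyP : hpoly_val \in hpoly_pred }.

HB.instance Definition _ := [isSub for hpoly_val].
HB.instance Definition _ := [Choice of hpoly by <:].
HB.instance Definition _ := [SubChoice_isSubLmodule of hpoly by <:].

Definition hpoly_norm (p : hpoly) : R := bergman_norm p.
Definition hpoly_dot (p q : hpoly) : C := bergman_dot p q.

End HomogeneousPolynomials.

(* Families of linear operators; on a finite dimensional space they are all
   bounded. *)
Definition hpoly_family : Type :=
  forall kappa, {linear hpoly kappa -> hpoly kappa}.

HB.instance Definition _ := gen_eqMixin hpoly_family.
HB.instance Definition _ := gen_choiceMixin hpoly_family.

Let family_add (S T : hpoly_family) : hpoly_family := fun kappa => S kappa + T kappa.
Let family_opp (T : hpoly_family) : hpoly_family := fun kappa => - T kappa.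
Let family_zero : hpoly_family := fun kappa => 0.
Let family_scale a (T : hpoly_family) : hpoly_family := fun kappa => a *: T kappa.

Let family_addA : associative family_add.
Proof. by move=> S T W; apply: functional_extensionality_dep => ?; apply: addrA. Qed.
Let family_addC : commutative family_add.
Proof. by move=> S T; apply: functional_extensionality_dep => ?; apply: addrC. Qed.
Let family_add0 : left_id family_zero family_add.
Proof. by move=> T; apply: functional_extensionality_dep => ?; apply: add0r. Qed.
Let family_addN : left_inverse family_zero family_opp family_add.
Proof. by move=> T; apply: functional_extensionality_dep => ?; apply: addNr. Qed.

HB.instance Definition _ := GRing.isZmodule.Build hpoly_family
  family_addA family_addC family_add0 family_addN.

Let family_scaleA a b T : family_scale a (family_scale b T) = family_scale (a * b) T.
Proof. by apply: functional_extensionality_dep => ?; apply: scalerA. Qed.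
Let family_scale1 : left_id 1 family_scale.
Proof. by move=> T; apply: functional_extensionality_dep => ?; apply: scale1r. Qed.
Let family_scaleDr : right_distributive family_scale +%R.
Proof. by move=> a S T; apply: functional_extensionality_dep => ?; apply: scalerDr. Qed.
Let family_scaleDl T : {morph family_scale^~ T : a b / a + b}.
Proof. by move=> a b; apply: functional_extensionality_dep => ?; apply: scalerDl. Qed.

HB.instance Definition _ := GRing.Zmodule_isLmodule.Build C hpoly_family
  family_scaleA family_scale1 family_scaleDr family_scaleDl.

Definition direct_sum_pred : {pred hpoly_family} := fun T =>
  `[< exists M, forall kappa, bounded_by (@hpoly_norm kappa) M (T kappa) >].

Lemma direct_sum_pred_submod : submod_closed direct_sum_pred.
Proof.
split=> [|a S T /asboolP[M1 bS] /asboolP[M2 bT]]; apply/asboolP.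
  by exists 0 => kappa p; rewrite /hpoly_norm lin_zeroE bergman_norm0 mul0r.
exists (Num.sqrt (2 * normc a ^+ 2 * M1 ^+ 2 + 2 * M2 ^+ 2)) => kappa.
apply: bounded_by_combination (bS kappa) (bT kappa).
  by move=> p; exact: bergman_norm_ge0.
by move=> b p q; exact: bergman_norm_combination.
Qed.

HB.instance Definition _ := GRing.isSubmodClosed.Build C hpoly_family
  direct_sum_pred direct_sum_pred_submod.

Record direct_sum := DirectSum {
  component : hpoly_family;
  direct_sumP : component \in direct_sum_pred }.

HB.instance Definition _ := [isSub for component].
HB.instance Definition _ := [Choice of direct_sum by <:].
HB.instance Definition _ := [SubChoice_isSubLmodule of direct_sum by <:].

Lemma direct_sum_mul_subproof (S T : direct_sum) :
  ((fun kappa => component S kappa \o component T kappa) : hpoly_family)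
    \in direct_sum_pred.
Proof.
have /asboolP[M1 bS] := direct_sumP S; have /asboolP[M2 bT] := direct_sumP T.
apply/asboolP; exists (Num.max M1 0 * M2) => kappa.
apply: bounded_by_comp (bS kappa) (bT kappa).
by move=> p; exact: bergman_norm_ge0.
Qed.

Definition direct_sum_mul (S T : direct_sum) : direct_sum :=
  DirectSum (direct_sum_mul_subproof S T).

(* The family of the adjoints, which have the same norms. *)
Definition direct_sum_adj (T : direct_sum) : direct_sum :=
  xget 0 [set S : direct_sum | forall kappa,
    is_adjoint (@hpoly_dot kappa) (component T kappa) (component S kappa)].

Definition direct_sum_norm (T : direct_sum) : R :=
  sup (range (fun kappa => opnorm (@hpoly_norm kappa) (component T kappa))).

Definition direct_sum_algebra : star_algebra R :=
  StarAlgebra direct_sum_mul direct_sum_adj direct_sum_norm.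

End Partition.

Arguments block_torus R {m} k _.
Arguments hpoly_pred {R m} k lambda kappa.
Arguments hpoly {R m} k lambda kappa.
Arguments direct_sum {R m} k lambda.
Arguments direct_sum_algebra {R m} k lambda.

(* Main.v *)
(* The spaces P_kappa are pairwise orthogonal, since T^m acts on them by distinct characters, and
   every f in A^2 is the sum of its components in them.  An equivariant operator sends P_kappa to
   functions transforming under the same character, which have no component in any other P_kappa';
   by continuity it is determined by its restrictions.  Conversely a bounded family acts
   componentwise, and its bounds carry over by Pythagoras.

   The analytic part is the norm convergence of the expansion of f.  Its homogeneous part of degree d
   is the pointwise limit of the averages of w^-d f(w z) over the N-th roots of unity w (Taylor's
   formula on complex lines, from Goursat's theorem on polar rectangles), and it is a polynomial
   because it is holomorphic and homogeneous.  For fixed N the averages are orthogonal and add up to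
   f, so Bessel's inequality passes to the limit by Fatou's lemma; the expansion thus converges in
   A^2, and to f because point evaluations are bounded.  Averaging over roots of unity in each block
   extracts the component in P_kappa.  As only linear combinations of rotations of f and their
   limits occur, it is never needed that the monomials are square integrable. *)

Require Import Defs.
From HB Require Import structures.
From mathcomp Require Import all_boot all_order all_algebra.
From mathcomp Require Import complex.
From mathcomp Require Import all_classical all_reals all_analysis.
From mathcomp Require Import measurable_realfun ring lra.
Import Order.TTheory GRing.Theory Num.Theory.
Import numFieldNormedType.Exports.

Set Implicit Arguments.
Unset Strict Implicit.
Unset Printing Implicit Defensive.

Local Open Scope classical_set_scope.
Local Open Scope ring_scope.
Local Open Scope complex_scope.

(** * One complex variable *)

(** All estimates are real while the norm of [R[i]] takes values in [R[i]]; hence differentiability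
    and convergence are restated with [normc] and [mnorm], and one equivalence,
    [holomorphic_hol_at], leads back to [differentiable]. Polar rectangles are chosen because on a
    full turn the two radial sides cancel: Goursat's theorem then says directly that circle
    integrals do not depend on the radius, down to radius 0. Cauchy's formula results by applying
    this to a difference quotient; its one doubtful point lies on a single circle, and continuity in
    the radius bridges it. Quadratic Taylor estimates that are uniform over a bounded family make
    locally bounded pointwise limits holomorphic; this one closure property serves partial
    derivatives, limits of averages and the completeness of $A^2$. Bounded point evaluations require
    a density bounded below near the point, hence a nonzero normalizing constant, hence the
    convergence of the Gamma integral. The inner product is shown to be definite only after this, so
    Cauchy-Schwarz is proved for a semidefinite form. *)

Section Modulus.
Context {R : realType}.
Local Notation C := R[i].
Implicit Types (x y z : C) (a b : R).

Lemma normc_ge0 x : 0 <= normc x.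
Proof. by case: x => a b; exact: sqrtr_ge0. Qed.

Lemma normc_gt0 x : (0 < normc x) = (x != 0).
Proof.
rewrite lt_neqAle normc_ge0 andbT eq_sym; congr (~~ _).
by apply/eqP/eqP => [/Normc.eq0_normc|->]//; exact: Normc.normc0.
Qed.

Lemma normc_eq0 x : (normc x == 0) = (x == 0).
Proof. by apply/eqP/eqP => [/Normc.eq0_normc|->]//; exact: Normc.normc0. Qed.

Lemma normcB x y : normc (x - y) = normc (y - x).
Proof. by rewrite -normcN opprB. Qed.

Lemma le_normcB x y : normc (x - y) <= normc x + normc y.
Proof. by rewrite (le_trans (le_normcD _ _))// normcN. Qed.

Lemma normc_real a : normc a%:C = `|a|.
Proof. by rewrite /= expr0n/= addr0 sqrtr_sqr. Qed.

Lemma normcX x n : normc (x ^+ n) = normc x ^+ n.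
Proof.
elim: n => [|n IH]; first by rewrite !expr0 Normc.normc1.
by rewrite !exprS Normc.normcM IH.
Qed.

Lemma normc_sum (I : Type) (r : seq I) (P : pred I) (F : I -> C) :
  normc (\sum_(i <- r | P i) F i) <= \sum_(i <- r | P i) normc (F i).
Proof.
elim/big_rec2: _ => [|i u v _ h]; first by rewrite Normc.normc0.
by rewrite (le_trans (le_normcD _ _))// lerD2l.
Qed.

Lemma normc_prod (I : Type) (r : seq I) (P : pred I) (F : I -> C) :
  normc (\prod_(i <- r | P i) F i) = \prod_(i <- r | P i) normc (F i).
Proof.
elim/big_rec2: _ => [|i u v _ <-]; first by rewrite Normc.normc1.
exact: Normc.normcM.
Qed.

Lemma normc_Re x : `|complex.Re x| <= normc x.
Proof.
case: x => a b /=; rewrite -[leLHS]sqrtr_sqr ler_wsqrtr//.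
by rewrite lerDl sqr_ge0.
Qed.

Lemma normc_Im x : `|complex.Im x| <= normc x.
Proof.
case: x => a b /=; rewrite -[leLHS]sqrtr_sqr ler_wsqrtr//.
by rewrite lerDr sqr_ge0.
Qed.

Lemma normc_le_ReIm x : normc x <= `|complex.Re x| + `|complex.Im x|.
Proof.
case: x => a b /=; rewrite -(@ger0_norm _ (`|a| + `|b|)) ?addr_ge0//.
rewrite -sqrtr_sqr ler_wsqrtr// sqrrD !real_normK ?num_real// mulr2n.
by have := mulr_ge0 (normr_ge0 a) (normr_ge0 b); lra.
Qed.

Lemma normcE_C x : `|x| = (normc x)%:C.
Proof. by []. Qed.

Lemma cReB x y : complex.Re (x - y) = complex.Re x - complex.Re y.
Proof. by case: x y => [? ?] [? ?]. Qed.
Lemma cImB x y : complex.Im (x - y) = complex.Im x - complex.Im y.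
Proof. by case: x y => [? ?] [? ?]. Qed.
Lemma cReD x y : complex.Re (x + y) = complex.Re x + complex.Re y.
Proof. by case: x y => [? ?] [? ?]. Qed.
Lemma cImD x y : complex.Im (x + y) = complex.Im x + complex.Im y.
Proof. by case: x y => [? ?] [? ?]. Qed.
Lemma cReM x y : complex.Re (x * y) =
  complex.Re x * complex.Re y - complex.Im x * complex.Im y.
Proof. by case: x y => [? ?] [? ?]. Qed.
Lemma cImM x y : complex.Im (x * y) =
  complex.Re x * complex.Im y + complex.Im x * complex.Re y.
Proof. by case: x y => [? ?] [? ?]. Qed.

Lemma complex_eqP x y :
  complex.Re x = complex.Re y -> complex.Im x = complex.Im y -> x = y.
Proof. by case: x y => [? ?] [? ?] /= -> ->. Qed.

Lemma normc_small_eq x y : (forall e : R, 0 < e -> normc (x - y) <= e) -> x = y.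
Proof.
move=> h; apply/eqP; rewrite -subr_eq0 -normc_eq0 eq_le normc_ge0 andbT.
by apply/ler_addgt0Pr => e e0; rewrite add0r h.
Qed.

End Modulus.

(** * Bisection of intervals and rectangles *)

Section Cousin.
Context {R : realType}.

(** By contradiction: a rectangle where [P] fails has a quarter where it fails, and the nested bad
    rectangles shrink to a point, near which [P] holds. It serves Goursat's theorem and, through
    [cousin1], uniform bounds along arcs. *)
Lemma cousin2 (P : R -> R -> R -> R -> Prop) (a0 b0 c0 d0 : R) :
  a0 <= b0 -> c0 <= d0 ->
  (forall a b c d, a <= b -> c <= d -> let x := (a + b) / 2 in let y := (c + d) / 2 in
     P a x c y -> P x b c y -> P a x y d -> P x b y d -> P a b c d) ->
  (forall p q, a0 <= p <= b0 -> c0 <= q <= d0 -> exists2 e, 0 < e &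
     forall a b c d, a0 <= a -> b <= b0 -> c0 <= c -> d <= d0 ->
       a <= p <= b -> c <= q <= d -> b - a < e -> d - c < e -> P a b c d) ->
  P a0 b0 c0 d0.
Proof.
move=> ab cd split4 loc; apply: contrapT => nP.
pose T : Type := (R * R * R * R)%type.
pose bad (r : T) := let: (a, b, c, d) := r in [/\ a <= b, c <= d & ~ P a b c d].
pose sub (r s : T) := let: (a, b, c, d) := r in let: (a', b', c', d') := s in
  [/\ a <= a', b' <= b, c <= c', d' <= d & (b' - a' = (b - a) / 2 /\ d' - c' = (d - c) / 2)].
(* Stated for every [r], with a dummy quarter when [r] is not bad, so that [choice] yields a total
   function to iterate. *)
have step (r : T) : exists s, bad r -> bad s /\ sub r s.
  case: r => [[[a b] c] d]; have [|nb] := pselect (bad (a, b, c, d)); last by exists (0, 0, 0, 0).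
  move=> [ab1 cd1 nP1]; set x := (a + b) / 2; set y := (c + d) / 2.
  have [ax xb] : a <= x /\ x <= b by rewrite /x; split; lra.
  have [cy yd] : c <= y /\ y <= d by rewrite /y; split; lra.
  have [h1|n1] := pselect (P a x c y); last first.
    by exists (a, x, c, y) => _; split; [split|split => //; rewrite /x /y; split; lra].
  have [h2|n2] := pselect (P x b c y); last first.
    by exists (x, b, c, y) => _; split; [split|split => //; rewrite /x /y; split; lra].
  have [h3|n3] := pselect (P a x y d); last first.
    by exists (a, x, y, d) => _; split; [split|split => //; rewrite /x /y; split; lra].
  have [h4|n4] := pselect (P x b y d); last first.
    by exists (x, b, y, d) => _; split; [split|split => //; rewrite /x /y; split; lra].
  by exfalso; apply: nP1; exact: split4.
have [f fP] := choice step.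
pose u n := iter n f (a0, b0, c0, d0).
pose A n := (u n).1.1.1; pose B n := (u n).1.1.2; pose C n := (u n).1.2; pose D n := (u n).2.
have uE n : u n = (A n, B n, C n, D n) by rewrite /A /B /C /D; case: (u n) => [[[? ?] ?] ?].
have ub n : bad (u n).
  by elim: n => [|n IH]//; rewrite /u iterS; have [] := fP _ IH.
have us n : sub (u n) (u n.+1).
  by rewrite {2}/u iterS; have [] := fP _ (ub n).
have incr n : [/\ A n <= A n.+1, B n.+1 <= B n, C n <= C n.+1, D n.+1 <= D n &
    (B n.+1 - A n.+1 = (B n - A n) / 2 /\ D n.+1 - C n.+1 = (D n - C n) / 2)].
  by have := us n; rewrite !uE.
have AB n : A n <= B n by have := ub n; rewrite uE => -[].
have CD n : C n <= D n by have := ub n; rewrite uE => -[].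
have mono n k : [/\ A n <= A (n + k)%N, B (n + k)%N <= B n, C n <= C (n + k)%N & D (n + k)%N <= D n].
  elim: k => [|k [h1 h2 h3 h4]]; first by rewrite addn0.
  by rewrite addnS; have [? ? ? ? _] := incr (n + k)%N; split; lra.
have len n : B n - A n = (b0 - a0) / 2 ^+ n /\ D n - C n = (d0 - c0) / 2 ^+ n.
  elim: n => [|n [h1 h2]]; first by rewrite !expr0 !divr1.
  have [_ _ _ _ [-> ->]] := incr n.
  by rewrite h1 h2 exprSr invfM !mulrA.
have AleB n k : A n <= B k.
  have [h1 _ _ _] := mono n k; have [_ h2 _ _] := mono k n.
  by rewrite (le_trans h1)// (le_trans (AB _))// addnC.
have CleD n k : C n <= D k.
  have [_ _ h1 _] := mono n k; have [_ _ _ h2] := mono k n.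
  by rewrite (le_trans h1)// (le_trans (CD _))// addnC.
(* The common point of the nested rectangles: the lower ends increase and stay below all upper
   ends. *)
pose p := sup (range A); pose q := sup (range C).
have hsA : has_sup (range A).
  by split; [exists (A 0%N), 0%N|exists (B 0%N) => _ [n _ <-]].
have hsC : has_sup (range C).
  by split; [exists (C 0%N), 0%N|exists (D 0%N) => _ [n _ <-]].
have pP n : A n <= p <= B n.
  apply/andP; split; first by apply: ub_le_sup; [case: hsA|exists n].
  by apply: ge_sup; [case: hsA|move=> _ [k _ <-]].
have qP n : C n <= q <= D n.
  apply/andP; split; first by apply: ub_le_sup; [case: hsC|exists n].
  by apply: ge_sup; [case: hsC|move=> _ [k _ <-]].
have [e e0 he] := loc p q (pP 0%N) (qP 0%N).
have [n hn] : exists n, (`|b0 - a0| + `|d0 - c0|) / 2 ^+ n < e.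
  have [n hn] : exists n : nat, (`|b0 - a0| + `|d0 - c0|) / e < n%:R.
    exists (Num.bound ((`|b0 - a0| + `|d0 - c0|) / e)).
    by rewrite archi_boundP// divr_ge0 ?addr_ge0// ltW.
  exists n; rewrite ltr_pdivrMr ?exprn_gt0//; move: hn; rewrite ltr_pdivrMr// => /lt_le_trans; apply.
  by rewrite mulrC ler_pM2l// -natrX ler_nat ltnW// ltn_expl.
have [l1 l2] := len n; have [h1 h2 h3 h4] := mono 0%N n; move: h1 h2 h3 h4; rewrite add0n => h1 h2 h3 h4.
have := ub n; rewrite uE => -[_ _]; apply.
apply: he => //.
- rewrite l1; apply: le_lt_trans hn; rewrite ler_wpM2r ?invr_ge0 ?exprn_ge0//.
  by rewrite (le_trans (ler_norm _))// lerDl.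
- rewrite l2; apply: le_lt_trans hn; rewrite ler_wpM2r ?invr_ge0 ?exprn_ge0//.
  by rewrite (le_trans (ler_norm _))// lerDr.
Qed.

(** The second side of the rectangle is reduced to the point 0. *)
Lemma cousin1 (P : R -> R -> Prop) (a0 b0 : R) : a0 <= b0 ->
  (forall a x b, a <= x <= b -> P a x -> P x b -> P a b) ->
  (forall p, a0 <= p <= b0 -> exists2 e, 0 < e &
     forall a b, a <= p <= b -> b - a < e -> P a b) ->
  P a0 b0.
Proof.
move=> ab spl loc.
apply: (@cousin2 (fun a b _ _ => P a b) a0 b0 0 0 ab (lexx 0)) => [a b c d leab _ x y ha hb _ _|p q hp _].
  by apply: (spl a x b) => //; rewrite /x; apply/andP; split; lra.
by have [e e0 he] := loc p hp; exists e => // a b c d _ _ _ _ pab _ lab _; exact: he.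
Qed.

End Cousin.

(** * Integrals of complex-valued functions of a real variable *)

Section ComplexIntegral.
Context {R : realType}.
Local Notation C := R[i].
Local Notation mu := (@lebesgue_measure R).
Implicit Types (h g : R -> C) (a b : R).

Definition path_continuous h (x : R) := forall e, 0 < e ->
  exists2 d, 0 < d & forall y, `|y - x| < d -> normc (h y - h x) < e.

Definition cintegral a b h : C :=
  (\int[mu]_(x in `[a, b]) complex.Re (h x)) +i* (\int[mu]_(x in `[a, b]) complex.Im (h x)).

Definition cintegrable a b h :=
  mu.-integrable `[a, b] (EFin \o (fun x => complex.Re (h x))) /\
  mu.-integrable `[a, b] (EFin \o (fun x => complex.Im (h x))).

Lemma path_continuous_real h x : path_continuous h x ->
  {for x, continuous (fun x => complex.Re (h x))} /\
  {for x, continuous (fun x => complex.Im (h x))}.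
Proof.
move=> hx; split; apply/cvgrPdist_lt => e e0; have [d d0 hd] := hx _ e0;
  near=> y; have : normc (h y - h x) < e.
- apply: hd; near: y; apply/nbhs_ballP; exists d => //= y.
  by rewrite /ball/= distrC.
- by apply: le_lt_trans; rewrite distrC -cReB normc_Re.
- apply: hd; near: y; apply/nbhs_ballP; exists d => //= y.
  by rewrite /ball/= distrC.
- by apply: le_lt_trans; rewrite distrC -cImB normc_Im.
Unshelve. all: by end_near. Qed.

Lemma path_continuous_integrable a b h :
  (forall x, a <= x <= b -> path_continuous h x) -> cintegrable a b h.
Proof.
move=> ch; split; apply: continuous_compact_integrable; try exact: segment_compact;
  apply: continuous_in_subspaceT => x; rewrite inE/= in_itv/= => /ch /path_continuous_real[]//.
Qed.

Lemma eq_cintegral a b h g : (forall x, a <= x <= b -> h x = g x) ->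
  cintegral a b h = cintegral a b g.
Proof.
by move=> hg; rewrite /cintegral; congr (_ +i* _); apply: eq_Rintegral => x;
  rewrite inE/= in_itv/= => /hg ->.
Qed.

Lemma cintegrableD a b h g : cintegrable a b h -> cintegrable a b g ->
  cintegrable a b (fun x => h x + g x).
Proof.
move=> [h1 h2] [g1 g2]; split.
  rewrite (_ : _ \o _ = (fun x => (complex.Re (h x))%:E + (complex.Re (g x))%:E)%E).
    exact: integrableD.
  by apply/funext => x /=; rewrite cReD.
rewrite (_ : _ \o _ = (fun x => (complex.Im (h x))%:E + (complex.Im (g x))%:E)%E).
  exact: integrableD.
by apply/funext => x /=; rewrite cImD.
Qed.

Lemma cintegralD a b h g : cintegrable a b h -> cintegrable a b g ->
  cintegral a b (fun x => h x + g x) = cintegral a b h + cintegral a b g.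
Proof.
move=> [h1 h2] [g1 g2]; rewrite /cintegral.
under eq_Rintegral do rewrite cReD; under [X in _ +i* X]eq_Rintegral do rewrite cImD.
by rewrite !RintegralD.
Qed.

Lemma cintegrableZ a b (c : C) h : cintegrable a b h ->
  cintegrable a b (fun x => c * h x).
Proof.
move=> [h1 h2]; split.
  rewrite (_ : _ \o _ = (fun x => (complex.Re c)%:E * (complex.Re (h x))%:E -
       (complex.Im c)%:E * (complex.Im (h x))%:E)%E).
    by apply: integrableB => //; exact: integrableZl.
  by apply/funext => x /=; rewrite cReM EFinB !EFinM.
rewrite (_ : _ \o _ = (fun x => (complex.Re c)%:E * (complex.Im (h x))%:E +
     (complex.Im c)%:E * (complex.Re (h x))%:E)%E).
  by apply: integrableD => //; exact: integrableZl.
by apply/funext => x /=; rewrite cImM EFinD !EFinM.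
Qed.

Lemma cintegralZ a b (c : C) h : cintegrable a b h ->
  cintegral a b (fun x => c * h x) = c * cintegral a b h.
Proof.
move=> [h1 h2]; rewrite /cintegral.
under eq_Rintegral do rewrite cReM; under [X in _ +i* X]eq_Rintegral do rewrite cImM.
have iZ (r : R) (f : R -> R) : mu.-integrable `[a, b] (EFin \o f) ->
    mu.-integrable `[a, b] (EFin \o (fun x => r * f x)).
  by move=> fi; exact: (integrableZl _ r fi).
rewrite RintegralB//; try exact: iZ.
rewrite RintegralD//; try exact: iZ.
by rewrite !RintegralZl//; apply: complex_eqP; rewrite ?cReM ?cImM.
Qed.

Lemma cintegralB a b h g : cintegrable a b h -> cintegrable a b g ->
  cintegral a b (fun x => h x - g x) = cintegral a b h - cintegral a b g.
Proof.
move=> ih ig; under eq_cintegral do rewrite -mulN1r.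
by rewrite cintegralD ?cintegralZ ?mulN1r//; exact: cintegrableZ.
Qed.

Lemma cintegrableB a b h g : cintegrable a b h -> cintegrable a b g ->
  cintegrable a b (fun x => h x - g x).
Proof.
move=> ih ig; under eq_fun do rewrite -mulN1r.
by apply: cintegrableD => //; exact: cintegrableZ.
Qed.

Lemma cintegralZr a b (c : C) h : cintegrable a b h ->
  cintegral a b (fun x => h x * c) = cintegral a b h * c.
Proof.
move=> ih; rewrite mulrC -cintegralZ//.
by apply: eq_cintegral => x _; rewrite mulrC.
Qed.

Lemma cintegrable_sum (I : Type) (r : seq I) (F : I -> R -> C) a b :
  (forall i, cintegrable a b (F i)) -> cintegrable a b (fun x => \sum_(i <- r) F i x).
Proof.
move=> iF; elim: r => [|i r IH].
  under eq_fun do rewrite big_nil; apply: path_continuous_integrable => x _ e e0.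
  by exists 1 => // y _; rewrite subrr Normc.normc0.
by under eq_fun do rewrite big_cons; exact: cintegrableD.
Qed.

Lemma cintegral_sum (I : Type) (r : seq I) (F : I -> R -> C) a b :
  (forall i, cintegrable a b (F i)) ->
  cintegral a b (fun x => \sum_(i <- r) F i x) = \sum_(i <- r) cintegral a b (F i).
Proof.
move=> iF; elim: r => [|i r IH].
  under eq_cintegral do rewrite big_nil.
  by rewrite big_nil /cintegral !Rintegral_cst//= mul0r.
under eq_cintegral do rewrite big_cons.
by rewrite cintegralD// ?IH ?big_cons//; exact: cintegrable_sum.
Qed.

Lemma cintegral_split a m b h : a <= m <= b -> cintegrable a b h ->
  cintegral a b h = cintegral a m h + cintegral m b h.
Proof.
move=> /andP[am mb] [h1 h2]; rewrite /cintegral.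
have E (f : R -> R) : mu.-integrable `[a, b] (EFin \o f) ->
    \int[mu]_(x in `[a, b]) f x = \int[mu]_(x in `[a, m]) f x + \int[mu]_(x in `[m, b]) f x.
  move=> fi; have := @Rintegral_itvB _ f (BLeft a) (BRight b) m fi.
  rewrite !bnd_simp => /(_ am mb) E; rewrite -(@Rintegral_itv_obnd_cbnd _ m (BRight b)).
    by rewrite -E addrC subrK.
  by apply: integrableS fi => //; apply: subset_itvr; rewrite bnd_simp.
by rewrite !E.
Qed.

(** The factor 2 comes from estimating the real and the imaginary part separately. It recurs in the
    constants of the Cauchy estimates below. *)
Lemma normc_cintegral a b h M : a <= b -> cintegrable a b h ->
  (forall x, a <= x <= b -> normc (h x) <= M) ->
  normc (cintegral a b h) <= 2 * M * (b - a).
Proof.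
move=> ab [h1 h2] hM; apply: le_trans (normc_le_ReIm _) _.
have E (f : R -> R) : mu.-integrable `[a, b] (EFin \o f) ->
    (forall x, a <= x <= b -> `|f x| <= M) -> `|\int[mu]_(x in `[a, b]) f x| <= M * (b - a).
  move=> fi fM; apply: le_trans (le_normr_Rintegral _ fi) _ => //.
  have <- : \int[mu]_(x in `[a, b]) M = M * (b - a).
    rewrite Rintegral_cst//= lebesgue_measure_itv/= lte_fin.
    by move: ab; rewrite le_eqVlt => /predU1P[->|->]//; rewrite ltxx subrr.
  apply: le_Rintegral => //.
  - exact: integrable_norm fi.
  - by apply: continuous_compact_integrable; [exact: segment_compact|move=> x; exact: cst_continuous].
rewrite (_ : 2 * M * _ = M * (b - a) + M * (b - a)); last by ring.
by apply: lerD; apply: E => // x /hM; apply: le_trans; rewrite ?normc_Re ?normc_Im.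
Qed.

Lemma cintegral_FTC a b h (H : R -> C) : a <= b ->
  (forall x, path_continuous h x) ->
  (forall x : R, is_derive x 1 (fun x : R => complex.Re (H x)) (complex.Re (h x))) ->
  (forall x : R, is_derive x 1 (fun x : R => complex.Im (H x)) (complex.Im (h x))) ->
  cintegral a b h = H b - H a.
Proof.
rewrite le_eqVlt => /predU1P[<- *|ab ch dR dI].
  by rewrite subrr /cintegral set_itv1 !Rintegral_set1.
have E (f F : R -> R) : (forall x, {for x, continuous f}) -> (forall x : R, is_derive x 1 F (f x)) ->
    \int[mu]_(x in `[a, b]) f x = F b - F a.
  move=> cf dF; rewrite /Rintegral (@continuous_FTC2 _ f F)//.
  - by apply: continuous_subspaceT.
  - have dd x : derivable F x 1 by have := dF x => -[].
    have cF x : {for x, continuous F} by apply/differentiable_continuous/derivable1_diffP.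
    by split; [move=> x _; exact: dd|apply: cvg_at_right_filter; exact: cF|apply: cvg_at_left_filter; exact: cF].
  - by move=> x _; rewrite derive1E; have := dF x => -[].
apply: complex_eqP; rewrite ?cReB ?cImB/=.
  by apply: E => // x; have [] := path_continuous_real (ch x).
by apply: E => // x; have [] := path_continuous_real (ch x).
Qed.

End ComplexIntegral.

(** * Polar rectangles and Goursat's theorem *)

Section Polar.
Context {R : realType}.
Local Notation C := R[i].
Implicit Types (q phi : C -> C) (r t a b : R) (w s : C).

Lemma path_continuousP (h : R -> C) x : path_continuous h x <->
  ((fun y => complex.Re (h y)) @ x --> complex.Re (h x)) /\
  ((fun y => complex.Im (h y)) @ x --> complex.Im (h x)).
Proof.
split; first exact: path_continuous_real.
move=> [/cvgrPdist_lt cr /cvgrPdist_lt ci] e e0.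
have e2 : 0 < e / 2 by rewrite divr_gt0.
have /nbhs_ballP[d1 /= d10 h1] := cr _ e2; have /nbhs_ballP[d2 /= d20 h2] := ci _ e2.
exists (Num.min d1 d2); first by rewrite lt_min d10.
move=> y; rewrite lt_min => /andP[y1 y2]; apply: le_lt_trans (normc_le_ReIm _) _.
rewrite cReB cImB [e]splitr; apply: ltrD; rewrite distrC.
  by apply: h1; rewrite /ball/= distrC.
by apply: h2; rewrite /ball/= distrC.
Qed.

Lemma path_continuous_cst c (x : R) : path_continuous (fun=> c : C) x.
Proof. by move=> e e0; exists 1 => // y _; rewrite subrr Normc.normc0. Qed.

Lemma path_continuousD (h g : R -> C) x : path_continuous h x ->
  path_continuous g x -> path_continuous (fun x => h x + g x) x.
Proof.
move=> /path_continuousP[h1 h2] /path_continuousP[g1 g2]; apply/path_continuousP; split.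
  by rewrite cReD; under eq_fun do rewrite cReD; exact: cvgD.
by rewrite cImD; under eq_fun do rewrite cImD; exact: cvgD.
Qed.

Lemma path_continuousM (h g : R -> C) x : path_continuous h x ->
  path_continuous g x -> path_continuous (fun x => h x * g x) x.
Proof.
move=> /path_continuousP[h1 h2] /path_continuousP[g1 g2]; apply/path_continuousP; split.
  by rewrite cReM; under eq_fun do rewrite cReM; apply: cvgB; apply: cvgM.
by rewrite cImM; under eq_fun do rewrite cImM; apply: cvgD; apply: cvgM.
Qed.

Lemma path_continuous_id x : path_continuous (fun x => x%:C : C) x.
Proof. by apply/path_continuousP; split => /=; [exact: cvg_id|exact: cvg_cst]. Qed.

Lemma normc_i : normc ('i : C) = 1.
Proof. by rewrite /= expr0n/= add0r expr1n sqrtr1. Qed.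

Definition cis t : C := cos t +i* sin t.

Lemma cis0 : cis 0 = 1.
Proof. by rewrite /cis cos0 sin0. Qed.

Lemma cisD t1 t2 : cis (t1 + t2) = cis t1 * cis t2.
Proof.
apply: complex_eqP; rewrite ?cReM ?cImM /=; first by rewrite cosD.
by rewrite sinD addrC.
Qed.

Lemma cisX t n : cis t ^+ n = cis (n%:R * t).
Proof.
elim: n => [|n IH]; first by rewrite mul0r cis0.
by rewrite exprS IH -cisD -natr1 mulrDl mul1r addrC.
Qed.

Lemma cis2pi : cis (2 * pi) = 1.
Proof. by rewrite /cis mulr_natl cos2pi sin2pi. Qed.

Lemma normc_cis t : normc (cis t) = 1.
Proof. by rewrite /= cos2Dsin2 sqrtr1. Qed.

Lemma path_continuous_cis x : path_continuous cis x.
Proof. by apply/path_continuousP; split => /=; [exact: continuous_cos|exact: continuous_sin]. Qed.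

Lemma cintegral_cis k a b : a <= b ->
  cintegral a b (fun t => (k%:C * 'i) * cis (k * t)) = cis (k * b) - cis (k * a).
Proof.
move=> ab; apply: (@cintegral_FTC _ _ _ _ (fun t => cis (k * t))) => // x.
- apply: path_continuousM; first exact: path_continuous_cst.
  apply/path_continuousP; split => /=; apply: continuous_comp => /=;
    try exact: continuous_cos; try exact: continuous_sin;
    by apply: cvgM; [exact: cvg_cst|exact: cvg_id].
- rewrite /=; apply: is_derive_eq; rewrite /GRing.scale/=; ring.
- rewrite /=; apply: is_derive_eq; rewrite /GRing.scale/=; ring.
Qed.

Lemma cintegral_cst a b (c : C) : a <= b -> cintegral a b (fun=> c) = (b - a)%:C * c.
Proof.
move=> ab; rewrite /cintegral !Rintegral_cst//= lebesgue_measure_itv/= lte_fin.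
have -> : fine (if (a < b)%R then b%:E - a%:E else 0)%E = b - a.
  by move: ab; rewrite le_eqVlt => /predU1P[->|->]//; rewrite ltxx subrr.
by apply: complex_eqP; rewrite ?cReM ?cImM/=; ring.
Qed.

Lemma cintegral_id a b : a <= b -> cintegral a b (fun x => x%:C) = ((b ^+ 2 - a ^+ 2) / 2)%:C.
Proof.
move=> ab; rewrite mulrBl rmorphB/=.
apply: (@cintegral_FTC _ _ _ _ (fun t => (t ^+ 2 / 2)%:C)) => // x.
- exact: path_continuous_id.
- rewrite /=; apply: is_derive_eq; rewrite /GRing.scale/= ; lra.
- rewrite /=; exact: is_derive_cst.
Qed.

(** The difference is the integral of the derivative over the arc; the factor 2 is that of
    [normc_cintegral]. *)
Lemma cis_lipschitz t1 t2 : normc (cis t1 - cis t2) <= 2 * `|t1 - t2|.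
Proof.
wlog t12 : t1 t2 / t2 <= t1.
  by move=> h; case: (leP t2 t1) => [/h//|/ltW/h]; rewrite normcB distrC.
have := cintegral_cis 1 t12; rewrite !mul1r => <-.
rewrite ger0_norm ?subr_ge0//; apply: le_trans (normc_cintegral (M := 1) _ _ _) _ => //.
- apply: path_continuous_integrable => x _; apply: path_continuousM.
    exact: path_continuous_cst.
  by under eq_fun do rewrite mul1r; exact: path_continuous_cis.
- by move=> x _; rewrite !Normc.normcM normc_cis normc_i !mul1r.
- by rewrite mulr1.
Qed.

Definition ccontinuous phi s := forall e, 0 < e ->
  exists2 d, 0 < d & forall w, normc (w - s) < d -> normc (phi w - phi s) < e.

(** The error is compared with the increment and no quotient is formed, so that [w = s] needs no
    exception. *)
Definition has_cderiv phi s (c : C) := forall e, 0 < e ->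
  exists2 d, 0 < d & forall w, normc (w - s) < d ->
    normc (phi w - phi s - c * (w - s)) <= e * normc (w - s).

Lemma has_cderiv_continuous phi s c : has_cderiv phi s c -> ccontinuous phi s.
Proof.
move=> dphi e e0; have [d d0 hd] := dphi 1 ltr01.
have K0 : 0 < 1 + normc c by rewrite ltr_pwDl ?normc_ge0.
exists (Num.min d (e / (1 + normc c))); first by rewrite lt_min d0 divr_gt0.
move=> w; rewrite lt_min ltr_pdivlMr// => /andP[/hd h1 h2].
rewrite -[X in normc X](subrK (c * (w - s))); apply: le_lt_trans (le_normcD _ _) _.
by apply: le_lt_trans h2; rewrite Normc.normcM [leRHS]mulrDr mulr1 [_ * normc c]mulrC lerD2r -[leRHS]mul1r.
Qed.

Lemma ccontinuous_comp phi (h : R -> C) x : path_continuous h x ->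
  ccontinuous phi (h x) -> path_continuous (phi \o h) x.
Proof.
move=> ch cphi e /cphi[d d0 hd]; have [d' d'0 hd'] := ch _ d0.
by exists d' => // y /hd' /hd.
Qed.

(** Along a ray $dw = e^{it} dr$, and along an arc $dw = i r e^{it} dt$; the factor $i$ is left out
    of [angular] and restored in [polar_boundary]. *)
Definition radial q a b t := cintegral a b (fun r => q (r%:C * cis t) * cis t).
Definition angular q r a b := cintegral a b (fun t => q (r%:C * cis t) * (r%:C * cis t)).

(* The integral of [q] along the boundary of the polar rectangle [a, b] x [c, d]. *)
Definition polar_boundary q a b c d :=
  radial q a b c - radial q a b d + 'i * (angular q b c d - angular q a c d).

Section Sector.
Variables (q : C -> C) (A B : R).
Hypotheses (A0 : 0 <= A) (cq : forall w, A <= normc w <= B -> ccontinuous q w).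

Lemma normc_polar r t : 0 <= r -> normc (r%:C * cis t) = r.
Proof. by move=> r0; rewrite Normc.normcM normc_cis mulr1 normc_real ger0_norm. Qed.

Lemma path_continuous_radial t x : A <= x <= B ->
  path_continuous (fun r => q (r%:C * cis t) * cis t) x.
Proof.
move=> xAB; apply: path_continuousM; last exact: path_continuous_cst.
apply: (@ccontinuous_comp _ (fun r => r%:C * cis t)).
  by apply: path_continuousM; [exact: path_continuous_id|exact: path_continuous_cst].
by apply: cq; rewrite normc_polar//; case/andP: xAB => /(le_trans A0).
Qed.

Lemma path_continuous_circle r x : A <= r <= B ->
  path_continuous (fun t => q (r%:C * cis t)) x.
Proof.
move=> xAB; apply: (@ccontinuous_comp _ (fun t => r%:C * cis t)).
  by apply: path_continuousM; [exact: path_continuous_cst|exact: path_continuous_cis].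
by apply: cq; rewrite normc_polar//; case/andP: xAB => /(le_trans A0).
Qed.

Lemma path_continuous_angular r x : A <= r <= B ->
  path_continuous (fun t => q (r%:C * cis t) * (r%:C * cis t)) x.
Proof.
move=> xAB; apply: path_continuousM; first exact: path_continuous_circle.
by apply: path_continuousM; [exact: path_continuous_cst|exact: path_continuous_cis].
Qed.

Lemma radial_integrable a b t : A <= a -> b <= B ->
  cintegrable a b (fun r => q (r%:C * cis t) * cis t).
Proof.
move=> Aa bB; apply: path_continuous_integrable => x /andP[ax xb].
by apply: path_continuous_radial; rewrite (le_trans Aa)// (le_trans xb).
Qed.

Lemma angular_integrable r a b : A <= r <= B ->
  cintegrable a b (fun t => q (r%:C * cis t) * (r%:C * cis t)).
Proof. by move=> rAB; apply: path_continuous_integrable => x _; exact: path_continuous_angular. Qed.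

Lemma polar_boundary_split a x b c y d : A <= a -> a <= x <= b -> b <= B -> c <= y <= d ->
  polar_boundary q a b c d = polar_boundary q a x c y + polar_boundary q x b c y +
    (polar_boundary q a x y d + polar_boundary q x b y d).
Proof.
move=> Aa axb bB cyd; case/andP: (axb) => ax xb.
have rs t : radial q a b t = radial q a x t + radial q x b t.
  by apply: cintegral_split => //; exact: radial_integrable.
have rg r : A <= r <= B -> angular q r c d = angular q r c y + angular q r y d.
  by move=> rAB; apply: cintegral_split => //; exact: angular_integrable.
rewrite /polar_boundary !rs !rg.
    move: (radial q a x c) (radial q x b c) (radial q a x d) (radial q x b d) => u1 u2 u3 u4.
    move: (angular q a c y) (angular q b c y) (angular q a y d) (angular q b y d) => v1 v2 v3 v4.
    by move: (angular q x c y) (angular q x y d) => v5 v6; ring.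
  by rewrite Aa/= (le_trans ax)// (le_trans xb).
by rewrite (le_trans Aa)// (le_trans ax).
Qed.

Lemma polar_boundary_bound (E : R) a b c d :
  A <= a -> a <= b -> b <= B -> c <= d -> 0 <= E ->
  (forall r t, a <= r <= b -> c <= t <= d -> normc (q (r%:C * cis t)) <= E) ->
  normc (polar_boundary q a b c d) <= 4 * E * ((b - a) + B * (d - c)).
Proof.
move=> Aa ab bB cd E0 hE.
have rb t : c <= t <= d -> normc (radial q a b t) <= 2 * E * (b - a).
  move=> tcd; apply: normc_cintegral => //; first exact: radial_integrable.
  by move=> r rab; rewrite Normc.normcM normc_cis mulr1 hE.
have gb r : a <= r <= b -> normc ('i * angular q r c d) <= 2 * (E * B) * (d - c).
  move=> /andP[ar rb']; rewrite Normc.normcM normc_i mul1r.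
  have rB := le_trans rb' bB; have r0 := le_trans A0 (le_trans Aa ar).
  apply: normc_cintegral => //.
    by apply: angular_integrable; rewrite (le_trans Aa).
  move=> t tcd; rewrite Normc.normcM normc_polar//.
  by apply: ler_pM => //; [exact: normc_ge0|apply: hE => //; rewrite ar].
rewrite /polar_boundary mulrBr.
apply: le_trans (le_normcD _ _) _; apply: le_trans (lerD (le_normcB _ _) (le_normcB _ _)) _.
have := rb c; have := rb d; have := gb a; have := gb b; rewrite !lexx ab cd /= => /(_ isT) h1 /(_ isT) h2 /(_ isT) h3 /(_ isT) h4.
apply: le_trans (lerD (lerD h4 h3) (lerD h1 h2)) _.
by rewrite le_eqVlt; apply/orP; left; apply/eqP; ring.
Qed.

End Sector.

(** An affine function has a primitive, so its integral along a closed path vanishes; here each side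
    is evaluated explicitly. *)
Lemma polar_boundary_affine (u v : C) a b c d : a <= b -> c <= d ->
  polar_boundary (fun w => u + v * w) a b c d = 0.
Proof.
move=> ab cd; rewrite /polar_boundary.
have pc (h : R -> C) : (forall x, path_continuous h x) -> cintegrable a b h.
  by move=> ch; apply: path_continuous_integrable => x _.
have pc' (h : R -> C) : (forall x, path_continuous h x) -> cintegrable c d h.
  by move=> ch; apply: path_continuous_integrable => x _.
have kc k x : path_continuous (fun t => k%:C * 'i * cis (k * t)) x.
  apply: path_continuousM; first exact: path_continuous_cst.
  apply/path_continuousP; split => /=; apply: continuous_comp => /=;
    try exact: continuous_cos; try exact: continuous_sin;
    by apply: cvgM; [exact: cvg_cst|exact: cvg_id].
have cc (k : C) (h : R -> C) : (forall x, path_continuous h x) -> forall x, path_continuous (fun t => k * h t) x.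
  by move=> ch x; apply: path_continuousM => //; exact: path_continuous_cst.
have rE t : radial (fun w => u + v * w) a b t =
    u * cis t * (b - a)%:C + v * cis t ^+ 2 * ((b ^+ 2 - a ^+ 2) / 2)%:C.
  transitivity (cintegral a b (fun r => u * cis t + (v * cis t ^+ 2) * r%:C)).
    by apply: eq_cintegral => x _; ring.
  have ci := pc _ path_continuous_id.
  rewrite cintegralD ?cintegral_cst ?cintegralZ ?cintegral_id//; first by rewrite [_ * (u * _)]mulrC.
  - by apply: pc => x; exact: path_continuous_cst.
  - exact: cintegrableZ.
have gE r : 'i * angular (fun w => u + v * w) r c d =
    u * r%:C * (cis d - cis c) + v * r%:C ^+ 2 / 2 * (cis d ^+ 2 - cis c ^+ 2).
  transitivity (cintegral c d (fun t => (u * r%:C) * (1%:C * 'i * cis (1 * t)) +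
      (v * r%:C ^+ 2 / 2) * (2%:C * 'i * cis (2 * t)))); last first.
    rewrite cintegralD; try exact/pc'/cc/kc.
    have i1 := pc' _ (kc 1); have i2 := pc' _ (kc 2).
    by rewrite (cintegralZ _ i1) (cintegralZ _ i2) !cintegral_cis// !mul1r !cisX.
  rewrite -cintegralZ; last first.
    apply: pc' => x; apply: path_continuousM; last exact/cc/path_continuous_cis.
    apply: path_continuousD; first exact: path_continuous_cst.
    exact/cc/cc/path_continuous_cis.
  by apply: eq_cintegral => t _; rewrite !mul1r -(cisX t 2) rmorph_nat; field.
by rewrite mulrBr !gE !rE !rmorphM/= !rmorphB/= !rmorphXn/= fmorphV rmorph_nat; field.
Qed.

Section Goursat.
Variables (q : C -> C) (A B : R).
Hypotheses (A0 : 0 <= A) (AB : A <= B).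

(** A bound by [e] times the square of the sum $S$ of the two side lengths is stable under
    quartering, because four times $(S/2)^2$ is $S^2$. Locally [q] is affine up to a small error and
    the affine part integrates to 0, so the bound holds on small rectangles; [cousin2] then gives it
    on the whole one, for every [e]. *)
Lemma goursat t0 t1 : t0 <= t1 ->
  (forall w, A <= normc w <= B -> exists c, has_cderiv q w c) ->
  polar_boundary q A B t0 t1 = 0.
Proof.
move=> t01 dq.
have cq w : A <= normc w <= B -> ccontinuous q w.
  by move=> /dq[c]; exact: has_cderiv_continuous.
have B0 := le_trans A0 AB.
suff main (e : R) : 0 < e -> normc (polar_boundary q A B t0 t1) <= e * (B - A + (t1 - t0)) ^+ 2.
  apply: normc_small_eq => e e0; rewrite subr0.
  set L := (B - A + (t1 - t0)) ^+ 2; have L0 : 0 < 1 + L by rewrite ltr_pwDl ?sqr_ge0.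
  apply: le_trans (main (e / (1 + L)) _) _; first by rewrite divr_gt0.
  by rewrite -mulrA ger_pMr// ler_pdivrMl// mulr1 lerDr.
move=> e0.
pose P a b c d := A <= a -> b <= B ->
  normc (polar_boundary q a b c d) <= e * (b - a + (d - c)) ^+ 2.
apply: (@cousin2 _ P A B t0 t1) => //.
- move=> a b c d ab cd x y; rewrite /P => h1 h2 h3 h4 Aa bB.
  have [ax xb] := midf_le ab; have [cy yd] := midf_le cd.
  rewrite (@polar_boundary_split q A B A0 cq a x b c y d) ?ax ?cy//.
  apply: le_trans (le_normcD _ _) _; apply: le_trans (lerD (le_normcD _ _) (le_normcD _ _)) _.
  apply: le_trans (lerD (lerD (h1 _ _) (h2 _ _)) (lerD (h3 _ _) (h4 _ _))) _ => //;
    rewrite ?(le_trans Aa)// ?(le_trans _ bB)//.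
  by rewrite le_eqVlt; apply/orP; left; apply/eqP; rewrite /x /y; field.
move=> p t pAB tt.
pose w0 := p%:C * cis t; have p0 : 0 <= p by case/andP: pAB => /(le_trans A0).
have [|v dv] := dq w0; first by rewrite normc_polar.
(* The distance in the plane from [w0] is at most $(1+2B)S$, where $2B$ combines the radius with the
   Lipschitz constant of [cis]. With this [e1] the final bound $4 e_1 ((1+2B)S)^2$ is exactly $e
   S^2$. *)
pose e1 := e / (4 * (1 + 2 * B) * (1 + 2 * B)).
have B2 : 0 < 1 + 2 * B by rewrite ltr_pwDl ?mulr_ge0.
have e10 : 0 < e1 by rewrite divr_gt0// !mulr_gt0.
have [d1 d10 hd1] := dv _ e10.
exists (d1 / (2 * (1 + 2 * B))); first by rewrite divr_gt0// mulr_gt0.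
move=> a b c d Aa bB c0 dd pab tcd lab lcd _ _.
have [ab cd] : a <= b /\ c <= d.
  by case/andP: pab => ap pb; case/andP: tcd => ct td; rewrite (le_trans ap pb) (le_trans ct td).
have dist (r s : R) : a <= r <= b -> c <= s <= d ->
    normc (r%:C * cis s - w0) <= (b - a) + 2 * B * (d - c).
  move=> rab scd; rewrite (_ : _ - w0 = (r - p)%:C * cis s + p%:C * (cis s - cis t)); last first.
    by rewrite /w0 rmorphB/=; ring.
  apply: le_trans (le_normcD _ _) _; rewrite !Normc.normcM normc_cis mulr1 !normc_real.
  apply: lerD; first by move: rab pab; clear; rewrite ler_norml; lra.
  rewrite (ger0_norm p0); apply: (@le_trans _ _ (B * (2 * `|s - t|))).
    by apply: ler_pM; rewrite ?normc_ge0 ?cis_lipschitz//; case/andP: pAB.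
  rewrite mulrA [B * 2]mulrC; apply: ler_wpM2l; first by rewrite mulr_ge0.
  by move: scd tcd; clear; rewrite ler_norml; lra.
pose Er := e1 * ((b - a) + 2 * B * (d - c)).
have Ld : (b - a) + 2 * B * (d - c) <= (1 + 2 * B) * (b - a + (d - c)).
  rewrite -subr_ge0 (_ : _ - _ = 2 * B * (b - a) + (d - c)); last by ring.
  by rewrite addr_ge0 ?mulr_ge0 ?subr_ge0.
have Ls : (1 + 2 * B) * (b - a + (d - c)) < d1.
  by rewrite -ltr_pdivlMl//; move: lab lcd; rewrite invfM; clear; lra.
pose aff w := (q w0 - v * w0) + v * w.
have aE w : q w - aff w = q w - q w0 - v * (w - w0) by rewrite /aff; ring.
have caff w : ccontinuous aff w.
  apply: (@has_cderiv_continuous _ _ v) => e' e'0; exists 1 => // w' _.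
  rewrite /aff (_ : _ - _ - _ = 0); last by ring.
  by rewrite Normc.normc0 mulr_ge0 ?normc_ge0// ltW.
have cE w : A <= normc w <= B -> ccontinuous (fun w => q w - aff w) w.
  move=> wAB e' e'0; have e2 : 0 < e' / 2 by rewrite divr_gt0.
  have [x1 x10 h1] := cq _ wAB _ e2; have [x2 x20 h2] := caff w _ e2.
  exists (Num.min x1 x2); first by rewrite lt_min x10.
  move=> w'; rewrite lt_min => /andP[/h1 k1 /h2 k2].
  rewrite (_ : _ - _ = (q w' - q w) - (aff w' - aff w)); last by ring.
  by rewrite [e']splitr; apply: le_lt_trans (le_normcB _ _) _; exact: ltrD.
have -> : polar_boundary q a b c d = polar_boundary (fun w => q w - aff w) a b c d.
  rewrite -[LHS]subr0 -(@polar_boundary_affine (q w0 - v * w0) v a b c d)//.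
  have rB (s : R) : radial (fun w => q w - aff w) a b s = radial q a b s - radial aff a b s.
    rewrite /radial -cintegralB; first by apply: eq_cintegral => x _; rewrite mulrBl.
      exact: (radial_integrable A0 cq).
    exact: (@radial_integrable aff A B A0 (fun w _ => caff w) a b s).
  have gB r : A <= r <= B -> angular (fun w => q w - aff w) r c d = angular q r c d - angular aff r c d.
    move=> rAB; rewrite /angular -cintegralB; first by apply: eq_cintegral => x _; rewrite mulrBl.
      exact: (angular_integrable A0 cq).
    exact: (@angular_integrable aff A B A0 (fun w _ => caff w) r c d rAB).
  rewrite /polar_boundary !rB !gB ?(le_trans Aa) ?(le_trans _ bB)// -?/aff; ring.
set X := b - a + 2 * B * (d - c) in dist Er Ld *; set S := b - a + (d - c) in Ld Ls *.
have X0 : 0 <= X by rewrite addr_ge0 ?mulr_ge0 ?subr_ge0.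
apply: le_trans (@polar_boundary_bound _ A B A0 cE Er a b c d Aa ab bB cd _ _) _.
- by rewrite mulr_ge0// ltW.
- move=> r s rab scd; rewrite aE; have ds := dist r s rab scd.
  apply: le_trans (hd1 _ (le_lt_trans ds (le_lt_trans Ld Ls))) _.
  by rewrite ler_wpM2l// ltW.
have XY : b - a + B * (d - c) <= X.
  by rewrite lerD2l ler_wpM2r ?subr_ge0// ler_peMl// ler1n.
apply: (@le_trans _ _ (4 * (e1 * X) * X)).
  by apply: ler_wpM2l => //; rewrite mulr_ge0// mulr_ge0// ltW.
 apply: (@le_trans _ _ (4 * e1 * ((1 + 2 * B) * S) ^+ 2)).
  rewrite (_ : 4 * (e1 * X) * X = 4 * e1 * X ^+ 2); last by ring.
  apply: ler_wpM2l; first by rewrite mulr_ge0// ltW.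
  by rewrite ler_pXn2r ?nnegrE// (le_trans X0).
rewrite le_eqVlt; apply/orP; left; apply/eqP; rewrite /e1; field.
by rewrite gt_eqF.
Qed.
End Goursat.
End Polar.

(** * Difference quotients and integrals over circles *)

Section Taylor.
Context {R : realType}.
Local Notation C := R[i].
Implicit Types (q phi : C -> C) (r t : R) (w s : C).

Lemma ccontinuous_cst (c : C) s : ccontinuous (fun=> c) s.
Proof. by move=> e e0; exists 1 => // w _; rewrite subrr Normc.normc0. Qed.

Lemma ccontinuous_id s : ccontinuous id s.
Proof. by move=> e e0; exists e. Qed.

Lemma ccontinuousB phi q s : ccontinuous phi s -> ccontinuous q s ->
  ccontinuous (fun w => phi w - q w) s.
Proof.
move=> cp cq e e0; have e2 : 0 < e / 2 by rewrite divr_gt0.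
have [d1 d10 h1] := cp _ e2; have [d2 d20 h2] := cq _ e2.
exists (Num.min d1 d2); first by rewrite lt_min d10.
move=> w; rewrite lt_min => /andP[/h1 k1 /h2 k2].
rewrite (_ : _ - _ = (phi w - phi s) - (q w - q s)); last by ring.
by rewrite [e]splitr; apply: le_lt_trans (le_normcB _ _) _; exact: ltrD.
Qed.

Lemma ccontinuousM phi q s : ccontinuous phi s -> ccontinuous q s ->
  ccontinuous (fun w => phi w * q w) s.
Proof.
move=> cp cq e e0; pose M := normc (phi s) + normc (q s) + 1.
have M0 : 0 < M by rewrite ltr_wpDl ?addr_ge0 ?normc_ge0.
have e2 : 0 < e / 2 / M by rewrite !divr_gt0.
have [d1 d10 h1] := cp _ e2; have [d2 d20 h2] := cq _ e2; have [d3 d30 h3] := cq _ ltr01.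
exists (Num.min d1 (Num.min d2 d3)); first by rewrite !lt_min d10 d20.
move=> w; rewrite !lt_min => /and3P[/h1 k1 /h2 k2 /h3 k3].
rewrite (_ : _ - _ = (phi w - phi s) * q w + phi s * (q w - q s)); last by ring.
apply: le_lt_trans (le_normcD _ _) _; rewrite !Normc.normcM [e]splitr.
have qM : normc (q w) <= M.
  rewrite -[q w](subrK (q s)); apply: le_trans (le_normcD _ _) _.
  by rewrite /M; have := normc_ge0 (phi s); move: k3; clear; lra.
have pM : normc (phi s) <= M.
  by rewrite /M; have := normc_ge0 (q s); clear; lra.
have l1 : normc (phi w - phi s) * normc (q w) <= normc (phi w - phi s) * M.
  by rewrite ler_wpM2l// normc_ge0.
have l2 : normc (phi s) * normc (q w - q s) <= M * normc (q w - q s).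
  by rewrite ler_wpM2r// normc_ge0.
apply: ltrD; first by apply: le_lt_trans l1 _; rewrite -ltr_pdivlMr.
by apply: le_lt_trans l2 _; rewrite mulrC -ltr_pdivlMr.
Qed.

Lemma ccontinuousV s : s != 0 -> ccontinuous (fun w => w^-1) s.
Proof.
move=> s0 e e0; have n0 : 0 < normc s by rewrite normc_gt0.
exists (Num.min (normc s / 2) (e * normc s ^+ 2 / 2)).
  by rewrite lt_min !divr_gt0// mulr_gt0// exprn_gt0.
move=> w; rewrite lt_min => /andP[h1 h2].
have nw : normc s / 2 < normc w.
  have : normc s <= normc w + normc (w - s).
    by rewrite -[s in leLHS](subKr w); exact: le_normcB.
  by move: h1; clear; lra.
have w0 : w != 0 by rewrite -normc_gt0 (lt_trans _ nw)// divr_gt0.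
rewrite (_ : _ - _ = (s - w) / (w * s)); last by field; rewrite s0 w0.
rewrite Normc.normcM Normc.normcV Normc.normcM normcB ltr_pdivrMr; last first.
  by rewrite mulr_gt0 ?normc_gt0.
apply: lt_le_trans h2 _; rewrite -mulrA; apply: ler_wpM2l; first exact: ltW.
by rewrite expr2 mulrAC ler_wpM2r ?normc_ge0// ltW.
Qed.

Definition slope phi s (c : C) w := if w == s then c else (phi w - phi s) / (w - s).

Lemma slopeE phi s c w : phi w - phi s = slope phi s c w * (w - s).
Proof.
rewrite /slope; case: eqP => [->|/eqP ws]; first by rewrite !subrr mulr0.
by rewrite divfK// subr_eq0.
Qed.

Lemma slope_continuous phi s c : has_cderiv phi s c -> ccontinuous (slope phi s c) s.
Proof.
move=> dp e e0; have e2 : 0 < e / 2 by rewrite divr_gt0.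
have [d d0 hd] := dp _ e2; exists d => // w /hd.
rewrite {2}/slope eqxx (slopeE phi s c) -mulrBl Normc.normcM => h.
have [->|ws] := eqVneq w s; first by rewrite /slope eqxx subrr Normc.normc0.
have n0 : 0 < normc (w - s) by rewrite normc_gt0 subr_eq0.
by move: h; rewrite ler_pM2r// => /le_lt_trans; apply; rewrite ltr_pdivrMr// ltr_pMr// ltr1n.
Qed.

(** Caratheodory's form of differentiability: the increment factors through a continuous function,
    whose value at [s] is the derivative. *)
Lemma has_cderiv_slope phi psi s (e0 : R) : 0 < e0 ->
  (forall w, normc (w - s) < e0 -> phi w - phi s = psi w * (w - s)) ->
  ccontinuous psi s -> has_cderiv phi s (psi s).
Proof.
move=> e00 E cpsi e e0'; have [d d0 hd] := cpsi _ e0'.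
exists (Num.min d e0); first by rewrite lt_min d0.
move=> w; rewrite lt_min => /andP[/hd h1 /E ->].
by rewrite -mulrBl Normc.normcM ler_wpM2r ?normc_ge0// ltW.
Qed.

(** The function [psi] is the quotient rule in difference form, obtained from $q(w)(w-s) =
    \varphi(w)-\varphi(s)$ at [w] and at [w1]. *)
Lemma slope_cderiv phi s c w1 : w1 != s -> (exists c1, has_cderiv phi w1 c1) ->
  exists c', has_cderiv (slope phi s c) w1 c'.
Proof.
move=> w1s [c1 dp]; pose q := slope phi s c.
pose psi w := (slope phi w1 c1 w - q w1) * (w - s)^-1.
exists (psi w1); apply: (@has_cderiv_slope _ _ _ (normc (w1 - s))).
- by rewrite normc_gt0 subr_eq0.
- move=> w hw; have ws : w - s != 0.
    by rewrite subr_eq0; apply: contraTneq hw => ->; rewrite -leNgt normcB.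
  apply: (mulIf ws); rewrite /psi mulrBl -slopeE.
  rewrite (_ : _ * (w - w1) * _ = (slope phi w1 c1 w * (w - w1) - q w1 * (w - w1))); last by field.
  rewrite -slopeE (_ : q w1 * (w - w1) = q w1 * (w - s) - q w1 * (w1 - s)); last by ring.
  by rewrite -[q w1 * (w1 - s)]slopeE -/q; ring.
- apply: ccontinuousM.
    by apply: ccontinuousB; [exact: slope_continuous|exact: ccontinuous_cst].
  have c0 : w1 - s != 0 by rewrite subr_eq0.
  move=> e e0; have [d d0 hd] := ccontinuousV c0 e0.
  exists d => // w wd; apply: (hd (w - s)).
  by rewrite (_ : _ - _ = w - w1); last by ring.
Qed.

Lemma path_bounded (h : R -> C) a b : a <= b ->
  (forall t, a <= t <= b -> path_continuous h t) ->
  exists M, forall t, a <= t <= b -> normc (h t) <= M.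
Proof.
move=> ab ch; pose P x y := exists M, forall t, x <= t <= y -> normc (h t) <= M.
apply: (@cousin1 _ P) => // [x z y /andP[xz zy] [M1 h1] [M2 h2]|p pab].
  exists (Num.max M1 M2) => t /andP[xt ty]; rewrite le_max.
  by apply/orP; case: (leP t z) => [tz|/ltW tz]; [left; apply: h1|right; apply: h2]; rewrite ?xt ?tz.
have [d d0 hd] := ch _ pab 1 ltr01; exists d => // x y /andP[xp py] xyd.
exists (normc (h p) + 1) => t /andP[xt ty].
rewrite -[h t](subrK (h p)) addrC; apply: le_trans (le_normcD _ _) _.
rewrite lerD2l ltW// hd//; move: xyd xt ty xp py; clear.
by rewrite ltr_norml; lra.
Qed.

Definition circle_integral q r := angular q r 0 (2 * pi).

Let pi2_ge0 : 0 <= 2 * pi :> R. Proof. by rewrite mulr_ge0// pi_ge0. Qed.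

(** On a full turn the sides at the angles 0 and $2\pi$ coincide and cancel, which leaves $i$ times
    the difference of the two circle integrals. *)
Lemma circle_integral_const q A B : 0 <= A -> A <= B ->
  (forall w, A <= normc w <= B -> exists c, has_cderiv q w c) ->
  circle_integral q A = circle_integral q B.
Proof.
move=> A0 AB dq; have := goursat A0 AB pi2_ge0 dq.
rewrite /polar_boundary /radial cis2pi cis0 subrr add0r => /eqP.
by rewrite mulf_eq0 -normc_eq0 normc_i oner_eq0/= subr_eq0 => /eqP.
Qed.

(** Uniform continuity near a circle, by [cousin1]. It is what carries the value of the integral
    across a radius on which the integrand is only known to be continuous. *)
Lemma circle_integral_continuous q (r0 r : R) : 0 <= r < r0 ->
  (forall w, normc w < r0 -> ccontinuous q w) ->
  forall e, 0 < e -> exists2 d, 0 < d & forall r', 0 <= r' < r0 -> `|r' - r| < d ->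
    normc (circle_integral q r' - circle_integral q r) < e.
Proof.
move=> /andP[r00 rr0] cq e e0.
pose G w := q w * w.
have cG w : normc w < r0 -> ccontinuous G w.
  by move=> /cq cw; apply: ccontinuousM => //; exact: ccontinuous_id.
(* [normc_cintegral] over the length $2\pi$ gives $4\pi e_1 = e\pi/(2(1+\pi)) < e$. *)
pose e1 := e / (8 * (1 + pi)).
have pi1 : 0 < 1 + pi :> R by rewrite ltr_pwDl ?pi_ge0.
have e10 : 0 < e1 by rewrite divr_gt0// mulr_gt0.
have e12 : 0 < e1 / 2 by rewrite divr_gt0.
pose P x y := exists2 d, 0 < d & forall t, x <= t <= y -> forall r', `|r' - r| < d ->
  normc (G (r'%:C * cis t) - G (r%:C * cis t)) <= e1.
have [d d0 hd] : P 0 (2 * pi).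
  apply: cousin1 => // [x z y /andP[xz zy] [d1 d10 h1] [d2 d20 h2]|p _].
    exists (Num.min d1 d2); first by rewrite lt_min d10.
    move=> t /andP[xt ty] r'; rewrite lt_min => /andP[k1 k2].
    by case: (leP t z) => [tz|/ltW tz]; [apply: h1|apply: h2]; rewrite ?xt ?tz.
  have [|d d0 hd] := cG (r%:C * cis p) _ _ e12; first by rewrite normc_polar.
  pose K := 2 + 2 * r; have K0 : 0 < K by rewrite ltr_wpDr// mulr_ge0.
  exists (d / K); first by rewrite divr_gt0.
  move=> x y /andP[xp py] xyd; exists (d / K); first by rewrite divr_gt0.
  have near t r' : `|r' - r| < d / K -> `|t - p| < d / K ->
      normc (G (r'%:C * cis t) - G (r%:C * cis p)) < e1 / 2.
    move=> h1 h2; apply: hd.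
    rewrite (_ : _ - _ = (r' - r)%:C * cis t + r%:C * (cis t - cis p)); last by rewrite rmorphB/=; ring.
    apply: le_lt_trans (le_normcD _ _) _; rewrite !Normc.normcM !normc_real normc_cis mulr1 (ger0_norm r00).
    have l1 := cis_lipschitz t p.
    have l2 : r * normc (cis t - cis p) <= r * (2 * `|t - p|) by rewrite ler_wpM2l.
    move: h1 h2; rewrite !ltr_pdivlMr// => h1 h2.
    apply: le_lt_trans (lerD (lexx _) l2) _.
    rewrite -(ltr_pM2r K0) mulrDl.
    apply: (@lt_le_trans _ _ (d + r * 2 * d)).
      apply: ltr_leD => //; rewrite -!mulrA ler_wpM2l// ler_wpM2l// ltW//.
    by rewrite /K; have := mulr_ge0 r00 (ltW d0); have := d0; clear; lra.
  move=> t /andP[xt ty] r' hr'.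
  have ht : `|t - p| < d / K by move: xyd xt ty xp py; clear; rewrite ltr_norml; lra.
  rewrite (_ : _ - _ = (G (r'%:C * cis t) - G (r%:C * cis p)) - (G (r%:C * cis t) - G (r%:C * cis p))); last by ring.
  apply: le_trans (le_normcB _ _) _; rewrite [e1]splitr ltW// ltrD// near//.
  by rewrite subrr normr0 divr_gt0.
exists d => // r' /andP[r'0 r'r0] rr'.
have ig x : 0 <= x < r0 -> cintegrable 0 (2 * pi) (fun t => q (x%:C * cis t) * (x%:C * cis t)).
  move=> /andP[x0 xr0]; apply: (@angular_integrable _ _ x x x0) => [w /andP[xw wx]|]; last by rewrite lexx.
  by apply: cq; apply: le_lt_trans xr0.
rewrite /circle_integral /angular -cintegralB; try by apply: ig; apply/andP.
apply: le_lt_trans (normc_cintegral (M := e1) pi2_ge0 _ _) _.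
- by apply: cintegrableB; apply: ig; apply/andP.
- by move=> t tt; apply: hd.
- rewrite /e1 subr0 (_ : _ * _ * _ = e * (pi / (2 * (1 + pi)))); last by clear -pi1; move: pi pi1 => p p1; field; rewrite gt_eqF.
  rewrite gtr_pMr// ltr_pdivrMr ?mulr_gt0// mul1r.
  by have := pi_ge0 R; clear; lra.
Qed.

End Taylor.

(** * Cauchy's formula and Taylor expansion in one variable *)

Section Cauchy.
Context {R : realType}.
Local Notation C := R[i].
Implicit Types (q phi : C -> C) (r t : R) (w s : C).

Let pi2_ge0 : 0 <= 2 * pi :> R. Proof. by rewrite mulr_ge0// pi_ge0. Qed.

(** This is Cauchy's formula in disguise. The difference quotient is continuous on the disc and
    known to be differentiable off [s]. Its circle integral is therefore constant on the radii below
    $|s|$ and on those above, continuous in the radius, and 0 at radius 0; hence it vanishes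
    throughout. *)
Lemma cauchy_slope phi (r0 r : R) s (c : C) :
  (forall w, normc w < r0 -> exists c, has_cderiv phi w c) -> has_cderiv phi s c ->
  normc s < r -> r < r0 -> circle_integral (slope phi s c) r = 0.
Proof.
move=> dphi ds sr rr0; set q := slope phi s c; set I := circle_integral q.
pose sg := normc s; have sg0 : 0 <= sg by exact: normc_ge0.
have r_0 : 0 <= r by rewrite (le_trans sg0)// ltW.
have cq w : normc w < r0 -> ccontinuous q w.
  have [-> _|ws /dphi dw] := eqVneq w s; first exact: slope_continuous.
  by have [c' /has_cderiv_continuous] := slope_cderiv c ws dw.
have const A B : 0 <= A -> A <= B -> B < r0 -> (sg < A) || (B < sg) -> I A = I B.
  move=> A0 AB Br0 sAB; apply: circle_integral_const => // w /andP[Aw wB].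
  apply: slope_cderiv; last by apply: dphi; exact: le_lt_trans Br0.
  apply: contraTneq sAB => ws; rewrite negb_or -!leNgt.
  by rewrite /sg -ws Aw wB.
have cI x : 0 <= x < r0 -> forall e, 0 < e -> exists2 d, 0 < d & forall r', 0 <= r' < r0 -> `|r' - x| < d ->
    normc (I r' - I x) < e.
  by move=> h; exact: circle_integral_continuous.
have I0 : I 0 = 0.
  rewrite /I /circle_integral /angular.
  under eq_cintegral do rewrite mul0r mulr0.
  by rewrite cintegral_cst ?mulr0.
have lim x : 0 <= x < r0 -> (forall d, 0 < d -> exists2 r', 0 <= r' < r0 & `|r' - x| < d /\ I r' = 0) -> I x = 0.
  move=> xr0 h; apply: normc_small_eq => e e0; have [d d0 hd] := cI _ xr0 _ e0.
  have [r' r'r0 [r'd Ir']] := h _ d0; have := hd _ r'r0 r'd.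
  by rewrite Ir' normcB => /ltW.
have sr0 : sg < r0 by rewrite (lt_trans sr).
have below x : 0 <= x -> x < sg -> I x = 0.
  move=> x0 xs; rewrite -(const 0 x) ?I0 ?xs ?orbT// (lt_trans xs)//.
have Isg : I sg = 0.
  move: sg0; rewrite le_eqVlt => /predU1P[<-//|sg0].
  apply: lim; first by rewrite ltW.
  move=> d d0; pose x := Num.max (sg / 2) (sg - d / 2).
  have xs : x < sg by rewrite gt_max; apply/andP; split; lra.
  have x0 : 0 <= x by rewrite le_max; apply/orP; left; lra.
  exists x; first by rewrite x0 (lt_trans xs).
  split; last exact: below.
  have : sg - d / 2 <= x by rewrite le_max lexx orbT.
  by rewrite ltr_norml; move: xs; clear -d0; lra.
apply: normc_small_eq => e e0; have [|d d0 hd] := cI sg _ e e0; first by rewrite sg0 sr0.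
pose x := Num.min r (sg + d / 2).
have sx : sg < x by rewrite lt_min sr/=; lra.
have xr : x <= r by rewrite ge_min lexx.
have x0 : 0 <= x by rewrite (le_trans sg0)// ltW.
have : normc (I x - I sg) < e.
  apply: hd; first by rewrite x0 (le_lt_trans xr).
  have : x <= sg + d / 2 by rewrite ge_min lexx orbT.
  by rewrite ltr_norml; move: sx; clear -d0; lra.
by rewrite Isg (const x r)// ?sx// => /ltW.
Qed.

Lemma cisV t : (cis t)^-1 = cis (- t).
Proof.
have c0 : cis t != 0 by rewrite -normc_gt0 normc_cis.
by apply: (mulfI c0); rewrite divff// -cisD subrr cis0.
Qed.

(** For positive [k] the integrand has a periodic primitive. *)
Lemma cintegral_circle_pow (k : nat) (r : R) :
  cintegral 0 (2 * pi) (fun t => (r%:C * cis t)^-1 ^+ k) = if k == 0 then (2 * pi)%:C else 0.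
Proof.
case: eqP => [->|/eqP k0].
  by under eq_cintegral do rewrite expr0; rewrite cintegral_cst// subr0 mulr1.
have ck x : path_continuous (fun t => cis (- k%:R * t)) x.
  apply/path_continuousP; split => /=; apply: continuous_comp => /=;
    try exact: continuous_cos; try exact: continuous_sin;
    by apply: cvgM; [exact: cvg_cst|exact: cvg_id].
have ik : cintegrable 0 (2 * pi) (fun t => cis (- k%:R * t)).
  by apply: path_continuous_integrable => x _.
transitivity (cintegral 0 (2 * pi) (fun t => (r%:C^-1) ^+ k * cis (- k%:R * t))).
  by apply: eq_cintegral => t _; rewrite invfM exprMn cisV cisX mulrN mulNr.
rewrite cintegralZ//; have := cintegral_cis (- k%:R) pi2_ge0; rewrite cintegralZ//.
rewrite mulr0 cis0 mulNr -mulrN -cisX -cisV cis2pi invr1 expr1n subrr => /eqP.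
rewrite mulf_eq0 mulf_eq0 -!(normc_eq0 'i) normc_i oner_eq0 orbF.
rewrite -normc_eq0 normc_real normr_eq0 oppr_eq0 pnatr_eq0 (negPf k0)/= => /eqP ->.
by rewrite mulr0.
Qed.

Section TaylorExpansion.
Variables (phi : C -> C) (r0 r : R).
Hypotheses (r_gt0 : 0 < r) (r_lt : r < r0).
Hypothesis dphi : forall w, normc w < r0 -> exists c, has_cderiv phi w c.

(** Cauchy's integral for the coefficient of order [k] at 0, with the circle of radius [r]
    parametrized by the angle. *)
Definition taylor_coef (k : nat) : C := ((2 * pi)^-1)%:C *
  cintegral 0 (2 * pi) (fun t => phi (r%:C * cis t) * (r%:C * cis t)^-1 ^+ k).

Lemma circle_neq0 t : r%:C * cis t != 0.
Proof. by rewrite -normc_gt0 normc_polar// ltW. Qed.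

Lemma path_continuous_circleV k x : path_continuous (fun t => (r%:C * cis t)^-1 ^+ k) x.
Proof.
elim: k => [|k IH]; first by under eq_fun do rewrite expr0; exact: path_continuous_cst.
under eq_fun do rewrite exprS; apply: path_continuousM => //.
apply: (@ccontinuous_comp _ (fun w => w^-1) (fun t => r%:C * cis t)); last exact/ccontinuousV/circle_neq0.
by apply: path_continuousM; [exact: path_continuous_cst|exact: path_continuous_cis].
Qed.

Lemma path_continuous_phi x : path_continuous (fun t => phi (r%:C * cis t)) x.
Proof.
apply: (@path_continuous_circle _ phi r r (ltW r_gt0)); last by rewrite lexx.
move=> w /andP[_ wr]; have [|c] := dphi (w := w); first exact: le_lt_trans r_lt.
exact: has_cderiv_continuous.
Qed.

Lemma taylor_coef_bound M k : (forall t, 0 <= t <= 2 * pi -> normc (phi (r%:C * cis t)) <= M) ->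
  normc (taylor_coef k) * r ^+ k <= 2 * M.
Proof.
move=> hM; have rk : 0 < r ^+ k by rewrite exprn_gt0.
have pi0 : 0 < 2 * pi :> R by rewrite mulr_gt0// pi_gt0.
rewrite /taylor_coef Normc.normcM normc_real ger0_norm ?invr_ge0//.
rewrite -ler_pdivlMr// ler_pdivrMl//.
apply: le_trans (normc_cintegral (M := M / r ^+ k) pi2_ge0 _ _) _.
- apply: path_continuous_integrable => x _; apply: path_continuousM; first exact: path_continuous_phi.
  exact: path_continuous_circleV.
- move=> t tt; rewrite Normc.normcM normcX Normc.normcV normc_polar ?(ltW r_gt0)// exprVn.
  by rewrite ler_wpM2r ?invr_ge0 ?(ltW rk)// hM.
- by rewrite subr0 mulrC mulrA.
Qed.

(** Let $W$ run over the circle and let $q$ be the difference quotient at $s$. Multiplying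
    $\varphi(W)-\varphi(s) = q(W)(W-s)$ by the geometric sum in $s/W$ expresses $q(W)W$ through the
    terms of the Taylor sum, the terms $\varphi(s)s^kW^{-k}$ and a remainder with the factor $s^K$.
    The integral of $q(W)W$ is 0 by [cauchy_slope], and of the second kind only the term $k = 0$
    survives, which is present because [0 < K]. *)
Lemma taylor_remainder s : normc s < r -> exists B, forall K, (0 < K)%N ->
  normc (phi s - \sum_(k < K) taylor_coef k * s ^+ k) <= B * (normc s / r) ^+ K.
Proof.
move=> sr; have [|c dc] := dphi (w := s); first exact: lt_trans r_lt.
have Iq := cauchy_slope dphi dc sr r_lt.
pose q := slope phi s c; pose W t : C := r%:C * cis t.
have nW t : normc (W t) = r by rewrite normc_polar// ltW.
have Ws t : W t != s by apply: contraTneq sr => <-; rewrite nW ltxx.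
have W0 t : W t != 0 by exact: circle_neq0.
have Wc x : path_continuous W x.
  by apply: path_continuousM; [exact: path_continuous_cst|exact: path_continuous_cis].
have qWc x : path_continuous (fun t => q (W t) * W t) x.
  apply: path_continuousM => //; apply: ccontinuous_comp => //.
  have dW : exists c1, has_cderiv phi (W x) c1 by apply: dphi; rewrite nW.
  by have [c' dc'] := slope_cderiv c (Ws x) dW; exact: has_cderiv_continuous dc'.
have [M hM] := path_bounded pi2_ge0 (fun x _ => qWc x).
exists (2 * M) => K K0; set x := normc s / r.
have pi0 : 0 < 2 * pi :> R by rewrite mulr_gt0// pi_gt0.
have E t : q (W t) * W t = \sum_(k < K) (phi (W t) * (W t)^-1 ^+ k) * s ^+ k
    - \sum_(k < K) (phi s * s ^+ k) * (W t)^-1 ^+ k + (s ^+ K) * (q (W t) * W t * (W t)^-1 ^+ K).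
  rewrite -sumrB; under eq_bigr => k _.
    rewrite (_ : _ - _ = (phi (W t) - phi s) * (s / W t) ^+ k); last by rewrite exprMn; ring.
    rewrite (slopeE phi s c) -/q; over.
  rewrite -mulr_sumr; set y := s / W t.
  have -> : q (W t) * (W t - s) = - (q (W t) * W t) * (y - 1).
    by rewrite /y; field; rewrite W0.
  rewrite -[_ * (y - 1) * _]mulrA -subrX1.
  have -> : s ^+ K * (q (W t) * W t * (W t)^-1 ^+ K) = q (W t) * W t * y ^+ K.
    by rewrite /y exprMn; ring.
  by ring.
have iWc k : cintegrable 0 (2 * pi) (fun t => (W t)^-1 ^+ k).
  by apply: path_continuous_integrable => t _; exact: path_continuous_circleV.
have ipWc k : cintegrable 0 (2 * pi) (fun t => phi (W t) * (W t)^-1 ^+ k).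
  apply: path_continuous_integrable => t _; apply: path_continuousM; first exact: path_continuous_phi.
  exact: path_continuous_circleV.
have iqWc k : cintegrable 0 (2 * pi) (fun t => q (W t) * W t * (W t)^-1 ^+ k).
  apply: path_continuous_integrable => t _; apply: path_continuousM; first exact: qWc.
  exact: path_continuous_circleV.
have i1 : cintegrable 0 (2 * pi) (fun t => \sum_(k < K) (phi (W t) * (W t)^-1 ^+ k) * s ^+ k).
  by apply: cintegrable_sum => k; under eq_fun do rewrite mulrC; exact: cintegrableZ.
have i2 : cintegrable 0 (2 * pi) (fun t => \sum_(k < K) (phi s * s ^+ k) * (W t)^-1 ^+ k).
  by apply: cintegrable_sum => k; exact: cintegrableZ.
set J := cintegral 0 (2 * pi) (fun t => q (W t) * W t * (W t)^-1 ^+ K).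
have p0 : (2 * pi)%:C != 0 :> C by rewrite -normc_gt0 normc_real gtr0_norm.
have S1 : cintegral 0 (2 * pi) (fun t => \sum_(k < K) (phi (W t) * (W t)^-1 ^+ k) * s ^+ k) =
    (\sum_(k < K) taylor_coef k * s ^+ k) * (2 * pi)%:C.
  rewrite cintegral_sum; last by move=> k; under eq_fun do rewrite mulrC; exact: cintegrableZ.
  rewrite mulr_suml; apply: eq_bigr => k _; rewrite cintegralZr// mulrAC; congr (_ * _).
  rewrite /taylor_coef mulrAC -rmorphM/= mulVf ?gt_eqF//.
  by rewrite (_ : 1%:C = 1)// mul1r.
have S2 : cintegral 0 (2 * pi) (fun t => \sum_(k < K) (phi s * s ^+ k) * (W t)^-1 ^+ k) =
    phi s * (2 * pi)%:C.
  rewrite cintegral_sum; last by move=> k; exact: cintegrableZ.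
  under eq_bigr => k _ do rewrite cintegralZ// cintegral_circle_pow.
  case: (K) K0 => // K' _; rewrite big_ord_recl big1 => [|i _]; last by rewrite mulr0.
  by rewrite addr0 expr0 mulr1.
have main : phi s - \sum_(k < K) taylor_coef k * s ^+ k = s ^+ K * J / (2 * pi)%:C.
  apply: (mulIf p0); rewrite divfK// mulrBl -S1 -S2.
  have : cintegral 0 (2 * pi) (fun t => q (W t) * W t) = 0 by exact: Iq.
  rewrite (eq_cintegral (fun t _ => E t)) cintegralD; [|exact: cintegrableB|exact: cintegrableZ].
  rewrite cintegralB// cintegralZ// -/J; move: (cintegral _ _ _) (cintegral _ _ _) (_ * J) => u v x0 /eqP.
  by rewrite addrC addr_eq0 opprB => /eqP.
rewrite main !Normc.normcM Normc.normcV normc_real gtr0_norm// normcX.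
have JM : normc J <= 2 * (M / r ^+ K) * (2 * pi).
  rewrite -[2 * pi in leRHS]subr0; apply: normc_cintegral => // t tt.
  rewrite Normc.normcM normcX Normc.normcV nW exprVn ler_wpM2r ?invr_ge0 ?exprn_ge0 ?(ltW r_gt0)//.
  exact: hM.
rewrite ler_pdivrMr//; apply: le_trans (ler_wpM2l _ JM) _; first by rewrite exprn_ge0// normc_ge0.
by rewrite /x expr_div_n le_eqVlt; apply/orP; left; apply/eqP; ring.
Qed.

Lemma circle_bounded : exists M, forall t, 0 <= t <= 2 * pi -> normc (phi (r%:C * cis t)) <= M.
Proof. by apply: path_bounded => // t _; exact: path_continuous_phi. Qed.

(** The constant of [taylor_remainder] depends on [s] and is only used to see that the remainder
    tends to 0. The explicit bound is that of the tail of a geometric series, with the coefficients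
    estimated by [taylor_coef_bound]. *)
Lemma taylor M s K : (forall t, 0 <= t <= 2 * pi -> normc (phi (r%:C * cis t)) <= M) -> normc s < r ->
  normc (phi s - \sum_(k < K) taylor_coef k * s ^+ k) <=
  2 * M * (normc s / r) ^+ K / (1 - normc s / r).
Proof.
move=> hM sr; set x := normc s / r.
have x0 : 0 <= x by rewrite divr_ge0 ?normc_ge0// ltW.
have x1 : x < 1 by rewrite ltr_pdivrMr// mul1r.
have M0 : 0 <= M by apply: le_trans (normc_ge0 _) (hM 0 _); rewrite lexx.
have [B hB] := taylor_remainder sr.
have tail L : normc (\sum_(j < L) taylor_coef (K + j) * s ^+ (K + j)) <= 2 * M * x ^+ K / (1 - x).
  apply: le_trans (normc_sum _ _ _) _.
  apply: (@le_trans _ _ (\sum_(j < L) 2 * M * x ^+ K * x ^+ j)).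
    apply: ler_sum => j _; rewrite -mulrA -exprD /x expr_div_n Normc.normcM normcX mulrA mulrAC.
    rewrite ler_wpM2r ?exprn_ge0 ?normc_ge0// ler_pdivlMr ?exprn_gt0//.
    exact: taylor_coef_bound.
  rewrite -mulr_sumr ler_wpM2l ?mulr_ge0 ?exprn_ge0//.
  rewrite -[leRHS]mul1r ler_pdivlMr ?subr_gt0// mulrC -opprB mulNr -subrX1 opprB.
  by rewrite lerBlDr lerDl exprn_ge0.
apply/ler_addgt0Pr => e e0.
have [L hL] : exists L, `|B| * x ^+ (K + L.+1) <= e.
  have [L hL] : exists L, `|B| * x ^+ L < e.
    have : (`|B| * x ^+ n) @[n --> \oo] --> `|B| * 0.
      by apply: cvgMr; apply: cvg_expr; rewrite ger0_norm.
    rewrite mulr0 => /cvgrPdist_lt/(_ _ e0)[L _ hL]; exists L.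
    by have := hL L (leqnn _); rewrite sub0r normrN; apply: le_lt_trans; exact: ler_norm.
  exists L; apply: le_trans (ltW hL); rewrite ler_wpM2l//.
  by apply: ler_wiXn2l => //; [exact: ltW|rewrite addnS (leq_trans (leq_addl K L))].
have := hB (K + L.+1)%N (ltn_addl _ (ltn0Sn _)); rewrite big_split_ord/= opprD addrA => h.
rewrite -[X in normc X](subrK (\sum_(j < L.+1) taylor_coef (K + j) * s ^+ (K + j))).
apply: le_trans (le_normcD _ _) _; rewrite addrC; apply: lerD (tail _) _.
apply: le_trans h (le_trans _ hL); rewrite ler_wpM2r ?exprn_ge0//.
exact: ler_norm.
Qed.

Lemma taylor_coef0 : taylor_coef 0 = phi 0.
Proof.
have [M hM] := circle_bounded; apply/eqP; rewrite eq_sym -subr_eq0 -normc_eq0 eq_le normc_ge0 andbT.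
have := taylor (s := 0) 1 hM; rewrite Normc.normc0 => /(_ r_gt0).
by rewrite big_ord1 expr0 mulr1 mul0r mulr0 mul0r.
Qed.

(** The Taylor estimate of order 2 and the definition of the derivative are compared at a small
    positive real [x], then divided by [x]. *)
Lemma taylor_coef1 c : has_cderiv phi 0 c -> taylor_coef 1 = c.
Proof.
move=> dc; have [M hM] := circle_bounded; apply: normc_small_eq => e e0.
have M0 : 0 <= M by apply: le_trans (normc_ge0 _) (hM 0 _); rewrite lexx.
have e2 : 0 < e / 2 by rewrite divr_gt0.
have [d d0 hd] := dc _ e2.
(* For $x \le r/2$ the denominator in [taylor] is at least 1/2, so the error is at most $4M(x/r)^2$;
   the summand 1 keeps [K] positive. *)
pose K := 4 * M / r ^+ 2 + 1; have K0 : 0 < K by rewrite ltr_wpDl// divr_ge0 ?sqr_ge0// mulr_ge0.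
pose x := Num.min (d / 2) (Num.min (r / 2) (e / 2 / K)).
have x0 : 0 < x by rewrite !lt_min !divr_gt0.
have [xd xr xe] : [/\ x < d, x <= r / 2 & x <= e / 2 / K].
  split; last by rewrite !ge_min lexx !orbT.
    by rewrite (@le_lt_trans _ _ (d / 2)) ?ge_min ?lexx// ltr_pdivrMr// ltr_pMr// ltr1n.
  by rewrite !ge_min lexx !orbT.
have nx : normc x%:C = x by rewrite normc_real gtr0_norm.
have := hd x%:C; rewrite !subr0 nx => /(_ xd) h1.
have := taylor (s := x%:C) 2 hM; rewrite nx => /(_ (le_lt_trans xr _)) h2.
have {}h2 : normc (phi x%:C - \sum_(k < 2) taylor_coef k * x%:C ^+ k) <= K * x ^+ 2.
  apply: le_trans (h2 _) _; first by rewrite ltr_pdivrMr// ltr_pMr// ltr1n.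
  have xr2 : 1 / 2 <= 1 - x / r.
    have : x / r <= 1 / 2 by rewrite ler_pdivrMr// mul1r mulrC.
    by move: (x / r) => y hy; lra.
  rewrite ler_pdivrMr; last by apply: lt_le_trans xr2; rewrite divr_gt0.
  apply: (@le_trans _ _ (K * x ^+ 2 * (1 / 2))); last first.
    by rewrite ler_wpM2l// mulr_ge0 ?exprn_ge0 ?(ltW x0) ?(ltW K0).
  rewrite /K expr_div_n -subr_ge0 (_ : _ - _ = x ^+ 2 / 2); last by field; rewrite gt_eqF.
  by rewrite divr_ge0 ?exprn_ge0 ?(ltW x0).
move: h2; rewrite big_ord_recr big_ord1/= expr0 mulr1 expr1 taylor_coef0 => h2.
rewrite -(ler_pM2r x0) -[x in leLHS]nx -Normc.normcM.
rewrite (_ : _ * _ = (phi x%:C - phi 0 - c * x%:C) - (phi x%:C - (phi 0 + taylor_coef 1 * x%:C))); last by ring.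
apply: le_trans (le_normcB _ _) _; apply: le_trans (lerD h1 h2) _.
rewrite expr2 mulrA -mulrDl ler_wpM2r ?(ltW x0)// [leRHS]splitr lerD2l.
by rewrite -ler_pdivlMl// mulrC.
Qed.

Lemma taylor2 M c s : has_cderiv phi 0 c ->
  (forall t, 0 <= t <= 2 * pi -> normc (phi (r%:C * cis t)) <= M) -> normc s <= r / 2 ->
  normc (phi s - phi 0 - c * s) <= 4 * M * (normc s / r) ^+ 2.
Proof.
move=> dc hM sr; have M0 : 0 <= M by apply: le_trans (normc_ge0 _) (hM 0 _); rewrite lexx.
have sr' : normc s < r by apply: le_lt_trans sr _; rewrite ltr_pdivrMr// ltr_pMr// ltr1n.
have := taylor 2 hM sr'; rewrite big_ord_recr big_ord1/= expr0 mulr1 expr1 taylor_coef0 (taylor_coef1 dc).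
rewrite opprD addrA => /le_trans; apply.
have xr2 : 1 / 2 <= 1 - normc s / r.
  have : normc s / r <= 1 / 2 by rewrite ler_pdivrMr// mul1r mulrC.
  by move: (normc s / r) => y hy; lra.
rewrite ler_pdivrMr; last by apply: lt_le_trans xr2; rewrite divr_gt0.
set y := (normc s / r) ^+ 2; have y0 : 0 <= y by exact: sqr_ge0.
apply: (@le_trans _ _ (4 * M * y * (1 / 2))); last by apply: ler_wpM2l => //; apply: mulr_ge0 => //; exact: mulr_ge0.
by rewrite le_eqVlt; apply/orP; left; apply/eqP; field.
Qed.

Lemma cderiv_bound M c : has_cderiv phi 0 c ->
  (forall t, 0 <= t <= 2 * pi -> normc (phi (r%:C * cis t)) <= M) -> normc c <= 2 * M / r.
Proof.
move=> dc hM; have := taylor_coef_bound 1 hM.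
by rewrite (taylor_coef1 dc) expr1 ler_pdivlMr.
Qed.

End TaylorExpansion.
End Cauchy.

(** * Several complex variables *)

Section ComplexSequences.
Context {R : realType}.
Local Notation C := R[i].
Implicit Types (u v : nat -> C) (l : C).

Definition ccvg u l := forall e, 0 < e -> exists N, forall n, (N <= n)%N -> normc (u n - l) < e.

Lemma ccvg_unique u l l' : ccvg u l -> ccvg u l' -> l = l'.
Proof.
move=> h h'; apply: normc_small_eq => e e0; have e2 : 0 < e / 2 by rewrite divr_gt0.
have [N1 h1] := h _ e2; have [N2 h2] := h' _ e2; pose n := maxn N1 N2.
rewrite (_ : l - l' = (u n - l') - (u n - l)); last by ring.
apply: le_trans (le_normcB _ _) _; rewrite [e]splitr ltW// ltrD//.
  by apply: h2; rewrite leq_maxr.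
by apply: h1; rewrite leq_maxl.
Qed.

Lemma ccvg_ReIm u l : ccvg u l <->
  (complex.Re (u n) @[n --> \oo] --> complex.Re l) /\ (complex.Im (u n) @[n --> \oo] --> complex.Im l).
Proof.
split=> [h|[/cvgrPdist_lt hr /cvgrPdist_lt hi] e e0].
  by split; apply/cvgrPdist_lt => e /h[N hN]; exists N => // n /= /hN;
    apply: le_lt_trans; rewrite distrC -?cReB -?cImB ?normc_Re ?normc_Im.
have e2 : 0 < e / 2 by rewrite divr_gt0.
have [N1 _ h1] := hr _ e2; have [N2 _ h2] := hi _ e2; exists (maxn N1 N2) => n.
rewrite geq_max => /andP[n1 n2]; apply: le_lt_trans (normc_le_ReIm _) _.
by rewrite cReB cImB [e]splitr; apply: ltrD; rewrite distrC; [exact: h1|exact: h2].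
Qed.

Lemma cauchy_ccvg u : (forall e, 0 < e -> exists N, forall p q, (N <= p)%N -> (N <= q)%N ->
  normc (u p - u q) < e) -> exists l, ccvg u l.
Proof.
move=> h.
have C1 (f : nat -> R) : (forall e, 0 < e -> exists N, forall p q, (N <= p)%N -> (N <= q)%N ->
    `|f p - f q| < e) -> exists a : R, f n @[n --> \oo] --> a.
  move=> hf; apply/cvg_ex; apply: cauchy_cvg; apply/cauchyP => e /hf[N hN].
  exists (f N); exists N => // n /= Nn; rewrite /ball/=.
  by apply: hN.
have [a ha] : exists a : R, complex.Re (u n) @[n --> \oo] --> a.
  apply: C1 => e /h[N hN]; exists N => p q Np Nq.
  by rewrite -cReB; apply: le_lt_trans (hN _ _ Np Nq); exact: normc_Re.
have [b hb] : exists b : R, complex.Im (u n) @[n --> \oo] --> b.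
  apply: C1 => e /h[N hN]; exists N => p q Np Nq.
  by rewrite -cImB; apply: le_lt_trans (hN _ _ Np Nq); exact: normc_Im.
by exists (a +i* b); apply/ccvg_ReIm.
Qed.

Lemma ccvg_cst l : ccvg (fun=> l) l.
Proof. by move=> e e0; exists 0%N => n _; rewrite subrr Normc.normc0. Qed.

Lemma ccvgD u v l l' : ccvg u l -> ccvg v l' -> ccvg (fun n => u n + v n) (l + l').
Proof.
move=> h h' e e0; have e2 : 0 < e / 2 by rewrite divr_gt0.
have [N1 h1] := h _ e2; have [N2 h2] := h' _ e2; exists (maxn N1 N2) => n.
rewrite geq_max => /andP[/h1 k1 /h2 k2].
rewrite (_ : _ - _ = (u n - l) + (v n - l')); last by ring.
by apply: le_lt_trans (le_normcD _ _) _; rewrite [e]splitr ltrD.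
Qed.

Lemma ccvgZ (c : C) u l : ccvg u l -> ccvg (fun n => c * u n) (c * l).
Proof.
move=> h e e0; have K0 : 0 < normc c + 1 by rewrite ltr_wpDl ?normc_ge0.
have [N hN] := h _ (divr_gt0 e0 K0); exists N => n /hN; rewrite ltr_pdivlMr// => k.
rewrite -mulrBr Normc.normcM; apply: le_lt_trans k.
by rewrite mulrC ler_wpM2l ?normc_ge0// lerDl.
Qed.

Lemma ccvgB u v l l' : ccvg u l -> ccvg v l' -> ccvg (fun n => u n - v n) (l - l').
Proof.
move=> h h'; rewrite -mulN1r (_ : (fun n => _) = (fun n => u n + -1 * v n)).
  by apply: ccvgD => //; exact: ccvgZ.
by apply/funext => n; rewrite mulN1r.
Qed.

Lemma ccvg_sum (I : Type) (r : seq I) (u : I -> nat -> C) (l : I -> C) :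
  (forall i, ccvg (u i) (l i)) -> ccvg (fun n => \sum_(i <- r) u i n) (\sum_(i <- r) l i).
Proof.
move=> h; elim: r => [|i r IH].
  by rewrite big_nil; under eq_fun do rewrite big_nil; exact: ccvg_cst.
by rewrite big_cons; under eq_fun do rewrite big_cons; exact: ccvgD.
Qed.

Lemma ccvg_bound u l M : ccvg u l -> (exists N, forall n, (N <= n)%N -> normc (u n) <= M) -> normc l <= M.
Proof.
move=> h [N hN]; apply/ler_addgt0Pr => e /h[N' hN'].
rewrite -[l](subKr (u (maxn N N'))) addrC addrC; apply: le_trans (le_normcB _ _) _.
by apply: lerD; [exact/hN/leq_maxl|exact/ltW/hN'/leq_maxr].
Qed.

Lemma eq_ccvg u v l : (exists N, forall n, (N <= n)%N -> u n = v n) -> ccvg u l -> ccvg v l.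
Proof.
move=> [N hN] h e /h[N' hN']; exists (maxn N N') => n; rewrite geq_max => /andP[n1 n2].
by rewrite -hN//; exact: hN'.
Qed.

End ComplexSequences.

(** * Differentiability in several variables and locally bounded limits *)

Section Holomorphy.
Context {R : realType} {n : nat}.
Local Notation C := R[i].
Local Notation V := 'cV[C]_n.
Implicit Types (f g : V -> C) (z w h : V).

(** The $\ell^1$ norm, with values in [R] instead of [R[i]]. *)
Definition mnorm z : R := \sum_i normc (z i 0).

Lemma mnorm_ge0 z : 0 <= mnorm z.
Proof. by apply: sumr_ge0 => i _; exact: normc_ge0. Qed.

Lemma mnorm0 : mnorm 0 = 0.
Proof. by rewrite /mnorm big1// => i _; rewrite mxE Normc.normc0. Qed.

Lemma mnormD z w : mnorm (z + w) <= mnorm z + mnorm w.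
Proof.
rewrite /mnorm -big_split/=; apply: ler_sum => i _; rewrite mxE; exact: le_normcD.
Qed.

Lemma mnormZ (a : C) z : mnorm (a *: z) = normc a * mnorm z.
Proof. by rewrite /mnorm mulr_sumr; apply: eq_bigr => i _; rewrite mxE Normc.normcM. Qed.

Lemma mnorm_eq0 z : mnorm z = 0 -> z = 0.
Proof.
move=> h; apply/matrixP => i j; rewrite ord1 mxE; apply: Normc.eq0_normc.
apply/eqP; rewrite eq_le normc_ge0 andbT -h /mnorm (bigD1 i)//= lerDl.
by apply: sumr_ge0 => k _; exact: normc_ge0.
Qed.

Definition complex_linear (L : V -> C) := forall a u v, L (a *: u + v) = a * L u + L v.

Lemma complex_linearZ L a u : complex_linear L -> L (a *: u) = a * L u.
Proof.
move=> lL; have L0 : L 0 = 0.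
  by have := lL (-1) 0 0; rewrite scaler0 addr0 mulN1r addNr.
by rewrite -[a *: u]addr0 lL L0 addr0.
Qed.

Definition hol_at f z := exists2 L, complex_linear L & forall e, 0 < e ->
  exists2 d, 0 < d & forall h, mnorm h < d -> normc (f (z + h) - f z - L h) <= e * mnorm h.

Lemma hol_at_line f z h (s : C) : hol_at f (z + s *: h) ->
  exists c, has_cderiv (fun s => f (z + s *: h)) s c.
Proof.
move=> [L lL hL]; exists (L h) => e e0.
have K0 : 0 < mnorm h + 1 by rewrite ltr_wpDl ?mnorm_ge0.
have [d d0 hd] := hL _ (divr_gt0 e0 K0); exists (d / (mnorm h + 1)); first by rewrite divr_gt0.
move=> w; rewrite ltr_pdivlMr// => wd.
have le1 : normc (w - s) * mnorm h <= normc (w - s) * (mnorm h + 1).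
  by rewrite ler_wpM2l ?normc_ge0// lerDl.
have := hd ((w - s) *: h); rewrite mnormZ => /(_ (le_lt_trans le1 wd)).
rewrite (_ : z + s *: h + _ = z + w *: h); last by rewrite -addrA -scalerDl [s + _]addrC subrK.
rewrite complex_linearZ// [_ * L h]mulrC => /le_trans; apply.
apply: le_trans (ler_wpM2l _ le1) _; first by rewrite divr_ge0 ?ltW.
by rewrite mulrCA mulrA -mulrA divfK ?gt_eqF// mulrC.
Qed.

Lemma hol_at_deriv0 f z h L : complex_linear L -> (forall e, 0 < e ->
  exists2 d, 0 < d & forall h, mnorm h < d -> normc (f (z + h) - f z - L h) <= e * mnorm h) ->
  has_cderiv (fun s => f (z + s *: h)) 0 (L h).
Proof.
move=> lL hL e e0.
have K0 : 0 < mnorm h + 1 by rewrite ltr_wpDl ?mnorm_ge0.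
have [d d0 hd] := hL _ (divr_gt0 e0 K0); exists (d / (mnorm h + 1)); first by rewrite divr_gt0.
move=> w; rewrite ltr_pdivlMr// subr0 => wd.
have le1 : normc w * mnorm h <= normc w * (mnorm h + 1).
  by rewrite ler_wpM2l ?normc_ge0// lerDl.
have := hd (w *: h); rewrite mnormZ => /(_ (le_lt_trans le1 wd)).
rewrite scale0r addr0 complex_linearZ// [_ * L h]mulrC => /le_trans; apply.
apply: le_trans (ler_wpM2l _ le1) _; first by rewrite divr_ge0 ?ltW.
by rewrite mulrCA mulrA -mulrA divfK ?gt_eqF// mulrC.
Qed.

(* Second order Taylor estimate, from the one-variable one on complex lines. *)
Lemma hol_quadratic f z (rho M : R) : 0 < rho ->
  (forall w, mnorm (w - z) < rho -> hol_at f w) ->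
  (forall w, mnorm (w - z) < rho -> normc (f w) <= M) ->
  exists2 L, complex_linear L & forall h,
    normc (L h) <= 4 * M * mnorm h / rho /\
    (mnorm h <= rho / 4 -> normc (f (z + h) - f z - L h) <= 16 * M * (mnorm h / rho) ^+ 2).
Proof.
move=> rho0 hf fM.
have [|L lL hL] := hf z; first by rewrite subrr mnorm0.
exists L => // h; have dL := hol_at_deriv0 h lL hL.
have [h0|] := leP (mnorm h) 0.
  have {}h0 : h = 0 by apply: mnorm_eq0; apply/eqP; rewrite eq_le h0 mnorm_ge0.
  have L0 : L h = 0 by rewrite h0 -(scale0r 0) complex_linearZ// mul0r.
  by rewrite L0 h0 addr0 !subrr Normc.normc0 mnorm0 mulr0 !mul0r expr0n/= mulr0.
(* The line $s \mapsto z + sh$ stays in the ball for $|s| < \rho/|h|$. The one-variable estimates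
   are used on the circle of half that radius, at $s = 1$; the condition $|h| \le \rho/4$ says that
   $1 \le r/2$. *)
move=> h0; pose r := rho / mnorm h / 2; pose r0 := rho / mnorm h.
have r0_gt0 : 0 < r0 by rewrite divr_gt0.
have rr0 : r < r0 by rewrite ltr_pdivrMr// ltr_pMr// ltr1n.
have rgt0 : 0 < r by rewrite divr_gt0.
have hphi (s : C) : normc s < r0 -> exists c, has_cderiv (fun s => f (z + s *: h)) s c.
  rewrite ltr_pdivlMr// => wr; apply: hol_at_line; apply: hf.
  by rewrite addrC addKr mnormZ.
have hM t : 0 <= t <= 2 * pi -> normc (f (z + (r%:C * cis t) *: h)) <= M.
  move=> _; apply: fM; rewrite addrC addKr mnormZ normc_polar ?(ltW rgt0)//.
  by rewrite /r mulrAC divfK ?gt_eqF// ltr_pdivrMr// ltr_pMr// ltr1n.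
split.
  apply: le_trans (cderiv_bound rgt0 rr0 hphi dL hM) _.
  by rewrite le_eqVlt; apply/orP; left; apply/eqP; rewrite /r; field; rewrite !gt_eqF.
move=> hle; have := taylor2 (s := 1) rgt0 rr0 hphi dL hM.
rewrite scale1r scale0r addr0 mulr1 Normc.normc1 => /(_ _)/le_trans; apply.
  by rewrite /r !ler_pdivlMr//; move: hle; rewrite ler_pdivlMr//; move: (mnorm h) => x; lra.
by rewrite le_eqVlt; apply/orP; left; apply/eqP; rewrite /r; field; rewrite !gt_eqF.
Qed.

(** Pointwise convergence suffices because [hol_quadratic] bounds the second order errors uniformly
    in [j]. The differentials [L j h] form a Cauchy sequence, as $t L_j h$ is an increment of [f_ j]
    up to $O(t^2)$; the quadratic estimate then passes to the limit. *)
Lemma hol_limit (f_ : nat -> V -> C) f z (rho M : R) : 0 < rho ->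
  (forall j w, mnorm (w - z) < rho -> hol_at (f_ j) w) ->
  (forall j w, mnorm (w - z) < rho -> normc (f_ j w) <= M) ->
  (forall w, mnorm (w - z) < rho -> ccvg (fun j => f_ j w) (f w)) ->
  hol_at f z.
Proof.
move=> rho0 hf fM cf.
have M0 : 0 <= M by apply: le_trans (normc_ge0 _) (fM 0%N z _); rewrite subrr mnorm0.
have /choice[L hL] : forall j, exists L, complex_linear L /\ forall h,
    normc (L h) <= 4 * M * mnorm h / rho /\
    (mnorm h <= rho / 4 -> normc (f_ j (z + h) - f_ j z - L h) <= 16 * M * (mnorm h / rho) ^+ 2).
  by move=> j; have [L lL hL] := hol_quadratic rho0 (hf j) (fM j); exists L.
have lL j : complex_linear (L j) by have [] := hL j.
have qL j h : mnorm h <= rho / 4 -> normc (f_ j (z + h) - f_ j z - L j h) <= 16 * M * (mnorm h / rho) ^+ 2.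
  by have [_ /(_ h)[]] := hL j.
have small h : mnorm h <= rho / 4 -> mnorm (z + h - z) < rho.
  by move=> hle; rewrite addrC addKr (le_lt_trans hle)// ltr_pdivrMr// ltr_pMr// ltr1n.
have cz : ccvg (fun j => f_ j z) (f z) by apply: cf; rewrite subrr mnorm0.
have cL h : exists l, ccvg (fun j => L j h) l.
  apply: cauchy_ccvg => e e0.
  (* Twice the quadratic error at $th$ is below $t^2K \le te/2$; the two increments, each within
     $te/4$ of their limit, use the other half. *)
  pose K := 32 * M * (mnorm h / rho) ^+ 2 + 1.
  have K0 : 0 < K by rewrite ltr_wpDl// mulr_ge0 ?sqr_ge0// mulr_ge0.
  pose t := Num.min (rho / 4 / (mnorm h + 1)) (e / 2 / K).
  have h10 : 0 < mnorm h + 1 by rewrite ltr_wpDl ?mnorm_ge0.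
  have t0 : 0 < t by rewrite lt_min !divr_gt0.
  have th : mnorm (t%:C *: h) <= rho / 4.
    rewrite mnormZ normc_real gtr0_norm//; apply: (@le_trans _ _ (t * (mnorm h + 1))).
      by rewrite ler_wpM2l ?(ltW t0)// lerDl.
    by rewrite -ler_pdivlMr// ge_min lexx.
  have te : t * K <= e / 2 by rewrite -ler_pdivlMr// ge_min lexx orbT.
  have := ccvgB (cf _ (small _ th)) cz => /(_ (t * (e / 4))).
  case; first by rewrite mulr_gt0// divr_gt0.
  move=> N hN; exists N => p q /hN hp /hN hq.
  have := qL p _ th; have := qL q _ th; rewrite !complex_linearZ// mnormZ normc_real gtr0_norm//.
  set Q := 16 * M * _ => k1 k2.
  have QE : Q + Q <= t * (e / 2).
    apply: (@le_trans _ _ (t * (t * K))); last by rewrite ler_wpM2l// ltW.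
    rewrite -subr_ge0 /Q /K (_ : _ - _ = t ^+ 2); first exact: sqr_ge0.
    by field; rewrite gt_eqF.
  rewrite -(ltr_pM2l t0) -{1}(gtr0_norm t0) -normc_real -Normc.normcM.
  move: (f_ p _) (f_ p z) (f_ q _) (f_ q z) (f (z + _)) (f z) hp hq k1 k2 => a1 a2 b1 b2 l1 l2 hp hq k1 k2.
  rewrite (_ : _ * _ = (a1 - a2 - (l1 - l2)) - (b1 - b2 - (l1 - l2)) - (a1 - a2 - t%:C * L p h) + (b1 - b2 - t%:C * L q h)); last by ring.
  apply: le_lt_trans (le_normcD _ _) _; apply: le_lt_trans (lerD (le_normcB _ _) (lexx _)) _.
  apply: le_lt_trans (lerD (lerD (le_normcB _ _) (lexx _)) (lexx _)) _.
  move: hp hq k1 k2 QE; clear.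
  move: (normc _) (normc _) (normc _) (normc _) => n1 n2 n3 n4; lra.
have [l hl] := choice cL.
exists l.
  move=> a u v; apply: (ccvg_unique (hl (a *: u + v))).
  rewrite (_ : (fun j => _) = (fun j => a * L j u + L j v)).
    by apply: ccvgD; [apply: ccvgZ|].
  by apply/funext => j; rewrite lL.
move=> e e0; pose K := 16 * M / rho ^+ 2 + 1.
have K0 : 0 < K by rewrite ltr_wpDl// mulr_ge0 ?invr_ge0 ?sqr_ge0// mulr_ge0.
exists (Num.min (rho / 4) (e / K)); first by rewrite lt_min !divr_gt0.
move=> h; rewrite lt_min => /andP[/ltW h4 he].
have := ccvgB (ccvgB (cf _ (small _ h4)) cz) (hl h).
move=> /ccvg_bound -/(_ (e * mnorm h)); apply; exists 0%N => j _.
apply: le_trans (qL j _ h4) _; rewrite expr_div_n.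
apply: (@le_trans _ _ (K * mnorm h * mnorm h)); last first.
  by rewrite ler_wpM2r ?mnorm_ge0// mulrC -ler_pdivlMr// ltW.
rewrite /K -subr_ge0 (_ : _ - _ = mnorm h ^+ 2); first exact: sqr_ge0.
by field; rewrite gt_eqF.
Qed.

End Holomorphy.

(** * Equivalence of [hol_at] with complex differentiability *)

Lemma differentiable_bound (K : numFieldType) (V W : normedModType K) (f : V -> W)
  (L : {linear V -> W}) (z : V) : continuous L ->
  (forall e, 0 < e -> \forall h \near 0, `|f (z + h) - f z - L h| <= e * `|h|) ->
  differentiable f z.
Proof.
move=> cL hL; have E : f \o shift z = cst (f z) + L +o_ 0 id.
  apply/eqaddoP => e /hL; apply: filterS => h.
  by rewrite !fctE /= [h + z]addrC opprD addrA.
by apply/diff_locallyP; rewrite (diff_unique cL E).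
Qed.

Section Differentiability.
Context {R : realType} {n : nat}.
Local Notation C := R[i].
Local Notation V := 'cV[C]_n.
Implicit Types (f g : V -> C) (z w h : V).

Lemma mx_norm_lt h (e : R) : 0 < e -> (`|h| < e%:C) <-> (forall i, normc (h i 0) < e).
Proof.
move=> e0; have b (x : V) : `|x| < e%:C <-> ball (0 : V) e%:C x.
  by rewrite mx_norm_ball /ball_ /= sub0r normrN.
rewrite b; split=> [h1 i|h1].
  by have := h1.2 i 0; rewrite /ball /= /ball_ /= mxE sub0r normrN normcE_C ltcR.
split; first by rewrite ltcR.
by move=> i j; rewrite ord1 /ball /= /ball_ /= mxE sub0r normrN normcE_C ltcR.
Qed.

Lemma normc_le_mnorm h i : normc (h i 0) <= mnorm h.
Proof.
by rewrite /mnorm (bigD1 i)//= lerDl; apply: sumr_ge0 => k _; exact: normc_ge0.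
Qed.

Lemma mx_norm_real h : exists2 r : R, `|h| = r%:C & 0 <= r.
Proof.
have : 0 <= `|h| by exact: normr_ge0.
by case: `|h| => a b; rewrite lecE /= => /andP[/eqP -> a0]; exists a.
Qed.

Lemma mx_norm_le_mnorm h : `|h| <= (mnorm h)%:C.
Proof.
have [r hr r0] := mx_norm_real h; rewrite hr lecR.
apply/ler_addgt0Pr => e e0; apply/ltW; rewrite -ltcR -hr; apply/mx_norm_lt => [|i].
  by rewrite ltr_wpDl ?mnorm_ge0.
by rewrite (le_lt_trans (normc_le_mnorm h i))// ltrDl.
Qed.

Lemma mnorm_le_mx_norm h : (mnorm h)%:C <= n%:R * `|h|.
Proof.
have [r hr r0] := mx_norm_real h; rewrite hr -(rmorph_nat (real_complex R)) -rmorphM lecR.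
rewrite -[X in _ <= X%:R * _](card_ord n) -mulr_natl mulr_natl -sumr_const /mnorm mulr_suml.
apply: ler_sum => i _; rewrite mul1r.
apply/ler_addgt0Pr => e e0; apply/ltW; have re : 0 < r + e by rewrite ltr_wpDl.
by apply: (mx_norm_lt h re).1; rewrite hr ltcR ltrDl.
Qed.

Lemma differentiable_hol_at f z : differentiable f z -> hol_at f z.
Proof.
move=> /diff_locallyP[_ /eqaddoP df].
exists ('d f z); first by move=> a u v; rewrite linearP.
move=> e e0; have eC : 0 < e%:C by rewrite ltcR.
have /nbhs_ballP[d /= d0 hd] := df _ eC.
have [d' dE d'0] : exists2 d' : R, d = d'%:C & 0 < d'.
  by move: d0; case: d {hd} => a b; rewrite ltcE /= => /andP[/eqP -> a0]; exists a.
exists d' => // h hh.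
have /hd : ball (0 : V) d h.
  rewrite mx_norm_ball /ball_ /= sub0r normrN dE; apply/mx_norm_lt => // i.
  exact: le_lt_trans (normc_le_mnorm h i) hh.
rewrite /= -![(_ - _) _]/(_ - _) /cst -![(_ + _) _]/(_ + _) normcE_C addrC opprD addrA => h1.
rewrite addrAC /= [h + z]addrC in h1.
have := le_trans h1 (ler_wpM2l (ltW eC) (mx_norm_le_mnorm h)).
by rewrite -rmorphM/= lecR.
Qed.

Lemma hol_at_differentiable f z : hol_at f z -> differentiable f z.
Proof.
move=> [L lL hL].
pose HL := GRing.isLinear.Build C V C *:%R L lL.
pose LL : {linear V -> C} := HB.pack L HL.
have cL : continuous LL.
  apply: bounded_linear_continuous; apply/linear_boundedP.
  pose B := \sum_i normc (L (delta_mx i 0)).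
  have B0 : 0 <= B by apply: sumr_ge0 => i _; exact: normc_ge0.
  near=> r => x.
  have -> : LL x = \sum_i x i 0 * L (delta_mx i 0).
    rewrite [in LHS](matrix_sum_delta x) linear_sum; apply: eq_bigr => i _.
    by rewrite big_ord1 linearZ.
  rewrite normcE_C; apply: (@le_trans _ _ (B%:C * `|x|)); last first.
    rewrite ler_wpM2r//; near: r; apply: nbhs_pinfty_ge.
    by rewrite complex_real.
  have [s hs s0] := mx_norm_real x; rewrite hs -rmorphM lecR.
  apply: le_trans (normc_sum _ _ _) _; rewrite /B mulr_suml; apply: ler_sum => i _.
  rewrite Normc.normcM mulrC ler_wpM2l ?normc_ge0//.
  apply/ler_addgt0Pr => e e0; apply/ltW; have re : 0 < s + e by rewrite ltr_wpDl.
  by apply: (mx_norm_lt x re).1; rewrite hs ltcR ltrDl.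
apply: (@differentiable_bound _ _ _ f LL z cL) => e e0.
  (* The factor [n] compares [mnorm] with the maximum norm; 1 is added so that [N] is positive even
     for [n = 0]. *)
  pose N := (n%:R + 1 : R).
  have N0 : 0 < N by rewrite ltr_wpDl.
  have [e' eE e'0] : exists2 e' : R, e = e'%:C & 0 < e'.
    by move: e0; case: e => a b; rewrite ltcE /= => /andP[/eqP -> a0]; exists a.
  have [d d0 hd] := hL _ (divr_gt0 e'0 N0).
  apply/nbhs_ballP; exists (d / N)%:C; first by rewrite /= ltcR divr_gt0.
  move=> h; rewrite mx_norm_ball /ball_ /= sub0r normrN => hh.
  have [s hs s0] := mx_norm_real h; have := mnorm_le_mx_norm h.
  rewrite hs -(rmorph_nat (real_complex R)) -rmorphM lecR => hm.
  have mN : mnorm h <= N * s by apply: le_trans hm _; rewrite ler_wpM2r// lerDl.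
  suff : (normc (f (z + h) - f z - L h))%:C <= e'%:C * s%:C by rewrite eE -hs.
  rewrite -rmorphM lecR; apply: le_trans (hd h _) _.
    by apply: le_lt_trans mN _; move: hh; rewrite hs ltcR ltr_pdivlMr// mulrC.
  apply: le_trans (ler_wpM2l _ mN) _; first by rewrite divr_ge0 ?ltW.
  by rewrite mulrA divfK ?gt_eqF.
Unshelve. all: by end_near. Qed.

Lemma holomorphic_hol_at f : holomorphic f <-> (forall z, unit_ball z -> hol_at f z).
Proof.
by split=> h z /h; [exact: differentiable_hol_at|exact: hol_at_differentiable].
Qed.

End Differentiability.

(** * Homogeneous holomorphic functions are polynomials *)

Section HomogeneousHolomorphic.
Context {R : realType} {n : nat}.
Local Notation C := R[i].
Local Notation V := 'cV[C]_n.
Implicit Types (f g : V -> C) (z w h : V) (alpha : {ffun 'I_n -> nat}).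

(* [monomial], for a number of variables that need not be of the form \sum_j k j. *)
Definition mono alpha z : C := \prod_i z i 0 ^+ alpha i.

Definition polyeval (s : seq (C * {ffun 'I_n -> nat})) z := \sum_(p <- s) p.1 * mono p.2 z.

Definition mdegree alpha := (\sum_i alpha i)%N.

Lemma monoZ alpha (t : C) z : mono alpha (t *: z) = t ^+ mdegree alpha * mono alpha z.
Proof.
rewrite /mono /mdegree -prodrXr -big_split/=.
by apply: eq_bigr => i _; rewrite mxE exprMn.
Qed.

Lemma polyevalZ s d (t : C) z : (forall p, p \in s -> mdegree p.2 = d) ->
  polyeval s (t *: z) = t ^+ d * polyeval s z.
Proof.
move=> sd; rewrite /polyeval mulr_sumr; apply: eq_big_seq => p ps.
by rewrite monoZ sd// mulrCA.
Qed.

Lemma has_cderiv_unique (phi : C -> C) s c c' : has_cderiv phi s c -> has_cderiv phi s c' -> c = c'.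
Proof.
move=> h h'; apply: normc_small_eq => e e0; have e2 : 0 < e / 2 by rewrite divr_gt0.
have [d d0 hd] := h _ e2; have [d' d'0 hd'] := h' _ e2.
pose x := Num.min d d' / 2; have x0 : 0 < x by rewrite divr_gt0// lt_min d0.
have [xd xd'] : x < d /\ x < d'.
  have : x < Num.min d d' by rewrite ltr_pdivrMr// ltr_pMr ?ltr1n// lt_min d0.
  by rewrite lt_min => /andP.
have nx : normc (s + x%:C - s) = x by rewrite addrC addKr normc_real gtr0_norm.
have := hd (s + x%:C); have := hd' (s + x%:C); rewrite nx => /(_ xd') k' /(_ xd) k.
rewrite -(ler_pM2r x0) -[x in leLHS]nx -Normc.normcM.
set y := s + x%:C in k k' *.
rewrite (_ : (c - c') * _ = (phi y - phi s - c' * (y - s)) - (phi y - phi s - c * (y - s))); last by ring.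
apply: le_trans (le_normcB _ _) _; apply: le_trans (lerD k' k) _.
by rewrite -mulrDl -splitr.
Qed.

Lemma ccontinuousD (phi psi : C -> C) s : ccontinuous phi s -> ccontinuous psi s ->
  ccontinuous (fun x => phi x + psi x) s.
Proof.
move=> c1 c2; rewrite (_ : (fun x => _) = (fun x => phi x - (0 - psi x))); last first.
  by apply/funext => x; rewrite sub0r opprK.
by apply: ccontinuousB => //; apply: ccontinuousB => //; exact: ccontinuous_cst.
Qed.

(** The derivative at the point 1 of a ray of a function homogeneous of degree [d], for use in
    Euler's identity. *)
Lemma has_cderiv_pow (d : nat) (c : C) : has_cderiv (fun s => (1 + s) ^+ d * c) 0 (d%:R * c).
Proof.
pose psi (s : C) := (\sum_(i < d) (1 + s) ^+ i) * c.
have -> : d%:R * c = psi 0.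
  by rewrite /psi addr0; under eq_bigr do rewrite expr1n; rewrite sumr_const card_ord.
apply: (@has_cderiv_slope _ _ _ _ 1 ltr01) => [w _|].
  rewrite subr0 addr0 expr1n -mulrBl subrX1 /psi.
  by rewrite [1 + w]addrC addrK -mulrA mulrC.
apply: ccontinuousM; last exact: ccontinuous_cst.
have pw i : ccontinuous (fun w : C => (1 + w) ^+ i) 0.
  elim: i => [|i IH]; first by under eq_fun do rewrite expr0; exact: ccontinuous_cst.
  under eq_fun do rewrite exprS; apply: ccontinuousM => //.
  by apply: ccontinuousD; [exact: ccontinuous_cst|exact: ccontinuous_id].
elim: d {psi} => [|d IH]; first by under eq_fun do rewrite big_ord0; exact: ccontinuous_cst.
by under eq_fun do rewrite big_ord_recr/=; exact: ccontinuousD.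
Qed.

Lemma complex_linear_sum (L : V -> C) z : complex_linear L ->
  L z = \sum_i z i 0 * L (delta_mx i 0).
Proof.
move=> lL; have LZ := fun a u => complex_linearZ a u lL.
have L0 : L 0 = 0 by rewrite -(scale0r 0) LZ mul0r.
have LS (r : seq 'I_n) : L (\sum_(i <- r) z i 0 *: delta_mx i 0) =
    \sum_(i <- r) z i 0 * L (delta_mx i 0).
  by elim: r => [|i r IH]; rewrite ?big_nil// !big_cons lL IH.
rewrite -LS; congr L; rewrite [LHS]matrix_sum_delta; apply: eq_bigr => i _.
by rewrite big_ord1.
Qed.

Lemma complex_linear_bound (L : V -> C) : complex_linear L ->
  exists2 B, 0 <= B & forall h, normc (L h) <= B * mnorm h.
Proof.
move=> lL; exists (\sum_i normc (L (delta_mx i 0))).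
  by apply: sumr_ge0 => i _; exact: normc_ge0.
move=> h; rewrite complex_linear_sum//; apply: le_trans (normc_sum _ _ _) _.
rewrite mulr_suml; apply: ler_sum => i _; rewrite Normc.normcM mulrC.
by rewrite ler_wpM2l ?normc_ge0// normc_le_mnorm.
Qed.

Lemma hol_at_bounded f z : hol_at f z -> exists M, exists2 d, 0 < d &
  forall w, mnorm (w - z) < d -> normc (f w) <= M.
Proof.
move=> [L lL hL]; have [B B0 hB] := complex_linear_bound lL.
have [d d0 hd] := hL _ ltr01; exists (normc (f z) + (B + 1) * d); exists d => // w wd.
have := hd _ wd; rewrite addrCA subrr addr0 mul1r => h1.
rewrite -[f w](subrK (f z + L (w - z))) addrC.
apply: le_trans (le_normcD _ _) _; rewrite opprD addrA.
apply: le_trans (lerD (le_normcD _ _) h1) _; rewrite -addrA lerD2l.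
apply: le_trans (lerD (hB _) (lexx _)) _; rewrite -{2}[mnorm _]mul1r -mulrDl.
by rewrite ler_wpM2l ?addr_ge0// ltW.
Qed.

Lemma hol_at_combination f g z (a : C) : hol_at f z -> hol_at g z ->
  hol_at (fun w => a * f w + g w) z.
Proof.
move=> [L lL hL] [L' lL' hL']; exists (fun h => a * L h + L' h).
  by move=> b u v; rewrite lL lL'; ring.
move=> e e0; have K0 : 0 < normc a + 1 by rewrite ltr_wpDl ?normc_ge0.
have [d d0 hd] := hL _ (divr_gt0 e0 K0 : 0 < e / (normc a + 1)).
have e1 : 0 < e / (normc a + 1) by rewrite divr_gt0.
have [d' d'0 hd'] := hL' _ e1.
exists (Num.min d d'); first by rewrite lt_min d0.
move=> h; rewrite lt_min => /andP[/hd h1 /hd' h2].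
rewrite (_ : _ - _ - _ = a * (f (z + h) - f z - L h) + (g (z + h) - g z - L' h)); last by ring.
apply: le_trans (le_normcD _ _) _; rewrite Normc.normcM.
apply: le_trans (lerD (ler_wpM2l (normc_ge0 _) h1) h2) _.
rewrite -{2}[e / _ * _]mul1r -mulrDl mulrA [_ * (e / _)]mulrC divfK ?gt_eqF//.
Qed.

Lemma hol_at_shift f z c : hol_at f (z + c) -> hol_at (fun w => f (w + c)) z.
Proof.
move=> [L lL hL]; exists L => // e /hL[d d0 hd]; exists d => // h /hd.
by rewrite [z + h + c]addrAC.
Qed.

Lemma hol_at_continuous f z : hol_at f z -> forall e, 0 < e -> exists2 d, 0 < d &
  forall h, mnorm h < d -> normc (f (z + h) - f z) < e.
Proof.
move=> [L lL hL] e e0; have [B B0 hB] := complex_linear_bound lL.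
have [d d0 hd] := hL _ ltr01; have K0 : 0 < B + 1 by rewrite ltr_wpDl.
exists (Num.min d (e / (B + 1))); first by rewrite lt_min d0 divr_gt0.
move=> h; rewrite lt_min ltr_pdivlMr// => /andP[/hd h1 h2]; apply: le_lt_trans h2.
rewrite -[X in normc X](subrK (L h)) addrC; apply: le_trans (le_normcD _ _) _.
by apply: le_trans (lerD (hB h) h1) _; rewrite -mulrDl mulrC.
Qed.

Lemma mnorm_delta i : mnorm (delta_mx i 0 : V) = 1.
Proof.
rewrite /mnorm (bigD1 i)//= big1 => [|j /negPf ji].
  by rewrite mxE !eqxx Normc.normc1 addr0.
by rewrite mxE ji Normc.normc0.
Qed.

(** The partial derivative is the limit of difference quotients with real steps [t j] tending to 0.
    Cauchy's estimate bounds them near [z0], so [hol_limit] applies. *)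
Lemma hol_at_partial g z0 (rho : R) (i : 'I_n) (D : V -> V -> C) :
  (forall z, mnorm z < rho -> complex_linear (D z) /\ forall e, 0 < e ->
     exists2 d, 0 < d & forall h, mnorm h < d -> normc (g (z + h) - g z - D z h) <= e * mnorm h) ->
  mnorm z0 < rho -> hol_at (fun z => D z (delta_mx i 0)) z0.
Proof.
move=> hD z0r; have hg z : mnorm z < rho -> hol_at g z.
  by move=> /hD[lD h]; exists (D z).
have [M [d d0 hM]] := hol_at_bounded (hg _ z0r).
pose d1 := Num.min d (rho - mnorm z0); have d10 : 0 < d1 by rewrite lt_min d0 subr_gt0.
have in_rho w : mnorm (w - z0) < d1 -> mnorm w < rho.
  rewrite lt_min => /andP[_]; rewrite ltrBrDr; apply: le_lt_trans.
  by apply: le_trans (mnormD _ _); rewrite subrK.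
pose r := d1 / 2; have r0 : 0 < r by rewrite divr_gt0.
pose t j : R := r / 4 / j.+1%:R; have t0 j : 0 < t j by rewrite !divr_gt0.
have M0 : 0 <= M by apply: le_trans (normc_ge0 _) (hM z0 _); rewrite subrr mnorm0.
pose e_ : V := delta_mx i 0.
have tr j : t j <= r / 4.
  by rewrite ler_pdivrMr ?ler_peMr// ?ler1n// divr_ge0// ltW.
have te j : mnorm ((t j)%:C *: e_) = t j.
  by rewrite mnormZ mnorm_delta mulr1 normc_real gtr0_norm.
have w1 w h : mnorm (w - z0) < r -> mnorm h < r -> mnorm (w + h - z0) < d1.
  move=> k1 k2; rewrite addrAC; apply: le_lt_trans (mnormD _ _) _.
  by rewrite [d1]splitr ltrD.
have r4 : r / 4 < r by rewrite ltr_pdivrMr// ltr_pMr// ltr1n.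
pose f_ j w := ((t j)%:C)^-1 * (g (w + (t j)%:C *: e_) - g w).
(* The constant is sufficient since $16M(t/r)^2 + 4Mt/r \le 8Mt/r$ when $t \le r/4$. *)
apply: (@hol_limit _ _ f_ _ _ r (8 * M / r)) => // [j w wr|j w wr|w wr].
- have -> : f_ j = fun w => (t j)%:C^-1 * g (w + (t j)%:C *: e_) + (- (t j)%:C^-1 * g w + 0).
    by apply/funext => x; rewrite /f_; ring.
  apply: hol_at_combination.
    by apply: hol_at_shift; apply/hg/in_rho/w1 => //; rewrite te (le_lt_trans (tr j)).
  apply: hol_at_combination.
    by apply/hg/in_rho; rewrite -[w]addr0; apply: w1; rewrite ?mnorm0.
  exists (fun=> 0); first by move=> *; rewrite mulr0 addr0.
  by move=> e e0; exists 1 => // h _; rewrite !subrr Normc.normc0 mulr_ge0 ?mnorm_ge0 ?ltW.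
- have hgw x : mnorm (x - w) < r -> hol_at g x.
    by move=> xw; apply/hg/in_rho; have := w1 _ _ wr xw; rewrite [w + _]addrC subrK.
  have hMw x : mnorm (x - w) < r -> normc (g x) <= M.
    move=> xw; apply: hM; have := w1 _ _ wr xw; rewrite [w + _]addrC subrK.
    by rewrite lt_min => /andP[].
  have [L lL /(_ ((t j)%:C *: e_))] := hol_quadratic r0 hgw hMw.
  rewrite te => -[k1 /(_ (tr j)) k2]; rewrite /f_ Normc.normcM Normc.normcV normc_real gtr0_norm//.
  rewrite ler_pdivrMl//; rewrite -[X in normc X](subrK (L ((t j)%:C *: e_))).
  apply: le_trans (le_normcD _ _) _; apply: le_trans (lerD k2 k1) _.
  have tj : t j / r <= 1 / 4 by rewrite ler_pdivrMr// mul1r mulrC.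
  rewrite -subr_ge0 (_ : _ - _ = 16 * M * (t j / r) * (1 / 4 - t j / r)); last by field; rewrite gt_eqF.
  apply: mulr_ge0; last by rewrite subr_ge0.
  by apply: mulr_ge0; [exact: mulr_ge0|rewrite divr_ge0 ?ltW].
- have wrho : mnorm w < rho.
    by apply: in_rho; rewrite -[w]addr0; apply: w1; rewrite ?mnorm0.
  have [lD hDw] := hD w wrho; move=> e e0; have e2 : 0 < e / 2 by rewrite divr_gt0.
  have [x x0 hx] := hDw _ e2.
  have [N hN] : exists N, forall j, (N <= j)%N -> t j < x.
    exists (Num.bound (r / 4 / x)) => j Nj; rewrite ltr_pdivrMr//.
    rewrite -ltr_pdivrMl// mulrC; apply: lt_le_trans (archi_boundP _) _.
      by rewrite !divr_ge0 ?ltW.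
    by rewrite ler_nat (leq_trans Nj).
  exists N => j /hN tx; have := hx ((t j)%:C *: e_); rewrite te => /(_ tx).
  have tC : (t j)%:C != 0 :> C by rewrite -normc_gt0 normc_real gtr0_norm.
  rewrite complex_linearZ// (_ : _ - _ - _ = (t j)%:C * (f_ j w - D w e_)); last first.
    by rewrite /f_ mulrBr mulVKf.
  rewrite Normc.normcM normc_real gtr0_norm// [_ * t j]mulrC ler_pM2l// => /le_lt_trans; apply.
  by rewrite ltr_pdivrMr// ltr_pMr// ltr1n.
Qed.

(* Induction on the degree: the partial derivatives have degree [d] and Euler's
   identity recovers [g] from them. *)
Lemma homogeneous_polynomial d g (rho : R) : 0 < rho ->
  (forall z, mnorm z < rho -> hol_at g z) ->
  (forall z (t : C), mnorm z < rho -> t != 0 -> normc t <= 1 -> g (t *: z) = t ^+ d * g z) ->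
  exists2 s, (forall p, p \in s -> mdegree p.2 = d) &
    forall z, mnorm z < rho -> g z = polyeval s z.
Proof.
move=> rho0; elim: d g => [|d IH] g hg homg.
  exists [:: (g 0, [ffun=> 0%N])].
    by move=> p; rewrite inE => /eqP ->; rewrite /mdegree big1// => i _; rewrite ffunE.
  move=> z zr; rewrite /polyeval big_seq1 /mono big1 ?mulr1; last by move=> i _; rewrite ffunE expr0.
  (* In degree 0, $g(z) = g(tz)$ for all small positive [t], and [g] is continuous at 0. *)
  apply: normc_small_eq => e e0.
  have [|x x0 hx] := hol_at_continuous (hg 0 _) e0; first by rewrite mnorm0.
  pose t := Num.min 1 (x / 2 / (mnorm z + 1)).
  have z1 : 0 < mnorm z + 1 by rewrite ltr_wpDl ?mnorm_ge0.
  have t0 : 0 < t by rewrite lt_min ltr01 !divr_gt0.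
  have t1 : t <= 1 by rewrite ge_min lexx.
  have tC : t%:C != 0 :> C by rewrite -normc_gt0 normc_real gtr0_norm.
  have := homg z t%:C zr tC; rewrite expr0 mul1r normc_real gtr0_norm// => <-//.
  apply/ltW; have := hx (t%:C *: z); rewrite add0r; apply.
  rewrite mnormZ normc_real gtr0_norm//; apply: (@le_lt_trans _ _ (t * (mnorm z + 1))).
    by rewrite ler_wpM2l ?(ltW t0)// lerDl.
  apply: (@le_lt_trans _ _ (x / 2)); last by rewrite ltr_pdivrMr// ltr_pMr// ltr1n.
  by rewrite -ler_pdivlMr// ge_min lexx orbT.
have /choice[D hD] : forall z, exists L, mnorm z < rho -> complex_linear L /\ forall e, 0 < e ->
     exists2 d, 0 < d & forall h, mnorm h < d -> normc (g (z + h) - g z - L h) <= e * mnorm h.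
  move=> z; have [zr|] := ltP (mnorm z) rho; last by exists (fun=> 0).
  by have [L lL hL] := hg z zr; exists L.
have dg z h : mnorm z < rho -> has_cderiv (fun s => g (z + s *: h)) 0 (D z h).
  by move=> zr; have [lD hDz] := hD z zr; exact: hol_at_deriv0.
(* For $|t| > 1$ the hypothesis is applied at [t *: z] with the factor $t^{-1}$. *)
have homg' z (t : C) : mnorm z < rho -> t != 0 -> mnorm (t *: z) < rho -> g (t *: z) = t ^+ d.+1 * g z.
  move=> zr t0 tzr; have [t1|/ltW t1] := leP (normc t) 1; first exact: homg.
  have := homg _ t^-1 tzr; rewrite scalerA mulVf// scale1r invr_eq0 => /(_ t0).
  rewrite Normc.normcV invf_le1 ?normc_gt0// => /(_ t1) ->.
  by rewrite exprVn mulrA divff ?mul1r// expf_neq0.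
have homD i z (t : C) : mnorm z < rho -> t != 0 -> normc t <= 1 ->
    D (t *: z) (delta_mx i 0) = t ^+ d * D z (delta_mx i 0).
  move=> zr t0 t1; have tzr : mnorm (t *: z) < rho.
    by rewrite mnormZ (le_lt_trans _ zr)// ler_piMl ?mnorm_ge0.
  have [lD _] := hD _ tzr; apply: (mulfI t0); rewrite -(complex_linearZ _ _ lD) mulrA -exprS.
  (* Both sides are the derivative at 0 of $s \mapsto g(tz + ste_i) = t^{d+1} g(z + se_i)$. *)
  apply: (has_cderiv_unique (dg (t *: z) (t *: delta_mx i 0) tzr)).
  have := dg z (delta_mx i 0) zr; move=> hz e e0.
  have k0 : 0 < normc (t ^+ d.+1) by rewrite normc_gt0 expf_neq0.
  have [x x0 hx] := hz _ (divr_gt0 e0 k0).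
  exists (Num.min x (rho - mnorm z)); first by rewrite lt_min x0 subr_gt0.
  move=> w; rewrite lt_min => /andP[/hx k1]; rewrite subr0 => wr.
  have sc s : t *: z + s *: (t *: delta_mx i 0) = t *: (z + s *: delta_mx i 0).
    by rewrite scalerDr !scalerA [s * t]mulrC.
  have wzr : mnorm (z + w *: delta_mx i 0) < rho.
    apply: le_lt_trans (mnormD _ _) _; rewrite mnormZ mnorm_delta mulr1.
    by rewrite addrC -ltrBrDr.
  rewrite !sc !homg//; last by rewrite scale0r addr0.
  rewrite (_ : _ - _ - _ = t ^+ d.+1 * (g (z + w *: delta_mx i 0) - g (z + 0 *: delta_mx i 0) - D z (delta_mx i 0) * (w - 0))); last by rewrite subr0; ring.
  rewrite Normc.normcM; apply: le_trans (ler_wpM2l (normc_ge0 _) k1) _.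
  by rewrite mulrA [normc _ * _]mulrC divfK ?gt_eqF// subr0.
have /choice[S hS] : forall i, exists s, (forall p, p \in s -> mdegree p.2 = d) /\
    forall z, mnorm z < rho -> D z (delta_mx i 0) = polyeval s z.
  move=> i; have [s s1 s2] := IH (fun z => D z (delta_mx i 0)) (fun z => hol_at_partial i hD) (homD i).
  by exists s.
pose inc i alpha : {ffun 'I_n -> nat} := [ffun j => (alpha j + (j == i))%N].
have mono_inc i alpha z : mono (inc i alpha) z = z i 0 * mono alpha z.
  rewrite /mono (bigD1 i)//= [in RHS](bigD1 i)//= ffunE eqxx addn1 exprS mulrA; congr (_ * _).
  by apply: eq_bigr => j /negPf ji; rewrite ffunE ji addn0.
have deg_inc i alpha : mdegree (inc i alpha) = (mdegree alpha).+1.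
  rewrite /mdegree (bigD1 i)//= [in RHS](bigD1 i)//= ffunE eqxx addn1 addSn; congr (_ + _).+1.
  by apply: eq_bigr => j /negPf ji; rewrite ffunE ji addn0.
exists (flatten [seq [seq (d.+1%:R^-1 * p.1, inc i p.2) | p <- S i] | i <- enum 'I_n]).
  move=> p /flattenP[_ /mapP[i _ ->] /mapP[q qS ->]] /=.
  by rewrite deg_inc (hS i).1.
move=> z zr; have d0 : d.+1%:R != 0 :> C by rewrite pnatr_eq0.
apply: (mulfI d0); transitivity (D z z).
  apply: (has_cderiv_unique (has_cderiv_pow d.+1 (g z))) => e e0.
  have [x x0 hx] := dg z z zr _ e0.
  have k0 : 0 < mnorm z + 1 by rewrite ltr_wpDl ?mnorm_ge0.
  exists (Num.min x (Num.min 1 ((rho - mnorm z) / (mnorm z + 1)))).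
    by rewrite !lt_min x0 ltr01 divr_gt0// subr_gt0.
  move=> w; rewrite !lt_min subr0 => /and3P[wx w1 wr].
  have hom1 : g (z + w *: z) = (1 + w) ^+ d.+1 * g z.
    rewrite -[z in z + _]scale1r -scalerDl.
    have t0 : 1 + w != 0.
      apply: contraTneq w1 => /eqP; rewrite addr_eq0 => /eqP E.
      by rewrite -leNgt -normcN -E Normc.normc1.
    apply: homg' => //; rewrite scalerDl scale1r; apply: le_lt_trans (mnormD _ _) _.
    rewrite mnormZ addrC -ltrBrDr; apply: le_lt_trans (ler_wpM2l (normc_ge0 _) (_ : _ <= mnorm z + 1)) _.
      by rewrite lerDl.
    by rewrite -ltr_pdivlMr.
  have := hx w; rewrite subr0 => /(_ wx).
  by rewrite hom1 scale0r addr0 addr0 expr1n mul1r.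
have [lD _] := hD z zr; rewrite (complex_linear_sum z lD) /polyeval big_flatten big_map big_enum/= mulr_sumr.
apply: eq_bigr => i _; rewrite (hS i).2// /polyeval big_map !mulr_sumr.
by apply: eq_bigr => p _; rewrite mono_inc !mulrA mulfV// mul1r; ring.
Qed.

End HomogeneousHolomorphic.

(** * Averages over roots of unity *)

Section RootsOfUnity.
Context {R : realType}.
Local Notation C := R[i].

Definition rootu (N : nat) : C := cis (2 * pi / N%:R).

Lemma normc_rootu N : normc (rootu N) = 1.
Proof. exact: normc_cis. Qed.

Lemma rootu_neq0 N : rootu N != 0.
Proof. by rewrite -normc_gt0 normc_rootu. Qed.

Lemma rootuX N : (0 < N)%N -> rootu N ^+ N = 1.
Proof.
by move=> N0; rewrite cisX mulrC divfK ?cis2pi// pnatr_eq0 -lt0n.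
Qed.

(** If [cis x] were 1, then [cis (x / 2)] would be 1 or -1 and its sine would vanish, although $0 <
    x/2 < \pi$. *)
Lemma cis_neq1 (x : R) : 0 < x -> x < 2 * pi -> cis x != 1.
Proof.
move=> x0 x2; have s0 : 0 < sin (x / 2).
  by apply: sin_gt0_pi; rewrite divr_gt0//= ltr_pdivrMr// mulrC.
apply: contraTneq s0 => h; have : cis (x / 2) ^+ 2 = 1 by rewrite cisX mulrC divfK.
move=> /eqP; rewrite sqrf_eq1 => /orP[]/eqP.
  by rewrite /cis => -[_ ->]; rewrite ltxx.
by rewrite /cis => -[_ ->]; rewrite oppr0 ltxx.
Qed.

Lemma rootuX_neq1 N k : (0 < k < N)%N -> rootu N ^+ k != 1.
Proof.
move=> /andP[k0 kN]; rewrite cisX; have N0 : (0 < N)%N by rewrite (leq_trans _ kN).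
have p0 : 0 < 2 * pi :> R by rewrite mulr_gt0// pi_gt0.
apply: cis_neq1; first by rewrite !mulr_gt0// ?ltr0n// ?invr_gt0 ?ltr0n// pi_gt0.
by rewrite mulrCA gtr_pMr// ltr_pdivrMr ?ltr0n// mul1r ltr_nat.
Qed.

(** For [k] different from [d] this is a geometric sum whose ratio $x \ne 1$ satisfies $x^N = 1$. *)
Lemma rootu_sum N k d : (k < N)%N -> (d < N)%N ->
  \sum_(j < N) (rootu N ^+ j) ^+ k / (rootu N ^+ j) ^+ d = if k == d then N%:R else 0.
Proof.
move=> kN dN; have N0 : (0 < N)%N by rewrite (leq_trans _ kN).
case: eqP => [->|/eqP kd].
  under eq_bigr => j _ do rewrite divff ?expf_neq0 ?rootu_neq0//.
  by rewrite sumr_const card_ord.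
pose x := rootu N ^+ k / rootu N ^+ d.
have x1 : x != 1.
  rewrite /x; case: (ltngtP k d) kd => // [kd|dk] _.
    rewrite -(subnKC (ltnW kd)) exprD invfM mulVKf ?expf_neq0 ?rootu_neq0// invr_eq1.
    by apply: rootuX_neq1; rewrite subn_gt0 kd/= (leq_ltn_trans (leq_subr _ _)).
  rewrite -(subnKC (ltnW dk)) exprD mulrAC divff ?mul1r ?expf_neq0 ?rootu_neq0//.
  by apply: rootuX_neq1; rewrite subn_gt0 dk/= (leq_ltn_trans (leq_subr _ _)).
under eq_bigr => j _ do rewrite -!exprM ![(j * _)%N]mulnC !exprM -expr_div_n -/x.
have /eqP : (x - 1) * \sum_(j < N) x ^+ j = 0.
  rewrite -subrX1 /x expr_div_n -!exprM ![(_ * N)%N]mulnC !exprM rootuX// !expr1n divr1.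
  by rewrite subrr.
by rewrite mulf_eq0 subr_eq0 (negPf x1)/= => /eqP.
Qed.

(** The coefficient of index [d] in the discrete Fourier transform of [phi] on the [N]-th roots of
    unity. *)
Definition avg N d (phi : C -> C) : C :=
  N%:R^-1 * \sum_(j < N) phi (rootu N ^+ j) / (rootu N ^+ j) ^+ d.

Lemma avg_poly N d (c : nat -> C) : (d < N)%N ->
  avg N d (fun s => \sum_(k < N) c k * s ^+ k) = c d.
Proof.
move=> dN; rewrite /avg; have N0 : (0 < N)%N by rewrite (leq_trans _ dN).
under eq_bigr do rewrite mulr_suml; rewrite exchange_big/=.
under eq_bigr => k _ do [under eq_bigr do rewrite -mulrA; rewrite -mulr_sumr rootu_sum//].
rewrite (bigD1 (Ordinal dN))//= eqxx big1 => [|k kd].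
  by rewrite addr0 mulrCA mulVf ?mulr1// pnatr_eq0 -lt0n.
case: eqP => [e|]; last by rewrite mulr0.
by case/eqP: kd; apply: val_inj.
Qed.

Lemma normc_avg N d (phi : C -> C) M : 0 <= M ->
  (forall s, normc s = 1 -> normc (phi s) <= M) -> normc (avg N d phi) <= M.
Proof.
move=> M0 hM; rewrite /avg Normc.normcM Normc.normcV -(rmorph_nat (real_complex R)) normc_real ger0_norm//.
case: N => [|N]; first by rewrite big_ord0 Normc.normc0 mulr0.
rewrite ler_pdivrMl ?ltr0n//; apply: le_trans (normc_sum _ _ _) _.
apply: le_trans (ler_sum _ (fun j _ => _ : _ <= M)) _.
  move=> j _; rewrite Normc.normcM Normc.normcV !normcX normc_rootu !expr1n invr1 mulr1.
  by apply: hM; rewrite normcX normc_rootu expr1n.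
by rewrite sumr_const card_ord mulr_natl.
Qed.

(** By [avg_poly] the average is exact on the Taylor sum with [N] terms, and what remains on the
    unit circle decays like $r^{-N}$. *)
Lemma avg_cvg d (phi : C -> C) (c : nat -> C) (r M : R) : 1 < r ->
  (forall s K, normc s <= 1 -> normc (phi s - \sum_(k < K) c k * s ^+ k) <= M * r^-1 ^+ K) ->
  ccvg (fun N => avg N d phi) (c d).
Proof.
move=> r1 h e e0; have r0 : 0 < r by rewrite (lt_trans ltr01).
have M0 : 0 <= M.
  have := h 0 0%N; rewrite Normc.normc0 ler01 expr0 mulr1 => /(_ isT).
  by apply: le_trans; exact: normc_ge0.
have [N0 hN0] : exists N0, forall N, (N0 <= N)%N -> M * r^-1 ^+ N < e.
  have : (M * r^-1 ^+ N) @[N --> \oo] --> M * 0.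
    by apply: cvgMr; apply: cvg_expr; rewrite ger0_norm ?invr_ge0 ?(ltW r0)// invf_lt1.
  rewrite mulr0 => /cvgrPdist_lt/(_ _ e0)[N0 _ hN]; exists N0 => N NN.
  by have := hN N NN; rewrite sub0r normrN; apply: le_lt_trans; exact: ler_norm.
exists (maxn N0 d.+1) => N; rewrite geq_max => /andP[/hN0 NN dN].
apply: le_lt_trans NN; rewrite -{1}(avg_poly c dN) /avg -mulrBr -sumrB.
under eq_bigr do rewrite -mulrBl.
apply: (@normc_avg N d (fun s => phi s - \sum_(k < N) c k * s ^+ k)).
  by rewrite mulr_ge0// exprn_ge0// invr_ge0 ltW.
by move=> s s1; apply: h; rewrite s1.
Qed.

(** A circle of radius strictly between 1 and [r0] makes the decay geometric, uniformly on the
    closed unit disc, which contains the roots of unity. *)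
Lemma taylor_unit (phi : C -> C) (r0 : R) : 1 < r0 ->
  (forall s, normc s < r0 -> exists c, has_cderiv phi s c) ->
  exists c : nat -> C, c 0 = phi 0 /\ exists r M, 1 < r /\ forall s K, normc s <= 1 ->
    normc (phi s - \sum_(k < K) c k * s ^+ k) <= M * r^-1 ^+ K.
Proof.
move=> r01 hphi; pose r := (1 + r0) / 2.
have r1 : 1 < r by rewrite /r; move: r01; clear; lra.
have rr0 : r < r0 by rewrite /r; move: r01; clear; lra.
have r_gt0 : 0 < r by rewrite (lt_trans ltr01).
have [M hM] := circle_bounded r_gt0 rr0 hphi.
exists (taylor_coef phi r); split; first exact: taylor_coef0 rr0 hphi.
have M0 : 0 <= M by apply: le_trans (normc_ge0 _) (hM 0 _); rewrite lexx mulr_ge0// pi_ge0.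
exists r, (2 * M / (1 - r^-1)); split=> // s K s1.
apply: le_trans (taylor r_gt0 rr0 hphi K hM _) _; first exact: le_lt_trans r1.
have x1 : normc s / r <= r^-1 by rewrite ler_piMl ?invr_ge0 ?(ltW r_gt0).
have x0 : 0 <= normc s / r by rewrite divr_ge0 ?normc_ge0 ?(ltW r_gt0).
have i1 : r^-1 < 1 by rewrite invf_lt1.
rewrite -[leRHS]mulrA [_^-1 * _]mulrC mulrA; apply: ler_pM.
- by rewrite !mulr_ge0// exprn_ge0.
- by rewrite invr_ge0 subr_ge0 ltW// (le_lt_trans x1).
- rewrite ler_wpM2l ?mulr_ge0//; apply: lerXn2r => //; rewrite nnegrE//.
  by rewrite invr_ge0 ltW.
- by rewrite lef_pV2 ?posrE ?subr_gt0// ?(le_lt_trans x1)// lerD2l lerN2.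
Qed.

End RootsOfUnity.

(** * Homogeneous expansion of holomorphic functions on the ball *)

Section Expansion.
Context {R : realType} {n : nat}.
Local Notation C := R[i].
Local Notation V := 'cV[C]_n.
Implicit Types (f g : V -> C) (z w h : V).

Lemma sqnorm_ge0 z : 0 <= sqnorm z.
Proof. by apply: sumr_ge0 => i _; exact: sqr_ge0. Qed.

Lemma sqnormZ (t : C) z : sqnorm (t *: z) = normc t ^+ 2 * sqnorm z.
Proof.
by rewrite /sqnorm mulr_sumr; apply: eq_bigr => i _; rewrite mxE Normc.normcM exprMn.
Qed.

Lemma unit_ballZ (t : C) z : normc t <= 1 -> unit_ball z -> unit_ball (t *: z).
Proof.
move=> t1; rewrite /unit_ball /= sqnormZ; apply: le_lt_trans.
by rewrite ler_piMl ?sqnorm_ge0// exprn_ile1// normc_ge0.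
Qed.

Lemma sqnorm_le_mnorm z : sqnorm z <= mnorm z ^+ 2.
Proof.
rewrite expr2 {1}/mnorm mulr_suml; apply: ler_sum => i _; rewrite expr2.
by rewrite ler_wpM2l ?normc_ge0// normc_le_mnorm.
Qed.

Lemma mnorm_unit_ball z : mnorm z < 1 -> unit_ball z.
Proof.
move=> z1; apply: le_lt_trans (sqnorm_le_mnorm z) _.
by rewrite exprn_ilt1// mnorm_ge0.
Qed.

Lemma hol_at_scale f z (t : C) : hol_at f (t *: z) -> hol_at (fun w => f (t *: w)) z.
Proof.
move=> [L lL hL]; exists (fun h => t * L h).
  by move=> a u v; rewrite lL; ring.
move=> e e0; have k0 : 0 < normc t + 1 by rewrite ltr_wpDl ?normc_ge0.
have [d d0 hd] := hL _ (divr_gt0 e0 k0).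
exists (d / (normc t + 1)); first by rewrite divr_gt0.
move=> h; rewrite ltr_pdivlMr// => hh.
have le1 : normc t * mnorm h <= mnorm h * (normc t + 1).
  by rewrite mulrC ler_wpM2l ?mnorm_ge0// lerDl.
rewrite -complex_linearZ// scalerDr; apply: le_trans (hd (t *: h) _) _.
  by rewrite mnormZ (le_lt_trans le1).
rewrite mnormZ; apply: le_trans (ler_wpM2l _ le1) _; first by rewrite divr_ge0 ?ltW.
by rewrite mulrCA divfK ?gt_eqF// mulrC.
Qed.

(** The coefficients [F z d] are chosen for each [z] separately, so all regularity in [z] comes from
    their being limits of averages. A bound on [f] is at hand only near 0; there the coefficients
    become polynomials, and homogeneity spreads the identity over the ball. *)
Lemma hol_expansion f : (forall z, unit_ball z -> hol_at f z) ->
  exists2 S : nat -> seq (C * {ffun 'I_n -> nat}),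
    forall d p, p \in S d -> mdegree p.2 = d &
    forall z, unit_ball z -> exists r M, 1 < r /\ forall s K, normc s <= 1 ->
      normc (f (s *: z) - \sum_(k < K) polyeval (S k) z * s ^+ k) <= M * r^-1 ^+ K.
Proof.
move=> hf.
have /choice[F hF] : forall z, exists c : nat -> C, unit_ball z -> exists r M, 1 < r /\
    forall s K, normc s <= 1 -> normc (f (s *: z) - \sum_(k < K) c k * s ^+ k) <= M * r^-1 ^+ K.
  move=> z; have [zB|nz] := pselect (unit_ball z); last by exists (fun=> 0).
  set q := sqnorm z in zB; have q0 : 0 <= q := sqnorm_ge0 z.
  have q1 : q < 1 := zB.
  (* The line through [z] stays in the ball beyond $|s| = 1$: $r_0^2 q < 1$ amounts to $(1-q)^2 >
     0$. *)
  pose r0 := 2 / (1 + q).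
  have k0 : 0 < 1 + q by rewrite ltr_pwDl.
  have r01 : 1 < r0 by rewrite ltr_pdivlMr// mul1r; move: q1; clear; lra.
  have hphi (s : C) : normc s < r0 -> exists c, has_cderiv (fun s => f (s *: z)) s c.
    move=> sr; have : hol_at f (0 + s *: z).
      rewrite add0r; apply: hf; rewrite /unit_ball /= sqnormZ -/q.
      apply: (@le_lt_trans _ _ (r0 ^+ 2 * q)).
        by rewrite ler_wpM2r// ler_pXn2r ?nnegrE ?normc_ge0 ?(ltW sr)// (le_trans ler01)// ltW.
      rewrite /r0 expr_div_n mulrAC ltr_pdivrMr ?exprn_gt0// mul1r -subr_gt0.
      rewrite (_ : _ - _ = (1 - q) ^+ 2); last by ring.
      by rewrite exprn_gt0// subr_gt0.
    by move=> /hol_at_line[c]; under eq_fun do rewrite add0r; exists c.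
  by have [c [_ hc]] := taylor_unit r01 hphi; exists c.
have avgF d z : unit_ball z -> ccvg (fun N => avg N d (fun s => f (s *: z))) (F z d).
  by move=> /hF[r [M [r1 h]]]; exact: avg_cvg h.
have homF d z (t : C) : unit_ball z -> t != 0 -> normc t <= 1 -> F (t *: z) d = t ^+ d * F z d.
  move=> zB t0 t1; apply: (ccvg_unique (avgF d _ (unit_ballZ t1 zB))).
  have [r [M [r1 h]]] := hF z zB.
  apply: (@avg_cvg _ d (fun s => f (s *: (t *: z))) (fun k => t ^+ k * F z k) r M r1) => s K s1.
  rewrite scalerA (eq_bigr (fun k : 'I_K => F z k * (s * t) ^+ k)); last first.
    by move=> k _; rewrite exprMn [_ * t ^+ k]mulrC mulrA [F z k * _]mulrC.
  by apply: h; rewrite Normc.normcM mulr_ile1 ?normc_ge0.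
have h0 : unit_ball (0 : V) by apply: mnorm_unit_ball; rewrite mnorm0.
have [M [d0 d00 hM]] := hol_at_bounded (hf _ h0).
pose rho := Num.min d0 1; have rho0 : 0 < rho by rewrite lt_min d00 ltr01.
have rhoB z : mnorm z < rho -> unit_ball z.
  by rewrite lt_min => /andP[_ z1]; exact: mnorm_unit_ball.
have M0 : 0 <= M by apply: le_trans (normc_ge0 _) (hM 0 _); rewrite subrr mnorm0.
have holF d z : mnorm z < rho -> hol_at (fun z => F z d) z.
  move=> zr; have s0 : 0 < rho - mnorm z by rewrite subr_gt0.
  have inr w : mnorm (w - z) < rho - mnorm z -> mnorm w < rho.
    rewrite ltrBrDr; apply: le_lt_trans; apply: le_trans (mnormD _ _); rewrite subrK.
    exact: lexx.
  apply: (@hol_limit _ _ (fun N w => avg N d (fun s => f (s *: w))) _ _ _ M s0) => [N w /inr wr|N w /inr wr|w /inr wr].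
  - rewrite /avg; set a := N%:R^-1.
    have hsum (r : seq 'I_N) : hol_at (fun w => \sum_(j <- r) f (rootu N ^+ j *: w) / (rootu N ^+ j) ^+ d) w.
      elim: r => [|j r IH].
        under eq_fun do rewrite big_nil; exists (fun=> 0); first by move=> *; rewrite mulr0 addr0.
        by move=> e e0; exists 1 => // h _; rewrite !subrr Normc.normc0 mulr_ge0 ?mnorm_ge0 ?ltW.
      under eq_fun do rewrite big_cons mulrC; apply: hol_at_combination => //.
      apply: hol_at_scale; apply: hf; apply: unit_ballZ; last exact: rhoB.
      by rewrite normcX normc_rootu expr1n.
    rewrite (_ : (fun w => _) = (fun w => a * (\sum_(j < N) f (rootu N ^+ j *: w) / (rootu N ^+ j) ^+ d) + 0)); last first.
      by apply/funext => x; rewrite addr0.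
    apply: hol_at_combination => //.
    exists (fun=> 0); first by move=> *; rewrite mulr0 addr0.
    by move=> e e0; exists 1 => // h _; rewrite !subrr Normc.normc0 mulr_ge0 ?mnorm_ge0 ?ltW.
  - apply: normc_avg => // s s1; apply: hM; rewrite subr0 mnormZ s1 mul1r.
    by move: wr; rewrite lt_min => /andP[].
  - exact/avgF/rhoB.
have /choice[S hS] : forall d, exists s, (forall p, p \in s -> mdegree p.2 = d) /\
    forall z, mnorm z < rho -> F z d = polyeval s z.
  move=> d; have [||s s1 s2] := @homogeneous_polynomial _ _ d (fun z => F z d) rho rho0.
  - exact: holF.
  - by move=> z t /rhoB zB t0 t1; exact: homF.
  - by exists s.
exists S; first by move=> d; case: (hS d).
move=> z zB; have [r [M' [r1 h]]] := hF z zB; exists r, M'; split=> // s K s1.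
have FE k : F z k = polyeval (S k) z.
  have [S1 S2] := hS k; have z1 : 0 < mnorm z + 1 by rewrite ltr_wpDl ?mnorm_ge0.
  (* A factor that brings [z] into the small ball on which the polynomial is known to agree with
     [F]. *)
  pose t := Num.min 1 (rho / 2 / (mnorm z + 1)).
  have t0 : 0 < t by rewrite lt_min ltr01 !divr_gt0.
  have t1 : t <= 1 by rewrite ge_min lexx.
  have tC : t%:C != 0 :> C by rewrite -normc_gt0 normc_real gtr0_norm.
  apply: (mulfI (expf_neq0 k tC)); rewrite -homF//; last by rewrite normc_real gtr0_norm.
  rewrite -(polyevalZ _ _ S1); apply: S2.
  rewrite mnormZ normc_real gtr0_norm//; apply: (@le_lt_trans _ _ (t * (mnorm z + 1))).
    by rewrite ler_wpM2l ?(ltW t0)// lerDl.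
  apply: (@le_lt_trans _ _ (rho / 2)); last by rewrite ltr_pdivrMr// ltr_pMr// ltr1n.
  by rewrite -ler_pdivlMr// ge_min lexx orbT.
by under eq_bigr do rewrite -FE; exact: h.
Qed.

End Expansion.

(** * Lebesgue measure on C^n *)

Section MeasurePreserving.
Context d (T : measurableType d) (R : realType) (mu : set T -> \bar R).

Definition measure_preserving (f : T -> T) :=
  measurable_fun setT f /\ forall A, measurable A -> mu (f @^-1` A) = mu A.

Lemma measure_preserving_comp f g : measure_preserving f -> measure_preserving g ->
  measure_preserving (f \o g).
Proof.
move=> [mf pf] [mg pg]; split; first exact: measurableT_comp.
move=> A mA; rewrite comp_preimage pg ?pf//.
by rewrite -[X in measurable X]setTI; exact: mf.
Qed.

Lemma measure_preserving_id : measure_preserving id.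
Proof. by []. Qed.

End MeasurePreserving.

Section ProductPreserving.
Context d1 d2 (T1 : measurableType d1) (T2 : measurableType d2) (R : realType).
Context (m1 : {sigma_finite_measure set T1 -> \bar R}).
Context (m2 : {sigma_finite_measure set T2 -> \bar R}).

(** The image measure agrees with the product on rectangles, so uniqueness of the product measure
    applies. *)
Lemma measure_preserving_prod f g : measure_preserving m1 f -> measure_preserving m2 g ->
  measure_preserving (product_measure m1 m2) (fun p => (f p.1, g p.2)).
Proof.
move=> [mf pf] [mg pg]; set h := fun p => _.
have mh : measurable_fun setT h.
  apply/measurable_fun_pairP; split.
    exact: (measurableT_comp mf measurable_fst).
  exact: (measurableT_comp mg measurable_snd).
split; first exact: mh.
move=> A mA.
pose m' := measure_function_pushforward__canonical__measure_function_Measure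
  (product_measure m1 m2) mh.
rewrite -[LHS]/(m' A) -[RHS]/((m1 \x m2)%E A); symmetry.
apply: (@product_measure_unique _ _ _ _ _ m1 m2 m') => // B C mB mC.
have mfB : measurable (f @^-1` B) by rewrite -[X in measurable X]setTI; exact: mf.
have mgC : measurable (g @^-1` C) by rewrite -[X in measurable X]setTI; exact: mg.
rewrite -(pf _ mB) -(pg _ mC) -product_measure1E//.
Qed.

(** The product measure is the integral of the measures of the sections, and each section is moved
    by a map preserving [m2]. *)
Lemma measure_preserving_skew (g : T1 -> T2 -> T2) :
  measurable_fun setT (fun p : T1 * T2 => g p.1 p.2) ->
  (forall x, measure_preserving m2 (g x)) ->
  measure_preserving (product_measure m1 m2) (fun p => (p.1, g p.1 p.2)).
Proof.
move=> mg pg; have mh : measurable_fun setT (fun p : T1 * T2 => (p.1, g p.1 p.2)).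
  by apply/measurable_fun_pairP; split; [exact: measurable_fst|].
split => // A mA; rewrite /product_measure /product_measure1.
apply: eq_integral => x _ /=.
rewrite (_ : xsection _ x = g x @^-1` xsection A x).
  by have [_ ->] := pg x; last exact: measurable_xsection.
by apply/seteqP; split => y; rewrite /xsection /= !inE.
Qed.

End ProductPreserving.

(** * Translations and rotations preserve Lebesgue measure *)

Section Plane.
Context {R : realType}.
Local Notation leb := (@lebesgue_measure R).
Local Notation plane := (measurableTypeR R * measurableTypeR R)%type.

Lemma measure_preserving_translate (c : R) : measure_preserving leb (fun x => x + c).
Proof.
have mf : measurable_fun setT ((fun x => x + c) : measurableTypeR R -> measurableTypeR R).
  exact: measurable_funD.
split => // A mA; symmetry.
pose m' := measure_function_pushforward__canonical__measure_function_Measure leb mf.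
rewrite -[RHS]/(m' A); apply: lebesgue_measure_unique => // _ [[a b] _ <-] /=.
rewrite /m' /= /pushforward (_ : _ @^-1` _ = `](a - c), (b - c)]%classic).
  rewrite !lebesgue_measure_itv/= !lte_fin ltrD2r; case: ifPn => // _.
  by rewrite -!EFinB; congr (_%:E); lra.
by apply/seteqP; split => x /=; rewrite !in_itv /= ltrBlDr lerBrDr.
Qed.

Lemma measure_preserving_opp : measure_preserving leb (fun x => - x).
Proof.
split; last by move=> A mA; exact: lebesgue_measureN.
exact: measurable_funN.
Qed.

Local Notation mu := (plane_measure R).

Lemma measure_preserving_swap : measure_preserving mu (fun p => (p.2, p.1)).
Proof.
set h := fun p => _; have mh : measurable_fun setT h.
  by apply/measurable_fun_pairP; split; [exact: measurable_snd|exact: measurable_fst].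
split=> // A mA.
pose m' := measure_function_pushforward__canonical__measure_function_Measure mu mh.
rewrite -[LHS]/(m' A) -[RHS]/((leb \x leb)%E A); symmetry.
apply: (@product_measure_unique _ _ _ _ _ leb leb m') => // B C mB mC.
rewrite /m' /= /pushforward (_ : h @^-1` (B `*` C) = C `*` B).
  by rewrite /product_measure product_measure1E// muleC.
by apply/seteqP; split => p [].
Qed.

Lemma measure_preserving_shear (a : R) :
  measure_preserving mu (fun p => (p.1, p.2 + a * p.1)).
Proof.
apply: (@measure_preserving_skew _ _ _ _ _ leb leb (fun x y : measurableTypeR R => y + a * x)).
  by apply: measurable_funD => //; apply: measurable_funM.
by move=> x; exact: measure_preserving_translate.
Qed.

Lemma measure_preserving_shear' (a : R) :
  measure_preserving mu (fun p => (p.1 + a * p.2, p.2)).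
Proof.
have s := measure_preserving_swap.
exact: (measure_preserving_comp s (measure_preserving_comp (measure_preserving_shear a) s)).
Qed.

Definition plane_rot (a b : R) (p : plane) : plane := (a * p.1 - b * p.2, b * p.1 + a * p.2).

(* A rotation other than [-id] is a product of three shears. *)
Lemma measure_preserving_rot (a b : R) : a ^+ 2 + b ^+ 2 = 1 -> measure_preserving mu (plane_rot a b).
Proof.
move=> ab; have [b0|b0] := eqVneq b 0.
  move: ab; rewrite b0 expr0n/= addr0 => /eqP; rewrite sqrf_eq1 => /orP[]/eqP ->.
    rewrite (_ : plane_rot _ _ = id); first exact: measure_preserving_id.
    by apply/funext => -[x y]; rewrite /plane_rot /= !mul1r !mul0r subr0 add0r.
  rewrite (_ : plane_rot _ _ = (fun p => (- p.1, - p.2))).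
    by apply: measure_preserving_prod; exact: measure_preserving_opp.
  by apply/funext => -[x y]; rewrite /plane_rot /= !mulN1r !mul0r subr0 add0r.
(* The tangent of half the angle of rotation. *)
pose t := (1 - a) / b.
have s := measure_preserving_shear' (- t).
rewrite (_ : plane_rot a b = (fun p : plane => (p.1 + - t * p.2, p.2)) \o
   ((fun p : plane => (p.1, p.2 + b * p.1)) \o (fun p : plane => (p.1 + - t * p.2, p.2)))).
  exact: (measure_preserving_comp s (measure_preserving_comp (measure_preserving_shear b) s)).
apply/funext => -[x y]; rewrite /plane_rot /= /t.
have -> : (x + - ((1 - a) / b) * y + - ((1 - a) / b) * (y + b * (x + - ((1 - a) / b) * y))) =
   a * x - (1 - a ^+ 2) / b * y by field.
have -> : (1 - a ^+ 2) / b = b by rewrite -ab addrAC subrr add0r expr2 mulfK.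
by congr pair; field.
Qed.

Lemma measure_preserving_plane_translate (c : plane) :
  measure_preserving mu (fun p => (p.1 + c.1, p.2 + c.2)).
Proof.
exact: (measure_preserving_prod (measure_preserving_translate c.1) (measure_preserving_translate c.2)).
Qed.

Definition tuple_map n (F : 'I_n -> plane -> plane) (t : n.-tuple plane) :=
  [tuple F i (tnth t i) | i < n].

(** Induction along the iterated product that defines [lebesgue_Cn]; [tuple_cons] intertwines the
    map on pairs with that on tuples. *)
Lemma measure_preserving_tuple n (F : 'I_n -> plane -> plane) :
  (forall i, measure_preserving mu (F i)) -> measure_preserving (lebesgue_Cn R n) (tuple_map F).
Proof.
elim: n F => [|n IH] F pF.
  have E : tuple_map F = id by apply/funext => t; apply/eq_from_tnth => -[].
  by rewrite E; exact: measure_preserving_id.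
have mF : measurable_fun setT (tuple_map F).
  apply/measurable_fun_tnthP => i; rewrite (_ : _ \o _ = F i \o (@tnth _ _)^~ i).
    by apply: measurableT_comp; [exact: (pF i).1|exact: measurable_tnth].
  by apply/funext => t /=; rewrite tnth_mktuple.
split; first exact: mF.
move=> A mA.
have [mG pG] := measure_preserving_prod (pF ord0) (IH (F \o lift ord0) (fun i => pF _)).
have mA' : measurable ((@tuple_cons R n) @^-1` A).
  by rewrite -[X in measurable X]setTI; exact: (@measurable_tuple_cons R n).
set G := (fun p => _) in mG pG.
have ES : (@tuple_cons R n) @^-1` (tuple_map F @^-1` A) = G @^-1` ((@tuple_cons R n) @^-1` A).
  apply/funext => -[x t]; rewrite /preimage /=; congr (A _); apply/eq_from_tnth => i.
  rewrite tnth_mktuple; case: (unliftP ord0 i) => [j|] ->; rewrite /tuple_cons /=; last by rewrite !tnth0.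
  by rewrite !tnthS tnth_mktuple.
transitivity (product_measure mu (lebesgue_Cn R n) ((@tuple_cons R n) @^-1` (tuple_map F @^-1` A))).
  by [].
by rewrite ES; exact: pG.
Qed.

End Plane.

(** * Convergence and positivity of the Gamma integral *)

Section GammaPositive.
Context {R : realType}.
Local Notation mu := (@lebesgue_measure R).
Implicit Types (x t a b : R).

Let gamma_integrand x t := t `^ (x - 1) * expR (- t).

Lemma measurable_gamma_integrand x D : measurable_fun D (gamma_integrand x).
Proof.
apply: measurable_funTS; apply: measurable_funM; first exact: measurable_powR.
by apply: measurableT_comp => //; exact: measurable_funN.
Qed.

Lemma powR_expR_bound x : 0 < x -> exists2 D, 0 < D & forall t, 0 < t -> 1 + t `^ x <= D * expR (t / 2).
Proof.
(* A single term of the exponential series, $(t/2)^{k+1}/(k+1)! \le e^{t/2}$ with $k+1 \ge x$,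
   controls the power for $t \ge 1$. *)
move=> x0; pose k := Num.bound `|x|; pose K := 2 ^+ k.+1 * (k.+1)`!%:R : R.
have K0 : 0 < K by rewrite mulr_gt0 ?exprn_gt0// ltr0n fact_gt0.
exists (2 + K); first by rewrite ltr_wpDl ?ltW.
move=> t t0; have xk : x <= k.+1%:R.
  apply: le_trans (ler_norm x) (ltW (lt_trans (archi_boundP (normr_ge0 x)) _)).
  by rewrite ltr_nat.
have e1 : 1 <= expR (t / 2) by rewrite -(expR0 R) ler_expR divr_ge0// ltW.
have tk : t ^+ k.+1 <= K * expR (t / 2).
  have := expR_ge1Dxn k (divr_ge0 (ltW t0) (ler0n R 2)).
  rewrite -lerBrDl ler_pdivrMr ?ltr0n ?fact_gt0// expr_div_n ler_pdivrMr ?exprn_gt0//.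
  move=> /le_trans; apply; rewrite -mulrA [_%:R * _]mulrC -/K mulrC.
  by apply: ler_wpM2l; [exact: ltW|rewrite gerBl].
have tx : t `^ x <= 1 + t ^+ k.+1.
  have [t1|/ltW t1] := leP t 1.
    apply: (@le_trans _ _ 1); last by rewrite lerDl exprn_ge0// ltW.
    by rewrite -[leRHS](powRr0 t); apply: ger_powR; rewrite ?t0// ltW.
  apply: (@le_trans _ _ (t ^+ k.+1)); last by rewrite lerDr.
  by rewrite -powR_mulrn ?(ltW t0)//; apply: ler_powR.
rewrite mulrDl; apply: (@le_trans _ _ (2 + t ^+ k.+1)).
  by rewrite (_ : 2 = 1 + 1)// -addrA lerD2l.
by apply: lerD => //; rewrite ler_peMr.
Qed.

(** The integrand is dominated by $(D^2/x)h$, where $h$ is the derivative of $-1/(1+t^x)$ and so has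
    integral at most 1 over every interval. This controls both ends, 0 and infinity, at once. *)
Lemma gamma_integral_bounded x : 0 < x -> exists C : R, forall a b, 0 < a -> a < b ->
  (\int[mu]_(t in `[a, b]) (gamma_integrand x t)%:E <= C%:E)%E.
Proof.
move=> x0; have [D D0 hD] := powR_expR_bound x0.
exists (D ^+ 2 / x) => a b a0 ab.
pose H t := - (1 + t `^ x)^-1; pose h t := x * t `^ (x - 1) / (1 + t `^ x) ^+ 2.
have p0 t : 0 < 1 + t `^ x by rewrite ltr_pwDl ?powR_ge0.
have dH t : 0 < t -> is_derive t 1 H (h t).
  move=> t0; rewrite /H; have dp := is_derive1_powR x t0.
  have n0 : 1 + t `^ x != 0 by rewrite gt_eqF.
  apply: is_derive_eq; rewrite /h add0r /GRing.scale/= mulNr opprK.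
  by rewrite mul1r mulrC.
have cp t p : 0 < t -> {for t, continuous (fun t => t `^ p)}.
  move=> t0; apply/differentiable_continuous/derivable1_diffP.
  by have [] := is_derive1_powR p t0.
have ch t : 0 < t -> {for t, continuous h}.
  move=> t0; apply: cvgM; first by apply: cvgM; [exact: cvg_cst|exact: cp].
  apply: cvgV; first by rewrite expf_neq0// gt_eqF.
  by apply: cvgM; apply: cvgD; [exact: cvg_cst|exact: cp|exact: cvg_cst|exact: cp].
have mh B : measurable_fun B h.
  rewrite (_ : h = fun t => x * t `^ (x - 1) * (1 + t `^ x) `^ (- 2%:R)).
    apply: measurable_funTS; apply: measurable_funM.
      by apply: measurable_funM => //; exact: measurable_powR.
    apply: (measurableT_comp (measurable_powR (- 2%:R))).
    by apply: measurable_funD => //; exact: measurable_powR.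
  by apply/funext => t; rewrite powR_invn// ltW.
have FTC : (\int[mu]_(t in `[a, b]) (h t)%:E = (H b)%:E - (H a)%:E)%E.
  apply: continuous_FTC2 => //.
  - apply: continuous_in_subspaceT => t; rewrite inE/= in_itv/= => /andP[at_ _].
    by apply: ch; exact: lt_le_trans at_.
  - have dd t : 0 < t -> derivable H t 1 by move=> /dH[].
    have cH t : 0 < t -> {for t, continuous H}.
      by move=> t0; apply/differentiable_continuous/derivable1_diffP/dd.
    split.
    + by move=> t; rewrite in_itv/= => /andP[at_ _]; apply/dd/(lt_trans a0).
    + by apply: cvg_at_right_filter; exact: cH.
    + by apply: cvg_at_left_filter; apply: cH; exact: lt_trans ab.
  - move=> t; rewrite in_itv/= => /andP[at_ _]; rewrite derive1E.
    by have [] := dH t (lt_trans a0 at_).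
have C0 : 0 <= D ^+ 2 / x by rewrite divr_ge0 ?sqr_ge0// ltW.
apply: (@le_trans _ _ (\int[mu]_(t in `[a, b]) ((D ^+ 2 / x)%:E * (h t)%:E))%E).
  apply: ge0_le_integral => //.
  - by move=> t _; rewrite lee_fin mulr_ge0 ?powR_ge0 ?expR_ge0.
  - by apply/measurable_EFinP; exact: measurable_gamma_integrand.
  - by apply: measurable_funeM; apply/measurable_EFinP; exact: mh.
  move=> t; rewrite /= in_itv/= => /andP[at_ _]; have t0 := lt_le_trans a0 at_.
  rewrite -EFinM lee_fin /h /gamma_integrand.
  rewrite (_ : _ / x * _ = t `^ (x - 1) * (D ^+ 2 / (1 + t `^ x) ^+ 2)); last first.
    have n0 : 1 + t `^ x != 0 by rewrite gt_eqF.
    have n1 : x != 0 by rewrite gt_eqF.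
    by move: (1 + t `^ x) (t `^ (x - 1)) n0 => u v n0; field; rewrite n0 n1.
  rewrite ler_wpM2l ?powR_ge0// expRN ler_pdivlMr ?exprn_gt0//.
  rewrite mulrC ler_pdivrMr ?expR_gt0//.
  have -> : expR t = expR (t / 2) ^+ 2 by rewrite -expRM_natr divfK.
  rewrite -exprMn; apply: lerXn2r; last exact: hD.
    by rewrite nnegrE ltW.
  by rewrite nnegrE; apply: mulr_ge0; [exact: ltW|exact: expR_ge0].
rewrite ge0_integralZl_EFin//; last 2 first.
- by move=> t _; rewrite lee_fin divr_ge0 ?sqr_ge0// mulr_ge0 ?powR_ge0 ?(ltW x0).
- by apply/measurable_EFinP; exact: mh.
rewrite FTC -EFinB -EFinM lee_fin ler_piMr//.
rewrite /H opprK addrC.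
apply: (@le_trans _ _ (1 + a `^ x)^-1); first by rewrite gerBl invr_ge0 ltW.
by rewrite invf_le1// lerDl powR_ge0.
Qed.

(** [Gamma] takes the [fine] part of an integral and would be 0 for a divergent one, so finiteness
    has to be shown along with positivity. *)
Lemma Gamma_gt0 x : 0 < x -> 0 < Gamma x.
Proof.
move=> x0; rewrite /Gamma /Rintegral -/(gamma_integrand x).
set D0 : set R := `]0, +oo[%classic.
have mg D : measurable_fun D (fun t => (gamma_integrand x t)%:E).
  by apply/measurable_EFinP; exact: measurable_gamma_integrand.
have g0 t : (0 <= (gamma_integrand x t)%:E)%E by rewrite lee_fin mulr_ge0 ?powR_ge0 ?expR_ge0.
have [C hC] := gamma_integral_bounded x0.
(* Compact intervals exhausting the half line; the shift by 2 keeps the two ends distinct at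
   [n = 0]. *)
pose F n : set R := `[(n.+2%:R)^-1, n.+2%:R]%classic.
have FU : \bigcup_n F n = D0.
  apply/seteqP; split => t.
    move=> [n _]; rewrite /F /D0 /= !in_itv/= => /andP[h _]; rewrite andbT.
    by apply: lt_le_trans h; rewrite invr_gt0.
  rewrite /D0 /= in_itv/= andbT => t0.
  exists (Num.bound (t + t^-1)) => //; rewrite /F /= in_itv/=.
  have tt : 0 <= t + t^-1 by rewrite addr_ge0 ?invr_ge0 ?(ltW t0).
  have hb : t + t^-1 <= (Num.bound (t + t^-1)).+2%:R.
    apply: le_trans (ltW (archi_boundP tt)) _; rewrite ler_nat.
    by rewrite (leq_trans (leqnSn _))// leqnSn.
  apply/andP; split; last by apply: le_trans hb; rewrite lerDl invr_ge0 (ltW t0).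
  rewrite -[leRHS]invrK lef_pV2 ?posrE ?invr_gt0//.
  by apply: le_trans hb; rewrite lerDr (ltW t0).
have ndF : nondecreasing_seq F.
  move=> i j ij; apply/subsetPset => t; rewrite /F /= !in_itv/= => /andP[h1 h2].
  have ij2 : (i.+2%:R : R) <= j.+2%:R by rewrite ler_nat.
  by rewrite (le_trans _ h1) ?(le_trans h2)//= lef_pV2 ?posrE.
have Ioo : (\int[mu]_(t in D0) (gamma_integrand x t)%:E <= C%:E)%E.
  have cv : (\int[mu]_(t in F n) (gamma_integrand x t)%:E)%E @[n --> \oo] -->
      (\int[mu]_(t in D0) (gamma_integrand x t)%:E)%E.
    rewrite -FU; apply: ge0_nondecreasing_set_cvg_integral; [exact: ndF|by move=> i; exact: measurable_itv|by move=> i; exact: mg|by move=> i t _; exact: g0].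
  rewrite -(cvg_lim _ cv)//; apply: lime_le; first by apply/cvg_ex; eexists; exact: cv.
  apply: nearW => n; apply: hC; first by rewrite invr_gt0.
  by apply: (@lt_trans _ _ 1); [rewrite invf_lt1// ltr1n|rewrite ltr1n].
have I0 : (0 < \int[mu]_(t in D0) (gamma_integrand x t)%:E)%E.
  (* On $[1,2]$ one has $t^{x-1} = t^x/t \ge 1/2$ and $e^{-t} \ge e^{-2}$. *)
  pose B : set R := `[1, 2]%classic; pose c : R := 1 / 2 * expR (- 2).
  apply: (@lt_le_trans _ _ (\int[mu]_(t in B) c%:E)%E).
    rewrite integral_cst /B//= lebesgue_measure_itv/= lte_fin ltr1n -EFinB -EFinM lte_fin.
    by rewrite mulr_gt0// ?mulr_gt0 ?expR_gt0// subr_gt0 ltr1n.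
  apply: (@le_trans _ _ (\int[mu]_(t in B) (gamma_integrand x t)%:E)%E).
    have c0 : 0 <= c by rewrite mulr_ge0 ?expR_ge0.
    apply: ge0_le_integral => //; first exact: measurable_itv.
      exact: mg.
    move=> t; rewrite /B /= in_itv/= => /andP[t1 t2]; rewrite lee_fin /gamma_integrand.
    have t0 : 0 < t by rewrite (lt_le_trans ltr01).
    apply: ler_pM; rewrite ?expR_ge0//; last by rewrite ler_expR lerN2.
    rewrite ler_pdivrMr//; apply: (@le_trans _ _ (t * t `^ (x - 1))); last first.
      by rewrite mulrC ler_wpM2l ?powR_ge0.
    rewrite mulr_powRB1 ?(ltW t0)//.
    by rewrite -[leLHS](powRr0 t); apply: ler_powR => //; exact: ltW.
  have mI (i : interval R) : measurable ([set` i] : set R) by exact: measurable_itv.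
  apply: ge0_subset_integral; [exact: mI|exact: mI|exact: mg|by move=> t _; exact: g0|].
  by move=> t; rewrite /B /D0 /= !in_itv/= andbT => /andP[t1 _]; rewrite (lt_le_trans ltr01).
rewrite -lte_fin fineK//.
rewrite ge0_fin_numE; first exact: le_lt_trans Ioo (ltry _).
exact: ltW.
Qed.

End GammaPositive.

(** * Change of variables and Fatou's lemma *)

Section PreservedIntegral.
Context d (T : measurableType d) (R : realType) (mu : {measure set T -> \bar R}).

Lemma measurable_preimageT d' (T' : measurableType d') (f : T' -> T) (D : set T) : measurable_fun setT f -> measurable D ->
  measurable (f @^-1` D).
Proof. by move=> mf mD; rewrite -[X in measurable X]setTI; exact: mf. Qed.

Lemma ge0_integral_preserving (f : T -> T) D (g : T -> \bar R) :
  measure_preserving mu f -> measurable D -> measurable_fun D g ->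
  (forall x, D x -> (0 <= g x)%E) ->
  (\int[mu]_(x in f @^-1` D) g (f x) = \int[mu]_(x in D) g x)%E.
Proof.
move=> [mf pf] mD mg g0.
rewrite -(ge0_integral_pushforward mf mu mD mg); last by move=> x; rewrite inE; exact: g0.
by apply: eq_measure_integral => A mA _; exact: pf.
Qed.

Lemma integral_preserving (f : T -> T) D (g : T -> \bar R) :
  measure_preserving mu f -> measurable D -> measurable_fun D g ->
  (\int[mu]_(x in f @^-1` D) g (f x) = \int[mu]_(x in D) g x)%E.
Proof.
move=> pf mD mg.
have p := ge0_integral_preserving pf mD (measurable_funepos mg) (fun x _ => funepos_ge0 g x).
have m := ge0_integral_preserving pf mD (measurable_funeneg mg) (fun x _ => funeneg_ge0 g x).
rewrite integralE [RHS]integralE -p -m; congr (_ - _)%E; apply: eq_integral => x _.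
  by rewrite !funeposE.
by rewrite !funenegE.
Qed.

Lemma fatou_le D (h_ : nat -> T -> R) (h : T -> R) (C : \bar R) : measurable D ->
  (forall N, measurable_fun D (h_ N)) -> (forall N t, D t -> 0 <= h_ N t) ->
  (forall t, D t -> h_ N t @[N --> \oo] --> h t) ->
  (forall N, (\int[mu]_(t in D) (h_ N t)%:E <= C)%E) ->
  (\int[mu]_(t in D) (h t)%:E <= C)%E.
Proof.
move=> mD mh h0 ch hC.
have := @fatou _ _ _ mu D mD (fun N t => (h_ N t)%:E) _ _.
move=> /(_ (fun N => (measurable_EFinP _ _).2 (mh N)))/(_ (fun N t Dt => h0 N t Dt)) F.
rewrite (@eq_integral _ _ _ _ _ (fun t => limn_einf (fun N => (h_ N t)%:E))); last first.
  move=> t; rewrite inE => Dt; apply/esym.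
  have c : ((h_ N t)%:E @[N --> \oo] --> (h t)%:E)%E by apply: cvg_EFin; [exact: nearW|exact: ch].
  by rewrite (is_cvg_limn_einfE (cvgP _ c)); exact: cvg_lim.
apply: le_trans F _.
rewrite limn_einf_lim; apply: lime_le; first exact: is_cvg_einfs.
apply: nearW => N; apply: ge_ereal_inf; exists (\int[mu]_(t in D) (h_ N t)%:E)%E => //.
by exists N => //=.
Qed.

End PreservedIntegral.

Section Coordinates.
Context {R : realType} {n : nat}.
Local Notation C := R[i].
Local Notation V := 'cV[C]_n.
Local Notation plane := (measurableTypeR R * measurableTypeR R)%type.
Implicit Types (z w : V) (t : n.-tuple plane).

Definition diag_scale (c : 'I_n -> C) z : V := \col_i (c i * z i 0).

Definition rot_coords (c : 'I_n -> C) : n.-tuple plane -> n.-tuple plane :=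
  tuple_map (fun i => plane_rot (complex.Re (c i)) (complex.Im (c i))).

Definition translate_coords z : n.-tuple plane -> n.-tuple plane :=
  tuple_map (fun i p => (p.1 + complex.Re (z i 0), p.2 + complex.Im (z i 0))).

Lemma rot_coordsE c t : of_real_coords (rot_coords c t) = diag_scale c (of_real_coords t).
Proof.
apply/colP => i; rewrite !mxE tnth_mktuple /plane_rot /=.
by apply: complex_eqP; rewrite ?cReM ?cImM//= addrC.
Qed.

Lemma translate_coordsE z t : of_real_coords (translate_coords z t) = z + of_real_coords t.
Proof.
apply/colP => i; rewrite !mxE tnth_mktuple /=.
by apply: complex_eqP; rewrite ?cReD ?cImD//= addrC.
Qed.

Lemma measure_preserving_rot_coords c : (forall i, normc (c i) = 1) ->
  measure_preserving (lebesgue_Cn R n) (rot_coords c).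
Proof.
move=> c1; apply: measure_preserving_tuple => i; apply: measure_preserving_rot.
by rewrite -sqr_normc_ReIm c1 expr1n.
Qed.

Lemma measure_preserving_translate_coords z :
  measure_preserving (lebesgue_Cn R n) (translate_coords z).
Proof.
apply: measure_preserving_tuple => i.
exact: (measure_preserving_plane_translate (complex.Re (z i 0), complex.Im (z i 0))).
Qed.

Lemma sqnorm_diag_scale c z : (forall i, normc (c i) = 1) -> sqnorm (diag_scale c z) = sqnorm z.
Proof.
by move=> c1; apply: eq_bigr => i _; rewrite mxE Normc.normcM c1 mul1r.
Qed.

End Coordinates.

Section Box.
Context {R : realType}.
Local Notation plane := (measurableTypeR R * measurableTypeR R)%type.

Definition box n (a : R) : set (n.-tuple plane) :=
  [set t | forall i, `|(tnth t i).1| <= a /\ `|(tnth t i).2| <= a].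
Arguments box : clear implicits.

(** It serves to bound the volume of small balls from below. *)
Lemma box_measure n (a : R) : 0 <= a ->
  measurable (box n a) /\ lebesgue_Cn R n (box n a) = ((2 * a) ^+ (2 * n))%:E.
Proof.
move=> a0; pose S : set (measurableTypeR R) := `[- a, a]%classic.
have mS : measurable S by exact: measurable_itv.
have SE x : S x <-> `|x| <= a by rewrite /S /= in_itv/= ler_norml.
have IS : (@lebesgue_measure R) S = (2 * a)%:E.
  rewrite lebesgue_measure_itv/= lte_fin.
  move: a0; rewrite le_eqVlt => /predU1P[<-|a0]; first by rewrite oppr0 ltxx mulr0.
  by rewrite gtrN// -EFinB opprK; congr (_%:E); lra.
have mbox m : measurable (box m a).
  rewrite (_ : box m a = \bigcap_(i in [set: 'I_m]) ((@tnth _ _)^~ i @^-1` (S `*` S))).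
    apply: fin_bigcap_measurable => // i _.
    by apply: measurable_preimageT; [exact: measurable_tnth|exact: measurableX].
  apply/seteqP; split => t /= h i; first by move=> _; have [h1 h2] := h i; split; apply/SE.
  by have [/SE h1 /SE h2] := h i Logic.I.
split=> //; elim: n => [|m IH].
  by rewrite /= diracE mem_set// => -[].
transitivity (product_measure (plane_measure R) (lebesgue_Cn R m) ((@tuple_cons R m) @^-1` box m.+1 a)).
  by [].
rewrite (_ : _ @^-1` _ = (S `*` S) `*` box m a); last first.
  apply/seteqP; split => -[p t] /=.
    move=> h; split; first by have [h1 h2] := h ord0; split; apply/SE.
    move=> i; have := h (lift ord0 i); rewrite /tuple_cons /= tnthS //.
  move=> [[/SE h1 /SE h2] h] i; rewrite /tuple_cons /=.
  by case: (unliftP ord0 i) => [j|] ->; rewrite ?tnth0 ?tnthS.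
rewrite /product_measure product_measure1E; [|exact: measurableX|exact: mbox].
rewrite IH [X in (X * _)%E](_ : _ = ((2 * a) ^+ 2)%:E); last first.
  transitivity ((@lebesgue_measure R) S * (@lebesgue_measure R) S)%E; first exact: product_measure1E.
  by rewrite expr2 EFinM; congr (_ * _)%E.
by rewrite -EFinM -exprD mulnS.
Qed.

End Box.

(** * The Bergman space *)

Section ComplexMeasurable.
Context {R : realType} d (T : measurableType d).
Local Notation C := R[i].
Implicit Types (D : set T) (f g : T -> C).

Definition cmeas D f := measurable_fun D (fun t => complex.Re (f t)) /\
  measurable_fun D (fun t => complex.Im (f t)).

Lemma cmeasS D D' f : measurable D -> D' `<=` D -> cmeas D f -> cmeas D' f.
Proof.
by move=> mD s [h1 h2]; split; [exact: measurable_funS h1|exact: measurable_funS h2].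
Qed.

Lemma eq_cmeas D f g : {in D, f =1 g} -> cmeas D f -> cmeas D g.
Proof.
by move=> fg [h1 h2]; split; [apply: eq_measurable_fun h1|apply: eq_measurable_fun h2] => x xD;
  rewrite fg.
Qed.

Lemma cmeas_cst D a : cmeas D (fun=> a).
Proof. by split; exact: measurable_cst. Qed.

Lemma cmeasD D f g : cmeas D f -> cmeas D g -> cmeas D (fun t => f t + g t).
Proof.
move=> [h1 h2] [h3 h4]; split.
  by under eq_fun do rewrite cReD; exact: measurable_funD.
by under eq_fun do rewrite cImD; exact: measurable_funD.
Qed.

Lemma cmeasM D f g : cmeas D f -> cmeas D g -> cmeas D (fun t => f t * g t).
Proof.
move=> [h1 h2] [h3 h4]; split.
  by under eq_fun do rewrite cReM; apply: measurable_funB; exact: measurable_funM.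
by under eq_fun do rewrite cImM; apply: measurable_funD; exact: measurable_funM.
Qed.

Lemma cmeas_conj D f : cmeas D f -> cmeas D (fun t => (f t)^*%C).
Proof.
move=> [h1 h2]; split.
  by rewrite (_ : (fun t => _) = (fun t => complex.Re (f t)))//; apply/funext => t; case: (f t).
rewrite (_ : (fun t => _) = (fun t => - complex.Im (f t))); first exact: measurable_funN.
by apply/funext => t; case: (f t).
Qed.

Lemma cmeas_sum D (I : Type) (s : seq I) (F : I -> T -> C) :
  (forall i, cmeas D (F i)) -> cmeas D (fun t => \sum_(i <- s) F i t).
Proof.
move=> h; elim: s => [|i s IH]; first by under eq_fun do rewrite big_nil; exact: cmeas_cst.
by under eq_fun do rewrite big_cons; exact: cmeasD.
Qed.

Lemma cmeas_cvg D (f_ : nat -> T -> C) f : (forall N, cmeas D (f_ N)) ->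
  (forall t, D t -> ccvg (fun N => f_ N t) (f t)) -> cmeas D f.
Proof.
move=> mf cf; split.
  apply: (@measurable_fun_cvg _ _ _ D (fun N t => complex.Re (f_ N t))) => [N|t Dt].
    by have [] := mf N.
  by have [] := (ccvg_ReIm _ _).1 (cf t Dt).
apply: (@measurable_fun_cvg _ _ _ D (fun N t => complex.Im (f_ N t))) => [N|t Dt].
  by have [] := mf N.
by have [] := (ccvg_ReIm _ _).1 (cf t Dt).
Qed.

Lemma cmeas_sqr D f : cmeas D f -> measurable_fun D (fun t => normc (f t) ^+ 2).
Proof. by move=> [h1 h2]; exact: measurable_sqr_normc. Qed.

End ComplexMeasurable.

Lemma cmeas_comp {R : realType} d d' (T : measurableType d) (T' : measurableType d')
  (D : set T) (D' : set T') (f : T -> R[i]) (g : T' -> T) :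
  measurable D -> measurable_fun D' g -> g @` D' `<=` D -> cmeas D f -> cmeas D' (fun t => f (g t)).
Proof.
move=> mD mg gD [h1 h2]; split; [exact: (measurable_comp mD gD h1 mg)|exact: (measurable_comp mD gD h2 mg)].
Qed.

(** * Lower bounds for the density and averages in $L^2$ *)

Section Density.
Context {R : realType} {n : nat} (lambda : R).
Hypothesis lambda_gtN1 : -1 < lambda.
Local Notation C := R[i].
Local Notation V := 'cV[C]_n.
Local Notation plane := (measurableTypeR R * measurableTypeR R)%type.
Implicit Types (z w : V) (t : n.-tuple plane).

Lemma bergman_density_const_gt0 :
  0 < Gamma (n%:R + lambda + 1) / (pi ^+ n * Gamma (lambda + 1)).
Proof.
have l0 : 0 < lambda + 1 by rewrite -ltrBlDr sub0r.
apply: divr_gt0.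
  by apply: Gamma_gt0; rewrite -addrA ltr_wpDl.
by apply: mulr_gt0; [rewrite exprn_gt0// pi_gt0|exact: Gamma_gt0].
Qed.

Lemma bergman_density_lower (q : R) : q < 1 ->
  exists2 c, 0 < c & forall z, sqnorm z <= q -> c <= bergman_density lambda z.
Proof.
move=> q1; have q1' : 0 < 1 - q by rewrite subr_gt0.
(* On $(0,1]$ a larger exponent gives a smaller power, so $\max(\lambda,0)$ bounds the weight from
   below for either sign of $\lambda$; this power is moreover nondecreasing in the base. *)
exists (Gamma (n%:R + lambda + 1) / (pi ^+ n * Gamma (lambda + 1)) * (1 - q) `^ Num.max lambda 0).
  by rewrite mulr_gt0 ?bergman_density_const_gt0// powR_gt0.
move=> z zq; apply: ler_wpM2l; first by rewrite ltW ?bergman_density_const_gt0.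
have z1 : 1 - q <= 1 - sqnorm z by rewrite lerD2l lerN2.
have z0 : 0 < 1 - sqnorm z by exact: lt_le_trans z1.
apply: (@le_trans _ _ ((1 - sqnorm z) `^ Num.max lambda 0)).
  by apply: ge0_ler_powR; rewrite ?nnegrE ?le_max ?lexx ?orbT// ltW.
apply: ger_powR; last by rewrite le_max lexx.
by rewrite z0 gerBl sqnorm_ge0.
Qed.

End Density.

Lemma sqr_sum_le {R : realType} N (a : 'I_N -> R) :
  (\sum_j a j) ^+ 2 <= N%:R * \sum_j a j ^+ 2.
Proof.
rewrite expr2 mulr_suml.
apply: (@le_trans _ _ (\sum_i \sum_j (a i ^+ 2 / 2 + a j ^+ 2 / 2))).
  apply: ler_sum => i _; rewrite mulr_sumr; apply: ler_sum => j _.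
  have := sqr_ge0 (a i - a j); move: (a i) (a j); clear => x y.
  by rewrite !expr2; lra.
set S := \sum_j a j ^+ 2.
under eq_bigr do rewrite big_split /= sumr_const card_ord -mulr_suml -/S.
rewrite big_split /= sumr_const card_ord sumrMnl -!mulr_suml -/S -mulrnDl -mulrDl -mulr2n.
by rewrite -[_ *+ 2]mulr_natr -mulrA divff ?pnatr_eq0// mulr1 mulr_natl.
Qed.

Lemma sqr_normc_avg {R : realType} N d (phi : R[i] -> R[i]) :
  normc (avg N d phi) ^+ 2 <= N%:R^-1 * \sum_(j < N) normc (phi (rootu N ^+ j)) ^+ 2.
Proof.
rewrite /avg Normc.normcM exprMn Normc.normcV.
have -> : normc (N%:R : R[i]) = N%:R by rewrite -[N%:R]/((1 : R[i]) *+ N) -(rmorph_nat (@real_complex R)) normc_real ger0_norm.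
have [->|N0] := posnP N; first by rewrite invr0 expr0n/= !mul0r.
have N1 : 0 < N%:R :> R by rewrite ltr0n.
rewrite expr2 -mulrA ler_wpM2l ?invr_ge0 ?ler0n// mulrC ler_pdivrMr// [leRHS]mulrC.
apply: le_trans (sqr_sum_le _).
rewrite lerXn2r ?nnegrE ?normc_ge0//; first by apply: sumr_ge0 => i _; exact: normc_ge0.
apply: le_trans (normc_sum _ _ _) _; apply: ler_sum => j _.
by rewrite Normc.normcM Normc.normcV !normcX normc_rootu !expr1n invr1 mulr1.
Qed.

Section MeanValue.
Context {R : realType} {n : nat}.
Local Notation C := R[i].
Local Notation V := 'cV[C]_n.
Local Notation plane := (measurableTypeR R * measurableTypeR R)%type.
Local Notation mu := (lebesgue_Cn R n).
Implicit Types (z w : V) (t : n.-tuple plane).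

Lemma diag_scale_cst (c : C) z : diag_scale (fun=> c) z = c *: z.
Proof. by apply/colP => i; rewrite !mxE. Qed.

(** Averaging over rotations contracts $L^2(D)$: Cauchy-Schwarz at each point, then invariance of
    [D] and of the measure. *)
Lemma integral_avg (D : set (n.-tuple plane)) (G : V -> C) N d : measurable D ->
  (forall c, normc c = 1 -> rot_coords (fun=> c) @^-1` D = D) ->
  cmeas D (fun t => G (of_real_coords t)) ->
  cmeas D (fun t => avg N d (fun s => G (s *: of_real_coords t))) /\
  (\int[mu]_(t in D) (normc (avg N d (fun s => G (s *: of_real_coords t))) ^+ 2)%:E <=
   \int[mu]_(t in D) (normc (G (of_real_coords t)) ^+ 2)%:E)%E.
Proof.
move=> mD rD mG.
have nr j : normc (rootu N ^+ j : C) = 1 by rewrite normcX normc_rootu expr1n.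
have p j := @measure_preserving_rot_coords R n (fun=> rootu N ^+ j) (fun=> nr j).
pose G_ j t := G (rootu N ^+ j *: of_real_coords t).
have G_E j t : G (of_real_coords (rot_coords (fun=> rootu N ^+ j) t)) = G_ j t.
  by rewrite rot_coordsE diag_scale_cst.
have mG_ j : cmeas D (G_ j).
  rewrite -[X in cmeas X _](rD _ (nr j)).
  rewrite (_ : G_ j = (fun t => G (of_real_coords (rot_coords (fun=> rootu N ^+ j) t)))); last first.
    by apply/funext => t; rewrite G_E.
  apply: (@cmeas_comp _ _ _ _ _ D _ (fun t => G (of_real_coords t))) mG => //.
  - by have [m _] := p j; exact: measurable_funTS.
  - by move=> _ [t Dt <-].
have mA : cmeas D (fun t => avg N d (fun s => G (s *: of_real_coords t))).
  rewrite /avg; apply: cmeasM; first exact: cmeas_cst.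
  by apply: cmeas_sum => j; apply: cmeasM; [exact: mG_|exact: cmeas_cst].
split=> //.
have iG j : (\int[mu]_(t in D) (normc (G_ j t) ^+ 2)%:E = \int[mu]_(t in D) (normc (G (of_real_coords t)) ^+ 2)%:E)%E.
  rewrite -[RHS](integral_preserving (p j) mD) ?(rD _ (nr j)).
    by apply: eq_integral => t _ /=; rewrite G_E.
  by apply/measurable_EFinP; exact: cmeas_sqr.
have mS : measurable_fun D (fun t => \sum_(j < N) (normc (G_ j t) ^+ 2)%:E)%E.
  by apply: emeasurable_sum => j; apply/measurable_EFinP; exact: cmeas_sqr.
apply: (@le_trans _ _ (\int[mu]_(t in D) ((N%:R^-1)%:E * \sum_(j < N) (normc (G_ j t) ^+ 2)%:E)))%E.
  apply: ge0_le_integral => //.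
  - by move=> t _; rewrite lee_fin sqr_ge0.
  - by apply/measurable_EFinP; exact: cmeas_sqr.
  - exact: measurable_funeM.
  by move=> t _; rewrite sumEFin -EFinM lee_fin; exact: sqr_normc_avg.
rewrite ge0_integralZl_EFin ?invr_ge0 ?ler0n//; last by move=> t _; apply: sume_ge0 => j _; rewrite lee_fin sqr_ge0.
rewrite ge0_integral_sum//; [|by move=> j; apply/measurable_EFinP; exact: cmeas_sqr|by move=> j t _; rewrite lee_fin sqr_ge0].
under eq_bigr do rewrite iG.
set I := integral _ _ _; have I0 : (0 <= I)%E by apply: integral_ge0 => t _; rewrite lee_fin sqr_ge0.
have [->|N0] := posnP N; first by rewrite big_ord0 mule0.
have -> : (\sum_(j < N) I = N%:R%:E * I)%E.
  elim: {mA mG_ G_E G_ p nr iG mS N0} N => [|N IH]; first by rewrite big_ord0 mul0e.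
  by rewrite big_ord_recr /= IH -natr1 EFinD ge0_muleDl// mul1e.
by rewrite muleA -EFinM mulVf ?mul1e// pnatr_eq0 -lt0n.
Qed.

End MeanValue.

(** * Bounded point evaluations *)

Section PointwiseBound.
Context {R : realType} {n : nat} (lambda : R).
Hypothesis lambda_gtN1 : -1 < lambda.
Local Notation C := R[i].
Local Notation V := 'cV[C]_n.
Local Notation plane := (measurableTypeR R * measurableTypeR R)%type.
Local Notation mu := (lebesgue_Cn R n).
Local Notation A2 := (@bergman R n lambda).
Implicit Types (z w : V) (t : n.-tuple plane) (f : A2).

Lemma bergman_hol f z : unit_ball z -> hol_at f z.
Proof.
have /asboolP[_ df _] := bergmanP f.
exact: (holomorphic_hol_at _).1.
Qed.

Lemma bergman_out f z : ~ unit_ball z -> f z = 0.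
Proof. by have /asboolP[h _ _] := bergmanP f; exact: h. Qed.

Lemma bergman_cmeas f : cmeas (@ball_coords R n) (fun t => f (of_real_coords t)).
Proof. by have /asboolP[_ _ []] := bergmanP f. Qed.

Lemma sqnormD_le z w : sqnorm z <= 1 -> mnorm w <= 1 ->
  sqnorm (z + w) <= sqnorm z + 3 * mnorm w.
Proof.
move=> z1 w1.
have zi i : normc (z i 0) <= 1.
  rewrite -(@expr_le1 _ 2)// ?normc_ge0//; apply: le_trans z1.
  by rewrite /sqnorm (bigD1 i)//= lerDl sumr_ge0// => j _; rewrite sqr_ge0.
rewrite /sqnorm /mnorm mulr_sumr -big_split; apply: ler_sum => i _ /=; rewrite mxE.
have wi : normc (w i 0) <= 1 := le_trans (normc_le_mnorm _ _) w1.
apply: (@le_trans _ _ ((normc (z i 0) + normc (w i 0)) ^+ 2)).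
  by rewrite lerXn2r ?nnegrE ?addr_ge0 ?normc_ge0// le_normcD.
have := normc_ge0 (z i 0); have := normc_ge0 (w i 0).
move: (normc (z i 0)) (normc (w i 0)) (zi i) wi; clear => x y x1 y1 y0 x0.
have : y * x <= y * 1 by rewrite ler_wpM2l.
have : y * y <= y * 1 by rewrite ler_wpM2l.
by rewrite !expr2; lra.
Qed.

Lemma mnorm_le_sqnorm (r : R) z : 0 <= r -> sqnorm z < r ^+ 2 -> mnorm z <= n%:R * r.
Proof.
move=> r0 zr; apply: (@le_trans _ _ (\sum_(i < n) r)); last first.
  by rewrite sumr_const card_ord mulr_natl.
apply: ler_sum => i _; rewrite -(@ler_pXn2r _ 2) ?nnegrE ?normc_ge0//.
apply: le_trans (ltW zr).
by rewrite /sqnorm (bigD1 i)//= lerDl sumr_ge0// => j _; rewrite sqr_ge0.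
Qed.

Definition pdisc (r : R) : set (n.-tuple plane) := [set t | sqnorm (of_real_coords t) < r ^+ 2].

Lemma measurable_pdisc r : measurable (pdisc r).
Proof.
have := @measurable_sqnorm R n measurableT _ (measurable_itv `]-oo, (r ^+ 2)[%R).
rewrite setTI; congr measurable; apply/seteqP; split => t /=; by rewrite /pdisc /= in_itv.
Qed.

Lemma pdisc_measure r : 0 < r -> exists2 b, 0 < b & (b%:E <= mu (pdisc r))%E.
Proof.
(* The cube with half side [a] lies in the ball because $2na^2 < r^2$. *)
move=> r0; pose a := r / (2 * n.+1%:R).
have n0 : 0 < n.+1%:R :> R by [].
have a0 : 0 < a by rewrite divr_gt0// mulr_gt0.
have [mb be] := box_measure n (ltW a0).
exists ((2 * a) ^+ (2 * n)); first by rewrite exprn_gt0// mulr_gt0.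
rewrite -be; apply: le_measure; rewrite ?inE//; first exact: measurable_pdisc.
move=> t tb; rewrite /pdisc /=.
have ai i : normc (of_real_coords t i 0) ^+ 2 <= 2 * a ^+ 2.
  rewrite sqr_normc_ReIm mxE /= mulr_natl mulr2n; have [h1 h2] := tb i.
  by apply: lerD; rewrite -real_normK ?num_real// lerXn2r ?nnegrE// ltW.
apply: (@le_lt_trans _ _ (\sum_(i < n) 2 * a ^+ 2)); first by apply: ler_sum => i _; exact: ai.
rewrite sumr_const card_ord -[ltLHS]mulr_natr /a exprMn.
have -> : 2 * (r ^+ 2 * ((2 * n.+1%:R)^-1) ^+ 2) * n%:R = r ^+ 2 * (n%:R / (2 * n.+1%:R ^+ 2)).
  by field; rewrite addrC natr1 pnatr_eq0.
rewrite -[ltRHS]mulr1 ltr_pM2l ?exprn_gt0// ltr_pdivrMr ?mulr_gt0 ?exprn_gt0// mul1r.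
rewrite -(natr1 n); have : 0 <= n%:R :> R by []. 
by move: (n%:R : R) => x x0; rewrite expr2; nra.
Qed.

(** After translation by [z] the domain lies where the density is at least [c]; enlarging it to the
    unit ball then gives the norm. *)
Lemma bergman_norm_le_pdisc z (r q : R) f : q < 1 ->
  (forall w, sqnorm w < r ^+ 2 -> sqnorm (z + w) <= q) ->
  forall c, 0 < c -> (forall w, sqnorm w <= q -> c <= bergman_density lambda w) ->
  (\int[mu]_(t in pdisc r) (normc (f (z + of_real_coords t)) ^+ 2)%:E <=
   (bergman_norm f ^+ 2 / c)%:E)%E.
Proof.
move=> q1 hr c c0 hc.
have mt := measure_preserving_translate_coords z.
pose D : set (n.-tuple plane) := [set t | sqnorm (of_real_coords t - z) < r ^+ 2].
have mD : measurable D.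
  rewrite (_ : D = translate_coords (- z) @^-1` pdisc r).
    have [m _] := measure_preserving_translate_coords (- z).
    by apply: measurable_preimageT => //; exact: measurable_pdisc.
  by apply/seteqP; split => t; rewrite /pdisc /D /= translate_coordsE addrC.
have Dq t : D t -> sqnorm (of_real_coords t) <= q.
  by move=> Dt; rewrite -[of_real_coords t](subrKC z); exact: hr.
have DB : D `<=` @ball_coords R n by move=> t /Dq tq; rewrite /ball_coords /unit_ball /=; exact: le_lt_trans q1.
have mfB := bergman_cmeas f.
have mf : measurable_fun D (fun t => (normc (f (of_real_coords t)) ^+ 2)%:E).
  apply/measurable_EFinP; apply: cmeas_sqr; apply: cmeasS mfB => //.
  exact: measurable_ball_coords.
rewrite (_ : (\int[mu]_(t in pdisc r) _)%E = (\int[mu]_(t in D) (normc (f (of_real_coords t)) ^+ 2)%:E)%E); last first.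
  rewrite -(integral_preserving mt mD mf) (_ : _ @^-1` D = pdisc r).
    by apply: eq_integral => t _; rewrite translate_coordsE.
  by apply/seteqP; split => t; rewrite /D /pdisc /= translate_coordsE addrAC subrr add0r.
rewrite EFinM lee_pdivlMr// muleC.
have mdens E : measurable E -> E `<=` @ball_coords R n -> measurable_fun E
    (fun t => (normc (f (of_real_coords t)) ^+ 2 * bergman_density lambda (of_real_coords t))%:E).
  move=> mE EB; apply/measurable_EFinP; apply: measurable_funM.
    by apply: cmeas_sqr; apply: cmeasS mfB => //; exact: measurable_ball_coords.
  exact: measurable_bergman_density.
rewrite -ge0_integralZl_EFin//; [|by move=> t _; rewrite lee_fin sqr_ge0|exact: ltW].
rewrite sqr_bergman_norm /integral_ball.
apply: (@le_trans _ _ (\int[mu]_(t in D)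
    (normc (f (of_real_coords t)) ^+ 2 * bergman_density lambda (of_real_coords t))%:E)%E).
  apply: ge0_le_integral => //.
  - by move=> t _; rewrite mule_ge0 ?lee_fin ?sqr_ge0// ltW.
  - exact: measurable_funeM.
  - exact: mdens.
  by move=> t Dt; rewrite -EFinM lee_fin mulrC ler_wpM2l ?sqr_ge0// hc// Dq.
apply: ge0_subset_integral => //.
- exact: measurable_ball_coords.
- by apply: mdens => //; exact: measurable_ball_coords.
- by move=> t _; rewrite lee_fin mulr_ge0 ?sqr_ge0 ?bergman_density_ge0.
Qed.

(** Radius 2 stands for any radius above 1: the expansion in [s] has to converge on the unit circle,
    where the average is taken. *)
Lemma mean_value_cvg f z w : (forall s : C, normc s < 2 -> unit_ball (z + s *: w)) ->
  ccvg (fun N => avg N 0 (fun s => f (z + s *: w))) (f z).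
Proof.
move=> h.
have [||c [c0 [r [M [r1 hc]]]]] := @taylor_unit _ (fun s => f (z + s *: w)) 2.
- by rewrite ltr1n.
- by move=> s s2; apply: hol_at_line; exact: bergman_hol (h _ s2).
by have := avg_cvg 0 r1 hc; rewrite c0 scale0r addr0; exact.
Qed.

(* f(z) is the limit of averages of f over rotated copies of z + w; by Cauchy-Schwarz |f(z)|^2 is at
   most the mean of |f|^2 over a small ball around z, where the density is bounded below. *)
Lemma pointwise_bound z0 : unit_ball z0 ->
  exists C rho : R, 0 < rho /\ (forall z, mnorm (z - z0) < rho -> unit_ball z) /\
    0 <= C /\ forall f z, mnorm (z - z0) < rho -> normc (f z) ^+ 2 <= C * bergman_norm f ^+ 2.
Proof.
move=> z01; pose q := sqnorm z0; have q1 : q < 1 := z01.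
have n0 : 0 < n.+1%:R :> R by [].
(* For [z] within $\rho$ of [z0] and [u] of size at most $2n\rho$, the displacement from [z0] is at
   most $(1-q)/6$; the factor 3 in [sqnormD_le] then gives $q + (1-q)/2 = q'$. The size $2n\rho$
   arises from $|s| \le 2$ and points of [pdisc rho], whose $\ell^1$ norm is at most $n\rho$. *)
pose rho := (1 - q) / (12 * n.+1%:R); pose q' := (1 + q) / 2.
have rho0 : 0 < rho by rewrite divr_gt0 ?subr_gt0// mulr_gt0.
have q0 : 0 <= q := sqnorm_ge0 _.
have rhoE : 12 * n.+1%:R * rho = 1 - q by rewrite /rho mulrC divfK// lt0r_neq0// mulr_gt0.
have q'1 : q' < 1 by rewrite /q'; lra.
have key z u : mnorm (z - z0) < rho -> mnorm u <= 2 * (n%:R * rho) -> sqnorm (z + u) <= q'.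
  move=> zr ur; rewrite -[z](subrKC z0) -addrA.
  have ur' : mnorm (z - z0 + u) <= (1 - q) / 6.
    apply: le_trans (mnormD _ _) _.
    have e : 12 * (n%:R * rho) + 12 * rho = 1 - q by rewrite -rhoE -(natr1 n); ring.
    lra.
  apply: le_trans (sqnormD_le _ _) _; first exact: ltW.
    by apply: le_trans ur' _; lra.
  by rewrite /q' -/q; lra.
have [c c0 hc] := bergman_density_lower (n := n) lambda_gtN1 q'1.
have [b b0 hb] := pdisc_measure rho0.
exists (b^-1 / c), rho; split=> //; split.
  move=> z zr; have h0 : 0 <= 2 * (n%:R * rho) by apply: mulr_ge0 => //; apply: mulr_ge0 => //; exact: ltW.
  by have := key z 0 zr; rewrite addr0 mnorm0 => /(_ h0)/le_lt_trans; exact.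
split; first by rewrite divr_ge0// ?invr_ge0 ltW.
move=> f z zr.
have hw (w : V) s : sqnorm w < rho ^+ 2 -> normc s <= 2 -> sqnorm (z + s *: w) <= q'.
  move=> wr s2; apply: key => //; rewrite mnormZ; apply: ler_pM; rewrite ?normc_ge0 ?mnorm_ge0//.
  by apply: mnorm_le_sqnorm => //; exact: ltW.
pose G w := f (z + w).
have mG : cmeas (pdisc rho) (fun t => G (of_real_coords t)).
  apply: (@eq_cmeas _ _ _ _ (fun t => f (of_real_coords (translate_coords z t)))).
    by move=> t _; rewrite translate_coordsE.
  apply: cmeas_comp (bergman_cmeas f); first exact: measurable_ball_coords.
    by have [m _] := measure_preserving_translate_coords z; exact: measurable_funTS.
  move=> _ [t tr <-]; rewrite /ball_coords /unit_ball /= translate_coordsE.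
  by rewrite -[of_real_coords t]scale1r; apply: le_lt_trans (hw _ 1 _ _) q'1; rewrite ?Normc.normc1 ?ler1n.
have rD e : normc e = 1 -> rot_coords (fun=> e) @^-1` pdisc rho = pdisc rho.
  by move=> e1; apply/seteqP; split => t; rewrite /pdisc /= rot_coordsE sqnorm_diag_scale.
have avgG N := integral_avg N 0 (measurable_pdisc rho) rD mG.
have int_le : (\int[mu]_(t in pdisc rho) (normc (f z) ^+ 2)%:E <= (bergman_norm f ^+ 2 / c)%:E)%E.
  apply: (@fatou_le _ _ _ _ _ (fun N t => normc (avg N 0 (fun s => G (s *: of_real_coords t))) ^+ 2)).
  - exact: measurable_pdisc.
  - by move=> N; apply: cmeas_sqr; have [] := avgG N.
  - by move=> N t _; rewrite sqr_ge0.
  - move=> t tr.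
    have /ccvg_ReIm[cr ci] : ccvg (fun N => avg N 0 (fun s => G (s *: of_real_coords t))) (f z).
      by apply: mean_value_cvg => s s2; apply: le_lt_trans (hw _ _ tr (ltW s2)) q'1.
    rewrite sqr_normc_ReIm; under eq_fun do rewrite sqr_normc_ReIm.
    by apply: cvgD; rewrite expr2; under eq_fun do rewrite expr2; apply: cvgM.
  - move=> N; apply: le_trans (avgG N).2 _; apply: bergman_norm_le_pdisc q'1 _ c c0 hc.
    by move=> w wr; rewrite -[w]scale1r; apply: hw; rewrite ?Normc.normc1 ?ler1n.
rewrite integral_cst in int_le; last exact: measurable_pdisc.
have : ((normc (f z) ^+ 2)%:E * b%:E <= (bergman_norm f ^+ 2 / c)%:E)%E.
  by apply: le_trans int_le; rewrite lee_wpmul2l// lee_fin sqr_ge0.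
rewrite -EFinM lee_fin -ler_pdivlMr// => /le_trans; apply.
by rewrite le_eqVlt; apply/orP; left; apply/eqP; ring.
Qed.

End PointwiseBound.

(** * The inner product and its norm *)

Section InnerProduct.
Context {R : realType} {n : nat} (lambda : R).
Local Notation C := R[i].
Local Notation V := 'cV[C]_n.
Local Notation plane := (measurableTypeR R * measurableTypeR R)%type.
Local Notation mu := (lebesgue_Cn R n).
Local Notation A2 := (@bergman R n lambda).
Local Notation N := (@bergman_norm R n lambda).
Local Notation dot := (@bergman_dot R n lambda).
Implicit Types (z : V) (t : n.-tuple plane) (f g h : A2) (u v w : V -> R).

Definition bintegrable u := mu.-integrable (@ball_coords R n)
  (fun t => (u (of_real_coords t) * bergman_density lambda (of_real_coords t))%:E).

Definition bint u : R := fine (integral_ball lambda u).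

(** The shape $au - bv + w$ is that of the real part of a complex combination; the imaginary part is
    the case of the coefficient $-b$. *)
Lemma bint_combination (a b : R) u v w : bintegrable u -> bintegrable v -> bintegrable w ->
  bint (fun z => a * u z - b * v z + w z) = a * bint u - b * bint v + bint w.
Proof.
move=> iu iv iw; have mB := @measurable_ball_coords R n.
pose U u t := u (of_real_coords t) * bergman_density lambda (of_real_coords t).
rewrite /bint /integral_ball -/(Rintegral mu ball_coords (U u)) -/(Rintegral mu ball_coords (U v)) -/(Rintegral mu ball_coords (U w)).
have iu' : mu.-integrable ball_coords (EFin \o (fun t => a * U u t)).
  by have := integrableZl mB a iu; apply: eq_integrable => // t _; rewrite /= EFinM.
have iv' : mu.-integrable ball_coords (EFin \o (fun t => b * U v t)).
  by have := integrableZl mB b iv; apply: eq_integrable => // t _; rewrite /= EFinM.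
have iuv : mu.-integrable ball_coords (EFin \o (fun t => a * U u t - b * U v t)).
  by have := integrableB mB iu' iv'; apply: eq_integrable => // t _; rewrite /= EFinB.
rewrite -!RintegralZl// -RintegralB// -RintegralD//.
by apply: eq_Rintegral => t _; rewrite /U; ring.
Qed.

Lemma normc_conj (x : C) : normc x^*%C = normc x.
Proof. by case: x => a b; rewrite /= sqrrN. Qed.

(** The product is dominated by $|f|^2 + |g|^2$. *)
Lemma bintegrable_dot f g : bintegrable (fun z => complex.Re (f z * (g z)^*%C)) /\
  bintegrable (fun z => complex.Im (f z * (g z)^*%C)).
Proof.
have mB := @measurable_ball_coords R n.
have mf := bergman_cmeas f; have mg := bergman_cmeas g.
have isqr h : bintegrable (fun z => normc (h z) ^+ 2).
  apply/integrableP; split.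
    apply/measurable_EFinP; apply: measurable_funM; first exact: cmeas_sqr (bergman_cmeas h).
    exact: measurable_bergman_density.
  have /asboolP[_ _ [_ _ hfin]] := bergmanP h; apply: le_lt_trans hfin.
  rewrite le_eqVlt; apply/orP; left; apply/eqP; apply: eq_integral => t _.
  by rewrite /= ger0_norm// mulr_ge0 ?sqr_ge0 ?bergman_density_ge0.
have ibound := integrableD mB (isqr f) (isqr g).
have [mr mi] := cmeasM mf (cmeas_conj mg).
have le t : normc (f (of_real_coords t) * (g (of_real_coords t))^*%C) <=
    normc (f (of_real_coords t)) ^+ 2 + normc (g (of_real_coords t)) ^+ 2.
  rewrite Normc.normcM normc_conj; move: (normc_ge0 (f (of_real_coords t))) (normc_ge0 (g (of_real_coords t))).
  move: (normc _) (normc _) => x y x0 y0; have := sqr_ge0 (x - y); have := mulr_ge0 x0 y0.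
  by rewrite !expr2; lra.
have aux (x y d : R) : 0 <= d -> `|x| <= y -> `|x * d| <= `|y * d|.
  by move=> d0 xy; rewrite !normrM ler_wpM2r// (le_trans xy)// ler_norm.
split; apply: (le_integrable mB _ _ ibound).
- by apply/measurable_EFinP; apply: measurable_funM => //; exact: measurable_bergman_density.
- move=> t _; rewrite /= lee_fin -mulrDl; apply: aux; first exact: bergman_density_ge0.
  by apply: le_trans (le t); exact: normc_Re.
- by apply/measurable_EFinP; apply: measurable_funM => //; exact: measurable_bergman_density.
- move=> t _; rewrite /= lee_fin -mulrDl; apply: aux; first exact: bergman_density_ge0.
  by apply: le_trans (le t); exact: normc_Im.
Qed.

Lemma eq_bint u v : u =1 v -> bint u = bint v.
Proof. by move=> /funext ->. Qed.

Lemma dot_combination a f g h : dot (a *: f + g) h = a * dot f h + dot g h.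
Proof.
have [fr fi] := bintegrable_dot f h; have [gr gi] := bintegrable_dot g h.
apply: complex_eqP; rewrite ?cReD ?cImD ?cReM ?cImM /=.
  rewrite -!/(bint _) -bint_combination//; apply: eq_bint => z.
  by rewrite -Re_combination mulrA -mulrDl.
rewrite -!/(bint _) -[X in _ + X + _]opprK -mulNr -bint_combination//; apply: eq_bint => z.
by rewrite mulNr opprK -Im_combination mulrA -mulrDl.
Qed.

Lemma dot_conj f g : dot g f = (dot f g)^*%C.
Proof.
apply: complex_eqP => /=; rewrite -!/(bint _).
  by apply: eq_bint => z; case: (f z) (g z) => [a b] [c d] /=; ring.
have [_ fi] := bintegrable_dot f g.
have i0 : bintegrable (fun=> 0).
  by have := integrable0 mu (@ball_coords R n); apply: eq_integrable => [|t _];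
    rewrite ?mul0r//; exact: measurable_ball_coords.
have b0 : bint (fun=> 0) = 0.
  by rewrite /bint /integral_ball integral0_eq// => t _; rewrite mul0r.
transitivity (bint (fun z => 0 * 0 - 1 * complex.Im (f z * (g z)^*%C) + 0)).
  by apply: eq_bint => z; case: (f z) (g z) => [a b] [c d] /=; ring.
by rewrite bint_combination// b0 mul0r mul1r addr0 sub0r.
Qed.

Lemma dotxx f : dot f f = (N f ^+ 2)%:C.
Proof.
apply: complex_eqP => /=.
  rewrite -[RHS]/(fine (N f ^+ 2)%:E) sqr_bergman_norm; apply: eq_bint => z.
  by rewrite sqr_normc_ReIm; case: (f z) => a b /=; ring.
rewrite -/(bint _) (eq_bint (v := fun=> 0)).
  by rewrite /bint /integral_ball integral0_eq// => t _; rewrite mul0r.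
by move=> z; case: (f z) => a b /=; ring.
Qed.

Lemma dotZl a f h : dot (a *: f) h = a * dot f h.
Proof.
rewrite -[a *: f]addr0 dot_combination -[RHS]addr0; congr (_ + _).
by have := dot_combination 1 0 0 h; rewrite scale1r addr0 mul1r -[LHS]addr0 => /addrI.
Qed.

Lemma dotDl f g h : dot (f + g) h = dot f h + dot g h.
Proof. by rewrite -[f]scale1r dot_combination mul1r scale1r. Qed.

Lemma dot0l h : dot 0 h = 0.
Proof. by rewrite -(scale0r 0) dotZl mul0r. Qed.

Lemma dotBl f g h : dot (f - g) h = dot f h - dot g h.
Proof. by rewrite dotDl -scaleN1r dotZl mulN1r. Qed.

Lemma dot_suml (I : Type) (r : seq I) (F : I -> A2) h :
  dot (\sum_(i <- r) F i) h = \sum_(i <- r) dot (F i) h.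
Proof.
by elim: r => [|i r IH]; rewrite ?big_nil ?dot0l// !big_cons dotDl IH.
Qed.

Lemma dotDr f g h : dot f (g + h) = dot f g + dot f h.
Proof. by rewrite dot_conj dotDl [dot f g]dot_conj [dot f h]dot_conj; exact: rmorphD. Qed.

Lemma dotZr a f h : dot f (a *: h) = a^*%C * dot f h.
Proof. by rewrite dot_conj dotZl [dot f h]dot_conj; exact: rmorphM. Qed.

Lemma dotBr f g h : dot f (g - h) = dot f g - dot f h.
Proof. by rewrite dot_conj dotBl [dot f g]dot_conj [dot f h]dot_conj; exact: rmorphB. Qed.

Lemma dot0r h : dot h 0 = 0.
Proof. by rewrite dot_conj dot0l; exact: rmorph0. Qed.

Lemma dot_sumr (I : Type) (r : seq I) (F : I -> A2) h :
  dot h (\sum_(i <- r) F i) = \sum_(i <- r) dot h (F i).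
Proof.
by elim: r => [|i r IH]; rewrite ?big_nil ?dot0r// !big_cons dotDr IH.
Qed.

Lemma sqr_normD f g : N (f + g) ^+ 2 = N f ^+ 2 + N g ^+ 2 + 2 * complex.Re (dot f g).
Proof.
rewrite -[LHS]/(complex.Re (N (f + g) ^+ 2)%:C) -dotxx dotDl !dotDr !dotxx (dot_conj f g).
by case: (dot f g) => a b /=; ring.
Qed.

Lemma normZ a f : N (a *: f) = normc a * N f.
Proof.
apply/eqP; rewrite -(@eqrXn2 _ 2)// ?mulr_ge0 ?normc_ge0 ?bergman_norm_ge0// exprMn.
rewrite -[X in X == _]/(complex.Re (N (a *: f) ^+ 2)%:C) -dotxx dotZl dotZr dotxx mulrA.
by rewrite sqr_normc_ReIm; case: a => a b /=; apply/eqP; ring.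
Qed.

Lemma normN f : N (- f) = N f.
Proof. by rewrite -scaleN1r normZ normcN Normc.normc1 mul1r. Qed.

(** Definiteness is not yet available at this point, so a vector [g] of norm 0 is treated apart: its
    multiples change $\|f\|^2$ only through the inner product, which would make the square negative
    unless it vanishes. Otherwise the norm of $\|g\|^2 f - \langle f,g\rangle g$ is expanded. *)
Lemma cauchy_schwarz f g : normc (dot f g) <= N f * N g.
Proof.
have [g0|gn0] := eqVneq (N g) 0.
  have h (s : R) : 0 <= N f ^+ 2 + s * normc (dot f g) ^+ 2.
    (* With this multiple, $\|f+cg\|^2 = \|f\|^2 + s|\langle f,g\rangle|^2$ for an arbitrary real
       [s]. *)
    set c := (s / 2)%:C * dot f g; have e : N (c *: g) ^+ 2 = 0 by rewrite normZ g0 mulr0 expr0n.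
    have := sqr_ge0 (N (f + c *: g)); rewrite sqr_normD e addr0 dotZr /c.
    move: (dot f g) => d; rewrite (_ : 2 * _ = s * normc d ^+ 2)//.
    by rewrite sqr_normc_ReIm; case: d => a b /=; field.
  rewrite g0 mulr0 leNgt; apply/negP => d0.
  have d2 : 0 < normc (dot f g) ^+ 2 by rewrite exprn_gt0.
  have := h (- (N f ^+ 2 + 1) / normc (dot f g) ^+ 2).
  by rewrite divfK ?gt_eqF//; lra.
have gp : 0 < N g by rewrite lt_def gn0 bergman_norm_ge0.
rewrite -(@ler_pXn2r _ 2)// ?nnegrE ?mulr_ge0 ?normc_ge0 ?bergman_norm_ge0//.
have := sqr_ge0 (N ((N g ^+ 2)%:C *: f + (- dot f g) *: g)).
rewrite sqr_normD !normZ normcN normc_real ger0_norm ?sqr_ge0// dotZl dotZr.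
move: (dot f g) => d; rewrite (_ : 2 * _ = - (2 * (N g ^+ 2 * normc d ^+ 2))); last first.
  by rewrite sqr_normc_ReIm; case: d => a b /=; ring.
rewrite (_ : _ + _ = N g ^+ 2 * ((N f * N g) ^+ 2 - normc d ^+ 2)); last by ring.
by rewrite pmulr_rge0 ?exprn_gt0// subr_ge0.
Qed.

Lemma norm_triangle f g : N (f + g) <= N f + N g.
Proof.
rewrite -(@ler_pXn2r _ 2)// ?nnegrE ?addr_ge0 ?bergman_norm_ge0// sqr_normD.
have := cauchy_schwarz f g; have := le_trans (ler_norm _) (normc_Re (dot f g)).
by move: (complex.Re _) (normc _) => a b; rewrite !expr2; lra.
Qed.

Lemma pythagoras f g : dot f g = 0 -> N (f + g) ^+ 2 = N f ^+ 2 + N g ^+ 2.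
Proof. by move=> h; rewrite sqr_normD h mulr0 addr0. Qed.

Lemma pythagoras_sum (I : eqType) (r : seq I) (F : I -> A2) : uniq r ->
  (forall i j, i != j -> dot (F i) (F j) = 0) ->
  N (\sum_(i <- r) F i) ^+ 2 = \sum_(i <- r) N (F i) ^+ 2.
Proof.
move=> ur h; elim: r ur => [_|i r IH /= /andP[ir ur]].
  by rewrite !big_nil bergman_norm0 expr0n.
rewrite !big_cons pythagoras ?IH// dot_sumr big_seq big1// => j jr; apply: h.
by apply: contraNneq ir => ->.
Qed.

End InnerProduct.

(** * Definiteness and completeness *)

Section Complete.
Context {R : realType} {n : nat} (lambda : R).
Hypothesis lambda_gtN1 : -1 < lambda.
Local Notation C := R[i].
Local Notation V := 'cV[C]_n.
Local Notation plane := (measurableTypeR R * measurableTypeR R)%type.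
Local Notation mu := (lebesgue_Cn R n).
Local Notation A2 := (@bergman R n lambda).
Local Notation N := (@bergman_norm R n lambda).
Local Notation dot := (@bergman_dot R n lambda).
Implicit Types (z : V) (t : n.-tuple plane) (f g h : A2).

Lemma bergman_ext f g : (forall z, unit_ball z -> f z = g z) -> f = g.
Proof.
move=> fg; apply: val_inj; apply/funext => z /=.
by have [/fg//|zB] := pselect (unit_ball z); rewrite !bergman_out.
Qed.

Lemma bergmanB f g z : (f - g) z = f z - g z.
Proof. by []. Qed.

Lemma bergmanZ a f z : (a *: f) z = a * f z.
Proof. by []. Qed.

Lemma bergman_sum (I : Type) (r : seq I) (F : I -> A2) z :
  (\sum_(i <- r) F i) z = \sum_(i <- r) F i z.
Proof. by elim: r => [|i r IH]; rewrite ?big_nil// !big_cons -IH. Qed.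

Lemma bergman_norm_eq0 f : N f = 0 -> f = 0.
Proof.
move=> f0; apply: bergman_ext => z zB.
have [C [rho [rho0 [_ [_ /(_ f z)]]]]] := pointwise_bound lambda_gtN1 zB.
rewrite subrr mnorm0 => /(_ rho0); rewrite f0 expr0n mulr0 => h.
apply: Normc.eq0_normc; apply/eqP.
by rewrite -sqrf_eq0 eq_le h sqr_ge0.
Qed.

Lemma evaluation_bound z : unit_ball z ->
  exists2 C, 0 < C & forall f, normc (f z) <= C * N f.
Proof.
move=> zB; have [C [rho [rho0 [_ [C0 hC]]]]] := pointwise_bound lambda_gtN1 zB.
exists (C + 1) => [|f]; first by rewrite ltr_wpDl.
have zz : mnorm (z - z) < rho by rewrite subrr mnorm0.
rewrite -(@ler_pXn2r _ 2)// ?nnegrE ?normc_ge0 ?mulr_ge0 ?bergman_norm_ge0 ?addr_ge0//.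
apply: le_trans (hC f z zz) _; rewrite exprMn ler_wpM2r ?sqr_ge0// expr2.
by have := mulr_ge0 C0 C0; lra.
Qed.

(** The norm bound passes to the limit by Fatou's lemma. Holomorphy passes by [hol_limit], whose
    local bounds come from the norm bound through [pointwise_bound]. *)
Lemma bergman_limit (f_ : nat -> A2) (F : V -> C) (M : R) :
  (forall z, unit_ball z -> ccvg (fun j => f_ j z) (F z)) ->
  (forall j, N (f_ j) <= M) ->
  exists f : A2, (forall z, unit_ball z -> f z = F z) /\ N f <= M.
Proof.
move=> cF fM; have M0 : 0 <= M by apply: le_trans (bergman_norm_ge0 _) (fM 0%N).
(* Elements of [bergman] have to vanish off the ball, where nothing is known of [F]. *)
pose G z := if `[< unit_ball z >] then F z else 0.
have GE z : unit_ball z -> G z = F z by move=> zB; rewrite /G asboolT.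
have cG t : ball_coords t -> ccvg (fun j => f_ j (of_real_coords t)) (G (of_real_coords t)).
  by move=> tB; rewrite GE//; exact: cF.
have mG : cmeas (@ball_coords R n) (fun t => G (of_real_coords t)).
  by apply: (cmeas_cvg (f_ := fun j t => f_ j (of_real_coords t))) => // j; exact: bergman_cmeas.
have iG : (integral_ball lambda (fun z => (normc (G z) ^+ 2)%R) <= (M ^+ 2)%:E)%E.
  apply: (@fatou_le _ _ _ mu _ (fun j t => normc (f_ j (of_real_coords t)) ^+ 2 *
    bergman_density lambda (of_real_coords t))).
  - exact: measurable_ball_coords.
  - move=> j; apply: measurable_funM; first exact: cmeas_sqr (bergman_cmeas _).
    exact: measurable_bergman_density.
  - by move=> j t _; rewrite mulr_ge0 ?sqr_ge0 ?bergman_density_ge0.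
  - move=> t tB; apply: cvgMl; have /ccvg_ReIm[cr ci] := cG t tB.
    rewrite sqr_normc_ReIm; under eq_fun do rewrite sqr_normc_ReIm.
    by apply: cvgD; rewrite expr2; under eq_fun do rewrite expr2; apply: cvgM.
  - move=> j; rewrite -/(integral_ball lambda (fun z => normc (f_ j z) ^+ 2)) -sqr_bergman_norm.
    by rewrite lee_fin lerXn2r ?nnegrE ?bergman_norm_ge0.
have hG : holomorphic G.
  apply/holomorphic_hol_at => z zB.
  have [C [rho [rho0 [rhoB [C0 hC]]]]] := pointwise_bound lambda_gtN1 zB.
  apply: (@hol_limit _ _ (fun j => f_ j) _ _ rho (Num.sqrt (C * M ^+ 2)) rho0).
  - by move=> j w /rhoB; exact: bergman_hol.
  - move=> j w wr; rewrite -(@ler_pXn2r _ 2)// ?nnegrE ?normc_ge0 ?sqrtr_ge0//.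
    rewrite sqr_sqrtr ?mulr_ge0 ?sqr_ge0//; apply: le_trans (hC _ _ wr) _.
    by rewrite ler_wpM2l// lerXn2r ?nnegrE ?bergman_norm_ge0.
  - by move=> w /rhoB wB; rewrite GE//; exact: cF.
have GP : G \in @bergman_pred R n lambda.
  apply/asboolP; split=> //; first by move=> z zB; rewrite /G asboolF.
  by case: mG => mr mi; split => //; exact: le_lt_trans iG (ltry _).
exists (Bergman GP); split=> [z zB|]; first by rewrite /= GE.
rewrite -(@ler_pXn2r _ 2)// ?nnegrE ?bergman_norm_ge0//.
by rewrite -lee_fin sqr_bergman_norm.
Qed.

Definition ncvg (u : nat -> A2) f :=
  forall e, 0 < e -> exists n0, forall j, (n0 <= j)%N -> N (u j - f) < e.

Lemma normB f g : N (f - g) = N (g - f).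
Proof. by rewrite -normN opprB. Qed.

Lemma norm_small_eq f g : (forall e, 0 < e -> N (f - g) <= e) -> f = g.
Proof.
move=> h; apply/subr0_eq; apply: bergman_norm_eq0; apply/eqP.
rewrite eq_le bergman_norm_ge0 andbT leNgt; apply/negP => p.
have := h _ (divr_gt0 p (ltr0n R 2)); move: (N _) p => x; lra.
Qed.

Lemma ncvg_unique u f g : ncvg u f -> ncvg u g -> f = g.
Proof.
move=> uf ug; apply: norm_small_eq => e e0; have e2 : 0 < e / 2 by rewrite divr_gt0.
have [a ha] := uf _ e2; have [b hb] := ug _ e2; pose j := maxn a b.
rewrite (_ : f - g = (f - u j) + (u j - g)); last by rewrite addrA subrK.
apply: le_trans (norm_triangle _ _) _; rewrite [e]splitr ltW// ltrD//.
  by rewrite normB ha// leq_maxl.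
by rewrite hb// leq_maxr.
Qed.

Lemma ncvg_norm u f (M : R) : ncvg u f -> (forall j, N (u j) <= M) -> N f <= M.
Proof.
move=> uf uM; apply/ler_addgt0Pr => e /uf[j hj].
have -> : f = u j + (f - u j) by rewrite addrC subrK.
apply: le_trans (norm_triangle _ _) _; apply: lerD; first exact: uM.
by rewrite normB ltW// hj.
Qed.

Lemma ncvg_dot u f h : ncvg u f -> ccvg (fun j => dot (u j) h) (dot f h).
Proof.
move=> uf e e0; have h0 : 0 < N h + 1 by rewrite ltr_wpDl ?bergman_norm_ge0.
have [n0 hn] := uf _ (divr_gt0 e0 h0); exists n0 => j /hn; rewrite ltr_pdivlMr// => uj.
rewrite -dotBl; apply: le_lt_trans (cauchy_schwarz _ _) _; apply: le_lt_trans uj.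
by rewrite ler_wpM2l ?bergman_norm_ge0// lerDl.
Qed.

Lemma ncvg_pointwise u f z : unit_ball z -> ncvg u f -> ccvg (fun j => u j z) (f z).
Proof.
move=> zB uf e e0.
have [C C0 hC] := evaluation_bound zB.
have [n0 hn] := uf _ (divr_gt0 e0 C0); exists n0 => j /hn; rewrite ltr_pdivlMr// mulrC.
by apply: le_lt_trans; rewrite -bergmanB.
Qed.

(** [bergman_limit] is used twice: on a tail of [u] it produces the limit, and on the differences
    [u p - u (n0 + j)] it turns the Cauchy condition into convergence in norm. *)
Lemma bergman_complete (u : nat -> A2) :
  (forall e, 0 < e -> exists n0, forall p q, (n0 <= p)%N -> (n0 <= q)%N -> N (u p - u q) < e) ->
  exists f, ncvg u f.
Proof.
move=> cu.
have /choice[F hF] : forall z, exists l, unit_ball z -> ccvg (fun j => u j z) l.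
  move=> z; have [zB|zB] := pselect (unit_ball z); last by exists 0.
  suff [l hl] : exists l, ccvg (fun j => u j z) l by exists l.
  apply: cauchy_ccvg => e e0.
  have [C C0 hC] := evaluation_bound zB.
  have [n0 hn] := cu _ (divr_gt0 e0 C0); exists n0 => p q np nq.
  have := hn p q np nq; rewrite ltr_pdivlMr// mulrC.
  by apply: le_lt_trans; rewrite -bergmanB.
have shift p z : unit_ball z -> ccvg (fun j => u (p + j)%N z) (F z).
  move=> /hF h e /h[n0 hn]; exists n0 => j nj.
  by apply: hn; rewrite (leq_trans nj)// leq_addl.
have [n1 hn1] := cu 1 ltr01.
have [|f [fF _]] := @bergman_limit (fun j => u (n1 + j)%N) F (N (u n1) + 1) (shift n1).
  move=> j; rewrite -[u (n1 + j)%N](subrK (u n1)) addrC.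
  apply: le_trans (norm_triangle _ _) _.
  by rewrite lerD2l ltW// hn1// leq_addr.
exists f => e e0; have e2 : 0 < e / 2 by rewrite divr_gt0.
have [n0 hn0] := cu _ e2; exists n0 => p np.
have [||g [gE gN]] := @bergman_limit (fun j => u p - u (n0 + j)%N) (fun z => u p z - F z) (e / 2).
- by move=> z zB; apply: ccvgB; [exact: ccvg_cst|exact: shift].
- by move=> j; rewrite ltW// hn0// leq_addr.
rewrite (_ : u p - f = g); last first.
  by apply: bergman_ext => z zB; rewrite gE// bergmanB fF.
by apply: le_lt_trans gN _; move: e0; lra.
Qed.

End Complete.

(** * Rotations as isometries, and averages over them *)

Section Rotations.
Context {R : realType} {n : nat} (lambda : R).
Local Notation C := R[i].
Local Notation V := 'cV[C]_n.
Local Notation plane := (measurableTypeR R * measurableTypeR R)%type.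
Local Notation mu := (lebesgue_Cn R n).
Local Notation A2 := (@bergman R n lambda).
Local Notation N := (@bergman_norm R n lambda).
Local Notation dot := (@bergman_dot R n lambda).
Implicit Types (z : V) (t : n.-tuple plane) (f g h : A2).

Section Rotation.
Variable (c : 'I_n -> C).
Hypothesis c1 : forall i, normc (c i) = 1.

Lemma unit_ball_diag_scale z : unit_ball (diag_scale c z) <-> unit_ball z.
Proof. by rewrite /unit_ball /= sqnorm_diag_scale. Qed.

Lemma preimage_rot_coords : rot_coords c @^-1` ball_coords = @ball_coords R n.
Proof.
by apply/seteqP; split => t; rewrite /ball_coords /= rot_coordsE; move/unit_ball_diag_scale.
Qed.

Lemma integral_ball_rotation (u : V -> R) :
  measurable_fun (@ball_coords R n) (fun t => u (of_real_coords t)) ->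
  integral_ball lambda (fun z => u (diag_scale c z)) = integral_ball lambda u.
Proof.
move=> mh; have mB := @measurable_ball_coords R n.
rewrite /integral_ball -[RHS](integral_preserving (measure_preserving_rot_coords c1) mB) /=.
  rewrite preimage_rot_coords; apply: eq_integral => t _.
  by rewrite rot_coordsE /bergman_density sqnorm_diag_scale.
apply/measurable_EFinP; apply: measurable_funM => //; exact: measurable_bergman_density.
Qed.

Lemma hol_at_diag_scale (F : V -> C) z : hol_at F (diag_scale c z) ->
  hol_at (fun w => F (diag_scale c w)) z.
Proof.
move=> [L lL hL]; exists (fun w => L (diag_scale c w)).
  move=> a u v; rewrite -lL; congr (L _); apply/colP => i; rewrite !mxE; ring.
move=> e /hL[d d0 hd]; exists d => // w wd.
have me : mnorm (diag_scale c w) = mnorm w.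
  by apply: eq_bigr => i _; rewrite mxE Normc.normcM c1 mul1r.
have := hd (diag_scale c w); rewrite me => /(_ wd).
by congr (normc (F _ - _ - _) <= _); apply/colP => i; rewrite !mxE mulrDr.
Qed.

Lemma rotation_subproof f : (fun z => f (diag_scale c z)) \in @bergman_pred R n lambda.
Proof.
have [mr mi] : cmeas (@ball_coords R n) (fun t => f (diag_scale c (of_real_coords t))).
  apply: (@eq_cmeas _ _ _ _ (fun t => f (of_real_coords (rot_coords c t)))).
    by move=> t _; rewrite rot_coordsE.
  apply: (cmeas_comp _ _ _ (bergman_cmeas f)); first exact: measurable_ball_coords.
    by have [m _] := measure_preserving_rot_coords c1; exact: measurable_funTS.
  by move=> _ [t tB <-]; rewrite -[ball_coords _]/((rot_coords c @^-1` ball_coords) t) preimage_rot_coords.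
apply/asboolP; split.
- by move=> z zB; rewrite bergman_out// => /unit_ball_diag_scale.
- apply/holomorphic_hol_at => z zB; apply: hol_at_diag_scale; apply: bergman_hol.
  exact/unit_ball_diag_scale.
- split => //.
  rewrite (integral_ball_rotation (u := fun z => normc (f z) ^+ 2)); last exact: cmeas_sqr (bergman_cmeas f).
  by rewrite -sqr_bergman_norm ltry.
Qed.

Definition rotation f : A2 := Bergman (rotation_subproof f).

Lemma rotationE f z : rotation f z = f (diag_scale c z).
Proof. by []. Qed.

Lemma dot_rotation f g : dot (rotation f) (rotation g) = dot f g.
Proof.
have [mr mi] := cmeasM (bergman_cmeas f) (cmeas_conj (bergman_cmeas g)).
rewrite /bergman_dot.
rewrite (integral_ball_rotation (u := fun z => complex.Re (f z * (g z)^*%C)))//.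
by rewrite (integral_ball_rotation (u := fun z => complex.Im (f z * (g z)^*%C))).
Qed.

(** A rotation preserves inner products, so $\langle f,g\rangle = a\bar b\langle f,g\rangle$; since
    $|b| = 1$, the factor is 1 only if $a = b$. *)
Lemma rotation_orthogonal (a b : C) f g : rotation f = a *: f -> rotation g = b *: g ->
  normc b = 1 -> a != b -> dot f g = 0.
Proof.
move=> fa gb b1 ab; have := dot_rotation f g; rewrite fa gb dotZl dotZr mulrA => h.
have bb : b * b^*%C = 1.
  have := sqr_normc_ReIm b; rewrite b1 expr1n; case: (b) => x y /= e.
  by apply: complex_eqP => /=; [rewrite e; ring|ring].
have : (a * b^*%C - 1) * dot f g = 0 by rewrite mulrBl h mul1r subrr.
move/eqP; rewrite mulf_eq0 => /orP[|/eqP//]; rewrite subr_eq0 => /eqP ab1.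
by case/eqP: ab; rewrite -[a]mulr1 -bb [b * _]mulrC mulrA ab1 mul1r.
Qed.

End Rotation.

Lemma normc_rootuX M j : normc (rootu M ^+ j : C) = 1.
Proof. by rewrite normcX normc_rootu expr1n. Qed.

Definition rot_avg M d f : A2 := M%:R^-1 *: \sum_(j < M)
  ((rootu M ^+ j) ^- d) *: rotation (fun=> normc_rootuX M j) f.

Lemma rot_avgE M d f z : rot_avg M d f z = avg M d (fun s => f (s *: z)).
Proof.
rewrite /rot_avg bergmanZ bergman_sum /avg; congr (_ * _); apply: eq_bigr => j _.
by rewrite bergmanZ rotationE diag_scale_cst mulrC.
Qed.

(** Rotating by a primitive root shifts the sum cyclically. *)
Lemma rot_rot_avg M d f : (0 < M)%N ->
  rotation (fun=> normc_rootuX M 1) (rot_avg M d f) = rootu M ^+ d *: rot_avg M d f.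
Proof.
move=> M0; apply: val_inj; apply/funext => z; rewrite -[LHS]/(rotation _ _ z) rotationE -[RHS]/((_ *: _ : A2) z) bergmanZ !rot_avgE /avg.
rewrite diag_scale_cst mulrCA; congr (_ * _); rewrite mulr_sumr.
pose G j := f (rootu M ^+ j *: z) / (rootu M ^+ j) ^+ d.
transitivity (\sum_(j < M) rootu M ^+ d * G j.+1).
  apply: eq_bigr => j _; rewrite /G scalerA -exprSr exprS exprMn mulrCA; congr (_ * _).
  by rewrite invfM mulrA divff ?mul1r// expf_neq0// rootu_neq0.
rewrite -!mulr_sumr; congr (_ * _).
case: M M0 @G => // M _ G; rewrite big_ord_recr [RHS]big_ord_recl /= addrC; congr (_ + _).
by rewrite /G rootuX// expr0.
Qed.

(** Inversion of the discrete Fourier transform: summing over [d] cancels all terms but that of the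
    root 1. *)
Lemma sum_rot_avg M f : (0 < M)%N -> \sum_(d < M) rot_avg M d f = f.
Proof.
move=> M0; apply: val_inj; apply/funext => z; rewrite -[LHS]/((\sum_(d < M) rot_avg M d f : A2) z) bergman_sum.
under eq_bigr do rewrite rot_avgE /avg; rewrite -mulr_sumr exchange_big /=.
rewrite (eq_bigr (fun j : 'I_M => if 0%N == j then f (rootu M ^+ j *: z) * M%:R else 0)).
  rewrite -big_mkcond (big_pred1 (Ordinal M0)) /= => [|j]; last by rewrite eq_sym.
  by rewrite expr0 scale1r mulrCA mulVf ?mulr1// pnatr_eq0 -lt0n.
move=> j _; rewrite -mulr_sumr (_ : \sum_(d < M) _ = if 0%N == j then M%:R else 0).
  by case: ifP; rewrite ?mulr0.
rewrite -(rootu_sum M0 (ltn_ord j)); apply: eq_bigr => d _.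
by rewrite expr0 mul1r -!exprM mulnC.
Qed.

Lemma rootuX_inj M d d' : (d < M)%N -> (d' < M)%N -> d != d' -> rootu M ^+ d != rootu M ^+ d' :> C.
Proof.
wlog dd : d d' / (d < d')%N => [h|] dM d'M.
  by case: ltngtP => // dd _; [|rewrite eq_sym]; apply: h => //; rewrite neq_ltn dd.
move=> _; rewrite -(subnKC (ltnW dd)) exprD -{1}[rootu M ^+ d]mulr1.
rewrite (inj_eq (mulfI _)) ?expf_neq0 ?rootu_neq0// eq_sym rootuX_neq1//.
by rewrite subn_gt0 dd (leq_ltn_trans (leq_subr _ _)).
Qed.

Lemma rot_avg_bessel M D f : (D <= M)%N -> (0 < M)%N -> N (\sum_(d < D) rot_avg M d f) <= N f.
Proof.
move=> DM M0.
have orth d d' : (d < M)%N -> (d' < M)%N -> d != d' -> dot (rot_avg M d f) (rot_avg M d' f) = 0.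
  move=> dM d'M dd'; apply: rotation_orthogonal (rot_rot_avg _ _ M0) (rot_rot_avg _ _ M0) _ _.
    by rewrite normc_rootuX.
  exact: rootuX_inj.
rewrite -(@ler_pXn2r _ 2)// ?nnegrE ?bergman_norm_ge0// -{2}(sum_rot_avg f M0).
rewrite -!(big_mkord xpredT (fun d => rot_avg M d f)) (@big_cat_nat _ _ _ D 0 M)//=.
set A := \sum_(0 <= d < D) _; set B := \sum_(D <= d < M) _.
have AB : dot A B = 0.
  rewrite dot_suml big_nat big1// => d /andP[_ dD].
  rewrite dot_sumr big_nat big1// => d' /andP[Dd' d'M]; apply: orth => //.
    exact: leq_trans dD DM.
  by rewrite neq_ltn (leq_trans dD Dd').
by rewrite (pythagoras AB) lerDl sqr_ge0.
Qed.

End Rotations.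

(** * The homogeneous expansion in norm *)

Section Expansion.
Context {R : realType} {n : nat} (lambda : R).
Hypothesis lambda_gtN1 : -1 < lambda.
Local Notation C := R[i].
Local Notation V := 'cV[C]_n.
Local Notation A2 := (@bergman R n lambda).
Local Notation N := (@bergman_norm R n lambda).
Local Notation dot := (@bergman_dot R n lambda).
Implicit Types (z : V) (f g h : A2).

Lemma bergman_expansion f : exists2 S : nat -> seq (C * {ffun 'I_n -> nat}),
  (forall d p, p \in S d -> mdegree p.2 = d) &
  exists2 F : nat -> A2, (forall d z, unit_ball z -> F d z = polyeval (S d) z) &
    ncvg (fun D => \sum_(d < D) F d) f.
Proof.
have [S Sd hS] := hol_expansion (fun z zB => bergman_hol f zB); exists S => //.
have c_avg d z : unit_ball z -> ccvg (fun M => rot_avg M d f z) (polyeval (S d) z).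
  move=> /hS[r [M [r1 h]]] e e0; have [n0 hn] := @avg_cvg _ d (fun s => f (s *: z)) (fun k => polyeval (S k) z) r M r1 h _ e0.
  by exists n0 => j /hn; rewrite rot_avgE.
(* The order [D + j.+1] exceeds every degree in the sum, as Bessel's inequality requires, and grows
   with [j]. *)
have sum_part D : exists P : A2, (forall z, unit_ball z -> P z = \sum_(d < D) polyeval (S d) z) /\ N P <= N f.
  apply: (bergman_limit lambda_gtN1 (f_ := fun j => \sum_(d < D) rot_avg (D + j.+1) d f)).
    move=> z zB e e0.
    have [n0 hn] := ccvg_sum (index_enum 'I_D) (fun d : 'I_D => c_avg d z zB) e0.
    exists n0 => j nj; rewrite bergman_sum; apply: hn.
    by rewrite (leq_trans nj)// (leq_trans _ (leq_addl _ _)).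
  by move=> j; apply: rot_avg_bessel; rewrite ?leq_addr// addnS.
have /choice[P hP] := sum_part.
(* Each homogeneous part is thus in $A^2$ as a difference of two partial sums. *)
pose F d := P d.+1 - P d.
have FE d z : unit_ball z -> F d z = polyeval (S d) z.
  move=> zB; rewrite bergmanB !(hP _).1// big_ord_recr /=.
  by rewrite addrAC subrr add0r.
have PE D : \sum_(d < D) F d = P D.
  apply: bergman_ext => z zB; rewrite bergman_sum (hP D).1//.
  by apply: eq_bigr => d _; rewrite FE.
exists F => //.
(* A root of unity of order above both degrees gives the two parts different eigenvalues. *)
have orth i j : i != j -> dot (F i) (F j) = 0.
  move=> ij; have ilt : (i < (maxn i j).+1)%N by rewrite ltnS leq_maxl.
  have jlt : (j < (maxn i j).+1)%N by rewrite ltnS leq_maxr.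
  have rF d : rotation (fun=> normc_rootuX (maxn i j).+1 1) (F d) = rootu (maxn i j).+1 ^+ d *: F d.
    apply: bergman_ext => z zB; rewrite rotationE diag_scale_cst bergmanZ !FE//.
      by rewrite (polyevalZ _ _ (Sd d)) expr1.
    by apply: unit_ballZ => //; rewrite normc_rootuX.
  by apply: rotation_orthogonal (rF i) (rF j) (normc_rootuX _ _) _; exact: rootuX_inj.
(* By Pythagoras the squared distances between the [P D] are increments of a bounded nondecreasing
   sequence, so [P] is Cauchy. *)
pose s D := \sum_(0 <= d < D) N (F d) ^+ 2.
have sE D D' : (D <= D')%N -> N (P D' - P D) ^+ 2 = s D' - s D.
  move=> DD; rewrite -!PE -!(big_mkord xpredT (fun d => F d)) /s !(@big_cat_nat _ _ _ D 0 D')//=.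
  rewrite [X in N X](_ : _ = \sum_(D <= d < D') F d); last by rewrite addrAC subrr add0r.
  by rewrite pythagoras_sum ?iota_uniq// addrAC subrr add0r.
have s_nd : {homo s : D D' / (D <= D')%N >-> D <= D'}.
  by move=> D D' /sE h; rewrite -subr_ge0 -h sqr_ge0.
have s_bd D : s D <= N f ^+ 2.
  have := sE 0%N D (leq0n _); rewrite -(PE 0%N) big_ord0 subr0 /s [X in _ - X]big_geq// subr0 => <-.
  by rewrite lerXn2r ?nnegrE ?bergman_norm_ge0// (hP D).2.
have cs : cvgn s by apply: nondecreasing_is_cvgn => //; exists (N f ^+ 2) => _ [D _ <-].
have [g gP] : exists g, ncvg P g.
  apply: (bergman_complete lambda_gtN1) => e e0.
  have e2 : 0 < e ^+ 2 by rewrite exprn_gt0.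
  have /cvgrPdist_lt/(_ _ e2)[n0 _ hn] : s D @[D --> \oo] --> limn s := cs.
  exists n0.
  suff W p q : (p <= q)%N -> (n0 <= p)%N -> N (P q - P p) < e.
    move=> p q np nq; have [pq|/ltnW qp] := leqP p q; last exact: W.
    by rewrite normB W.
  move=> pq np; rewrite -(@ltr_pXn2r _ 2)// ?nnegrE ?bergman_norm_ge0 ?(ltW e0)//.
  rewrite sE//; have := hn p np; have := nondecreasing_cvgn_le s_nd cs q.
  have := nondecreasing_cvgn_le s_nd cs p.
  by move=> sp sq; rewrite /= ger0_norm ?subr_ge0//; apply: le_lt_trans; rewrite lerD2r.
have -> : (fun D => \sum_(d < D) F d) = P by apply/funext => D; rewrite PE.
suff -> : f = g by [].
(* Norm limits are pointwise limits, and the pointwise limit is the expansion on the line through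
   [z], taken at [s = 1]. *)
apply: bergman_ext => z zB; apply: ccvg_unique (ncvg_pointwise lambda_gtN1 zB gP).
have [r [M [r1 h]]] := hS z zB => e e0.
have r0 : 0 < r by exact: lt_trans r1.
have r1' : `|r^-1| < 1 by rewrite ger0_norm ?invr_ge0 ?(ltW r0)// invf_lt1.
have /cvgrPdist_lt/(_ _ e0)[n0 _ hn] : M * r^-1 ^+ K @[K --> \oo] --> M * 0.
  by apply: cvgMr; exact: cvg_expr.
exists n0 => D /hn /=; rewrite mulr0 sub0r normrN => /(le_lt_trans (ler_norm _)).
apply: le_lt_trans; have := h 1 D; rewrite Normc.normc1 => /(_ (lexx _)).
rewrite scale1r (hP D).1// -normcN opprB; congr (normc (_ - _) <= _).
by apply: eq_bigr => d _; rewrite expr1n mulr1.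
Qed.

End Expansion.

(** * Homogeneous components *)

Section Blocks.
Context {R : realType} {m : nat} (k : 'I_m -> nat) (lambda : R).
Hypothesis lambda_gtN1 : -1 < lambda.
Local Notation C := R[i].
Local Notation n := (\sum_(j < m) k j)%N.
Local Notation V := 'cV[C]_n.
Local Notation A2 := (@bergman R n lambda).
Local Notation N := (@bergman_norm R n lambda).
Local Notation dot := (@bergman_dot R n lambda).
Local Notation index := {ffun 'I_m -> nat}.
Implicit Types (z : V) (f g h : A2) (t : 'I_m -> C) (kappa : index).

Definition block_scale t (i : 'I_n) : C := t (tagnat.sig1 i).

Definition torus_character t kappa : C := \prod_j t j ^+ kappa j.

Lemma normc_block_scale t : (forall j, normc (t j) = 1) ->
  forall i, normc (block_scale t i) = 1.
Proof. by move=> t1 i; exact: t1. Qed.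

Lemma normc_torus_character t kappa : (forall j, normc (t j) = 1) ->
  normc (torus_character t kappa) = 1.
Proof.
by move=> t1; rewrite normc_prod big1// => j _; rewrite normcX t1 expr1n.
Qed.

Lemma mono_block_scale t alpha z : mono alpha (diag_scale (block_scale t) z) =
  torus_character t (block_degree alpha) * mono alpha z.
Proof.
rewrite /mono /torus_character.
under eq_bigr do rewrite mxE exprMn.
rewrite big_split /=; congr (_ * _); rewrite (partition_big (@tagnat.sig1 _ k) predT)//=.
apply: eq_bigr => j _; rewrite ffunE -prodrXr; apply: eq_bigr => i /eqP ij.
by rewrite /block_scale ij.
Qed.

Lemma hpolyP' kappa f : f \in hpoly_pred k lambda kappa <->
  exists2 s : seq (C * {ffun 'I_n -> nat}), (forall p, p \in s -> block_degree p.2 = kappa) &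
    forall z, unit_ball z -> f z = polyeval s z.
Proof. by split=> [/asboolP|h]; [|apply/asboolP]. Qed.

Lemma hpoly_diag_scale kappa f t z : f \in hpoly_pred k lambda kappa ->
  (forall j, normc (t j) = 1) ->
  f (diag_scale (block_scale t) z) = torus_character t kappa * f z.
Proof.
move=> /hpolyP'[s sk sE] t1; have c1 := normc_block_scale t1.
have [zB|zB] := pselect (unit_ball z); last first.
  by rewrite !bergman_out ?mulr0// => /(unit_ball_diag_scale c1).
rewrite !sE//; last exact/unit_ball_diag_scale.
rewrite /polyeval mulr_sumr; apply: eq_big_seq => p ps.
by rewrite mono_block_scale (sk _ ps) mulrCA.
Qed.

Lemma rotation_hpoly kappa f t (t1 : forall j, normc (t j) = 1) : f \in hpoly_pred k lambda kappa ->
  rotation (normc_block_scale t1) f = torus_character t kappa *: f.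
Proof.
by move=> fk; apply: bergman_ext => z zB; rewrite rotationE bergmanZ (hpoly_diag_scale _ fk).
Qed.

Definition single_block (j : 'I_m) (s : C) : 'I_m -> C := fun j' => if j' == j then s else 1.

Lemma torus_character_single j s kappa : torus_character (single_block j s) kappa = s ^+ kappa j.
Proof.
rewrite /torus_character (bigD1 j)//= /single_block eqxx big1 ?mulr1// => j' /negPf ->.
exact: expr1n.
Qed.

Lemma normc_single_block j s : normc s = 1 -> forall j', normc (single_block j s j') = 1.
Proof. by move=> s1 j'; rewrite /single_block; case: eqP => // _; exact: Normc.normc1. Qed.

Lemma character_separation kappa kappa' : kappa != kappa' -> exists2 t,
  (forall j, normc (t j) = 1) & torus_character t kappa != torus_character t kappa'.
Proof.
move=> kk; have [j kj] : exists j, kappa j != kappa' j.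
  apply/existsP; rewrite -negb_forall; apply: contra kk => /forallP h.
  by apply/eqP/ffunP => j; apply/eqP/h.
(* Only a block where the indices differ is rotated, by a root of unity of order above both
   entries. *)
exists (single_block j (rootu (maxn (kappa j) (kappa' j)).+1)).
  by apply: normc_single_block; exact: normc_rootu.
rewrite !torus_character_single; apply: rootuX_inj => //.
  by rewrite ltnS leq_maxl.
by rewrite ltnS leq_maxr.
Qed.

Lemma hpoly_orthogonal kappa kappa' f g : kappa != kappa' ->
  f \in hpoly_pred k lambda kappa -> g \in hpoly_pred k lambda kappa' -> dot f g = 0.
Proof.
move=> /character_separation[t t1 tk] fk gk.
by apply: rotation_orthogonal (rotation_hpoly t1 fk) (rotation_hpoly t1 gk) _ tk; exact: normc_torus_character.
Qed.

(** Averaging over rotations of the block [j] by [M]-th roots of unity, with [M] above [e] and above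
    every degree that occurs, keeps exactly the terms of degree [e] in that block. The result is a
    combination of rotations of [g], hence in $A^2$. *)
Lemma block_part j e s g : (forall z, unit_ball z -> g z = polyeval s z) ->
  exists g' : A2, forall z, unit_ball z ->
    g' z = polyeval [seq p <- s | block_degree p.2 j == e] z.
Proof.
move=> gE; pose M := (maxn e (\max_(p <- s) block_degree p.2 j)).+1.
have s1 l := normc_block_scale (normc_single_block j (normc_rootuX M l)).
exists (M%:R^-1 *: \sum_(l < M) (rootu M ^+ l) ^- e *: rotation (s1 l) g) => z zB.
rewrite bergmanZ bergman_sum.
transitivity (M%:R^-1 * \sum_(l < M) \sum_(p <- s)
    (p.1 * mono p.2 z) * ((rootu M ^+ l) ^+ block_degree p.2 j / (rootu M ^+ l) ^+ e)).
  congr (_ * _); apply: eq_bigr => l _; rewrite bergmanZ rotationE gE; last exact/unit_ball_diag_scale.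
  rewrite /polyeval mulr_sumr; apply: eq_bigr => p _.
  rewrite mono_block_scale torus_character_single [LHS]mulrC [RHS]mulrA; congr (_ * _).
  by rewrite -mulrA; congr (_ * _); exact: mulrC.
rewrite exchange_big mulr_sumr /polyeval big_filter [RHS]big_mkcond; apply: eq_big_seq => p ps /=.
rewrite -mulr_sumr rootu_sum; last 2 first.
- rewrite ltnS leq_max; apply/orP; right.
  exact: (@leq_bigmax_seq _ _ xpredT (fun q => block_degree q.2 j) p ps).
- by rewrite ltnS leq_maxl.
by case: eqP => _; rewrite ?mulr0// mulrCA mulVf ?mulr1// pnatr_eq0.
Qed.

Lemma hpoly_part kappa s g : (forall z, unit_ball z -> g z = polyeval s z) ->
  exists g' : A2, forall z, unit_ball z ->
    g' z = polyeval [seq p <- s | block_degree p.2 == kappa] z.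
Proof.
move=> gE.
have [g' hg'] : exists g' : A2, forall z, unit_ball z -> g' z =
    polyeval [seq p <- s | all (fun j => block_degree p.2 j == kappa j) (enum 'I_m)] z.
  elim: (enum 'I_m) => [|j js [h hE]]; first by exists g => z zB; rewrite filter_predT gE.
  have [g' g'E] := block_part j (kappa j) hE; exists g' => z zB.
  by rewrite g'E// -filter_predI.
exists g' => z zB; rewrite hg'//; congr polyeval; apply: eq_filter => p.
apply/allP/eqP => [h|-> //]; apply/ffunP => j; apply/eqP/h; exact: mem_enum.
Qed.

Definition indices D : seq index :=
  [seq kappa : index <- [seq [ffun j => nat_of_ord (u j)] | u : {ffun 'I_m -> 'I_D}] | (\sum_j kappa j < D)%N].

Lemma indices_uniq D : uniq (indices D).
Proof.
apply: filter_uniq; rewrite map_inj_uniq ?enum_uniq// => u v /ffunP uv.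
by apply/ffunP => j; apply: val_inj; have := uv j; rewrite !ffunE.
Qed.

Lemma mem_indices D kappa : (kappa \in indices D) = (\sum_j kappa j < D)%N.
Proof.
rewrite mem_filter; have [kD|//] := boolP (_ < D)%N; rewrite andTb.
have kj j : (kappa j < D)%N by apply: leq_ltn_trans kD; rewrite (bigD1 j)//= leq_addr.
apply/mapP; exists [ffun j => Ordinal (kj j)]; first by rewrite mem_enum.
by apply/ffunP => j; rewrite !ffunE.
Qed.

Lemma sum_block_degree (alpha : {ffun 'I_n -> nat}) : (\sum_j block_degree alpha j)%N = mdegree alpha.
Proof.
rewrite /mdegree (partition_big (@tagnat.sig1 _ k) predT)//=.
by apply: eq_bigr => j _; rewrite ffunE.
Qed.

(** Each homogeneous part is split by block degree. Since block degrees add up to the total degree,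
    the sum over [indices D] regroups the first [D] homogeneous parts, and convergence carries over
    from [bergman_expansion]. *)
Lemma hpoly_decomposition f : exists2 p : index -> A2,
  forall kappa, p kappa \in hpoly_pred k lambda kappa &
  ncvg (fun D => \sum_(kappa <- indices D) p kappa) f.
Proof.
have [S Sd [F FE cF]] := bergman_expansion lambda_gtN1 f.
pose S' kappa := [seq p <- S (\sum_j kappa j)%N | block_degree p.2 == kappa].
have /choice[p hp] : forall kappa, exists g : A2, forall z, unit_ball z -> g z = polyeval (S' kappa) z.
  by move=> kappa; exact: hpoly_part (FE _).
exists p.
  move=> kappa; apply/hpolyP'; exists (S' kappa); last exact: hp.
  by move=> q; rewrite /S' mem_filter => /andP[/eqP].
suff -> : (fun D => \sum_(kappa <- indices D) p kappa) = (fun D => \sum_(d < D) F d) by [].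
apply/funext => D; apply: bergman_ext => z zB; rewrite !bergman_sum.
under [RHS]eq_bigr do rewrite FE// /polyeval.
transitivity (\sum_(kappa <- indices D) \sum_(d < D) \sum_(q <- S d | block_degree q.2 == kappa) q.1 * mono q.2 z).
  apply: eq_big_seq => kappa; rewrite mem_indices => kD.
  rewrite hp// /polyeval /S' big_filter (bigD1 (Ordinal kD))//= [X in _ + X]big1 ?addr0// => d dk.
  rewrite big_seq_cond big_pred0// => q; apply/negP => /andP[qS /eqP qk].
  case/eqP: dk; apply: val_inj => /=.
  by rewrite -(Sd _ _ qS) -sum_block_degree qk.
rewrite exchange_big; apply: eq_bigr => d _.
under eq_bigr do rewrite big_mkcond; rewrite exchange_big; apply: eq_big_seq => q qS /=.
rewrite -big_mkcond -big_filter (eq_filter (a2 := pred1 (block_degree q.2))); last first.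
  by move=> kappa; rewrite /= eq_sym.
rewrite filter_pred1_uniq ?indices_uniq ?big_seq1// mem_indices sum_block_degree.
by rewrite (Sd _ _ qS).
Qed.

End Blocks.

(** * Orthogonal projections onto the spaces of homogeneous polynomials *)

Section Projection.
Context {R : realType} {m : nat} (k : 'I_m -> nat) (lambda : R).
Hypothesis lambda_gtN1 : -1 < lambda.
Local Notation C := R[i].
Local Notation n := (\sum_(j < m) k j)%N.
Local Notation A2 := (@bergman R n lambda).
Local Notation N := (@bergman_norm R n lambda).
Local Notation dot := (@bergman_dot R n lambda).
Local Notation index := {ffun 'I_m -> nat}.
Local Notation hpolys := (hpoly_pred k lambda).
Implicit Types (f g h q : A2) (t : 'I_m -> C) (kappa : index) (p : index -> A2).

(** The components come from the decomposition by choice; [dot_hproj] and [hproj_unique] then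
    characterize them as orthogonal projections, and linearity follows from that. *)
Definition hproj f : index -> A2 := s2val (cid2 (hpoly_decomposition lambda_gtN1 f)).

Lemma hproj_hpoly f kappa : hproj f kappa \in hpolys kappa.
Proof. exact: (s2valP (cid2 (hpoly_decomposition lambda_gtN1 f))). Qed.

Definition partial p D := \sum_(kappa <- indices D) p kappa.

Lemma hproj_cvg f : ncvg (partial (hproj f)) f.
Proof. exact: (s2valP' (cid2 (hpoly_decomposition lambda_gtN1 f))). Qed.

Section Family.
Variable p : index -> A2.
Hypothesis ph : forall kappa, p kappa \in hpolys kappa.

Lemma dot_partial kappa q D : q \in hpolys kappa -> (\sum_j kappa j < D)%N ->
  dot (partial p D) q = dot (p kappa) q.
Proof.
move=> qk kD; rewrite /partial dot_suml (bigD1_seq kappa) ?indices_uniq ?mem_indices//=.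
by rewrite [X in _ + X]big1 ?addr0// => kappa' kk; exact: hpoly_orthogonal kk (ph _) qk.
Qed.

Lemma dot_ncvg f kappa q : ncvg (partial p) f -> q \in hpolys kappa ->
  dot f q = dot (p kappa) q.
Proof.
move=> pf qk; apply: ccvg_unique (ncvg_dot q pf) _.
apply: eq_ccvg (ccvg_cst _); exists (\sum_j kappa j).+1%N => D kD.
by rewrite (dot_partial qk).
Qed.

Lemma partialB D D' : (D <= D')%N -> partial p D' - partial p D =
  \sum_(kappa <- [seq kappa <- indices D' | kappa \notin indices D]) p kappa.
Proof.
move=> DD; have perm : perm_eq [seq kappa : index <- indices D' | kappa \in indices D] (indices D).
  apply: uniq_perm => [||kappa]; [by rewrite filter_uniq ?indices_uniq|exact: indices_uniq|].
  rewrite mem_filter andb_idr// !mem_indices => kD.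
  exact: leq_trans kD DD.
have e : \sum_(kappa <- indices D' | kappa \in indices D) p kappa = partial p D.
  by rewrite -[LHS]big_filter; exact: perm_big.
by rewrite {1}/partial [X in X - _](bigID (mem (indices D)))/= e addrAC subrr add0r [RHS]big_filter.
Qed.

Lemma sqr_norm_hpolys (s : seq index) : uniq s ->
  N (\sum_(kappa <- s) p kappa) ^+ 2 = \sum_(kappa <- s) N (p kappa) ^+ 2.
Proof.
move=> us; apply: pythagoras_sum => // i j ij; exact: hpoly_orthogonal ij (ph i) (ph j).
Qed.

End Family.

Lemma dot_hproj f q kappa : q \in hpolys kappa -> dot f q = dot (hproj f kappa) q.
Proof. by move=> qk; rewrite (dot_ncvg (hproj_hpoly f) (hproj_cvg f) qk). Qed.

Lemma hproj_unique f g kappa : g \in hpolys kappa ->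
  (forall q, q \in hpolys kappa -> dot f q = dot g q) -> hproj f kappa = g.
Proof.
move=> gk h; apply/subr0_eq; set d := _ - _.
have dk : d \in hpolys kappa by rewrite rpredB ?hproj_hpoly.
have : dot d d = 0 by rewrite {1}/d dotBl -dot_hproj// h// subrr.
rewrite dotxx => /(congr1 (@complex.Re R))/eqP; rewrite /= sqrf_eq0 => /eqP.
exact: (bergman_norm_eq0 lambda_gtN1).
Qed.

Lemma hproj_combination a f g kappa :
  hproj (a *: f + g) kappa = a *: hproj f kappa + hproj g kappa.
Proof.
apply: hproj_unique => [|q qk]; first by rewrite rpredD ?rpredZ ?hproj_hpoly.
by rewrite !dot_combination (dot_hproj f qk) (dot_hproj g qk).
Qed.

Lemma hproj_ext f g : (forall kappa, hproj f kappa = hproj g kappa) -> f = g.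
Proof.
move=> fg; apply: (ncvg_unique lambda_gtN1 (hproj_cvg f)).
by rewrite (_ : hproj f = hproj g); [exact: hproj_cvg|exact/funext].
Qed.

Lemma hproj_id f kappa : f \in hpolys kappa -> hproj f kappa = f.
Proof. by move=> fk; exact: hproj_unique. Qed.

Lemma hproj_other f kappa kappa' : f \in hpolys kappa -> kappa != kappa' ->
  hproj f kappa' = 0.
Proof.
move=> fk kk; apply: hproj_unique => [|q qk]; first exact: rpred0.
by rewrite dot0l; exact: hpoly_orthogonal kk fk qk.
Qed.

Lemma hproj_supported f kappa : (forall kappa', kappa != kappa' -> hproj f kappa' = 0) ->
  f \in hpolys kappa.
Proof.
move=> h; suff -> : f = hproj f kappa by exact: hproj_hpoly.
apply: hproj_ext => kappa'; have [<-|kk] := eqVneq kappa kappa'.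
  by rewrite (hproj_id (hproj_hpoly f kappa)).
by rewrite h// (hproj_other (hproj_hpoly f kappa)).
Qed.

Lemma hproj_homogeneous f kappa :
  (forall t (t1 : forall j, normc (t j) = 1),
    rotation (normc_block_scale (k := k) t1) f = torus_character t kappa *: f) ->
  f \in hpolys kappa.
Proof.
move=> h; apply: hproj_supported => kappa' kk.
have [t t1 tk] := character_separation (R := R) kk.
apply: hproj_unique => [|q qk]; first exact: rpred0.
rewrite dot0l; apply: rotation_orthogonal (h t t1) (rotation_hpoly t1 qk) _ tk.
by rewrite normc_torus_character.
Qed.

Lemma hproj_rotation t (t1 : forall j, normc (t j) = 1) f kappa :
  hproj (rotation (normc_block_scale (k := k) t1) f) kappa = torus_character t kappa *: hproj f kappa.
Proof.
rewrite -(rotation_hpoly t1 (hproj_hpoly f kappa)); apply: hproj_unique => [|q qk].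
  by rewrite (rotation_hpoly t1 (hproj_hpoly f kappa)) rpredZ ?hproj_hpoly.
have c0 : torus_character t kappa != 0.
  by rewrite -normc_gt0 normc_torus_character// ltr01.
(* Writing [q] as a rotated element of its own space allows the rotation to be removed from both
   arguments of the inner product. *)
have -> : q = rotation (normc_block_scale (k := k) t1) ((torus_character t kappa)^-1 *: q).
  by rewrite (rotation_hpoly (kappa := kappa)) ?rpredZ// scalerA divff// scale1r.
by rewrite !dot_rotation; apply: dot_hproj; rewrite rpredZ.
Qed.

Lemma norm_partial_hproj f D : N (partial (hproj f) D) <= N f.
Proof.
set P := partial _ _.
have fP : dot (f - P) P = 0.
  rewrite dotBl dotxx {2}/P sqr_norm_hpolys ?indices_uniq//; last exact: hproj_hpoly.
  rewrite {1}/P /partial dot_sumr rmorph_sum -sumrB; apply: big1 => kappa _.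
  by rewrite (dot_hproj f (hproj_hpoly f kappa)) dotxx subrr.
rewrite -(@ler_pXn2r _ 2)// ?nnegrE ?bergman_norm_ge0//.
by rewrite -[X in _ <= N X ^+ 2](subrK P) (pythagoras fP) lerDr sqr_ge0.
Qed.

(** By Pythagoras, finite sums of the [p kappa] are dominated by [M] times the corresponding sums
    for [f], so the series is Cauchy. This both assembles an operator from a family and bounds an
    operator by its restrictions. *)
Lemma hpoly_series (p : index -> A2) (M : R) f : 0 <= M ->
  (forall kappa, p kappa \in hpolys kappa) ->
  (forall kappa, N (p kappa) <= M * N (hproj f kappa)) ->
  exists g, (forall kappa, hproj g kappa = p kappa) /\ N g <= M * N f.
Proof.
move=> M0 ph pM.
have le_sum (s : seq index) : uniq s ->
    N (\sum_(kappa <- s) p kappa) <= M * N (\sum_(kappa <- s) hproj f kappa).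
  move=> us; rewrite -(@ler_pXn2r _ 2)// ?nnegrE ?mulr_ge0 ?bergman_norm_ge0// exprMn.
  rewrite (sqr_norm_hpolys ph us) (sqr_norm_hpolys (hproj_hpoly f) us).
  rewrite mulr_sumr; apply: ler_sum => kappa _; rewrite -exprMn.
  by rewrite lerXn2r ?nnegrE ?mulr_ge0 ?bergman_norm_ge0.
have [g gP] : exists g, ncvg (partial p) g.
  apply: (bergman_complete lambda_gtN1) => e e0; have M1 : 0 < M + 1 by rewrite ltr_wpDl.
  have e2 : 0 < e / (M + 1) / 2 by rewrite !divr_gt0.
  have [n0 hn] := hproj_cvg f e2; exists n0.
  suff W i j : (i <= j)%N -> (n0 <= i)%N -> N (partial p j - partial p i) < e.
    move=> i j ni nj; have [ij|/ltnW ji] := leqP i j; last exact: W.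
    by rewrite normB W.
  move=> ij ni; rewrite partialB//; apply: le_lt_trans (le_sum _ _) _.
    by rewrite filter_uniq// indices_uniq.
  rewrite -partialB//.
  have : N (partial (hproj f) j - partial (hproj f) i) < e / (M + 1).
    rewrite (_ : _ - _ = (partial (hproj f) j - f) - (partial (hproj f) i - f)).
      apply: le_lt_trans (norm_triangle _ _) _; rewrite normN [ltRHS]splitr.
      by apply: ltrD; apply: hn => //; exact: leq_trans ni ij.
    by rewrite opprB addrA subrK.
  rewrite ltr_pdivlMr//; apply: le_lt_trans; rewrite mulrC ler_wpM2l ?bergman_norm_ge0//.
  by rewrite lerDl.
exists g; split.
  by move=> kappa; apply: hproj_unique => // q; exact: dot_ncvg.
apply: (ncvg_norm gP) => D; apply: le_trans (le_sum _ (indices_uniq D)) _.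
by rewrite ler_wpM2l// norm_partial_hproj.
Qed.

End Projection.

(** * Operators commuting with the torus *)

Section OperatorNorm.
Context (R : realType) (U : lmodType R[i]) (N : U -> R).
Hypothesis N_ge0 : forall u, 0 <= N u.
Hypothesis NZ : forall a u, N (a *: u) = normc a * N u.
Variable T : {linear U -> U}.

Lemma opnorm_le (M : R) : 0 <= M -> bounded_by N M T -> opnorm N T <= M.
Proof.
move=> M0 bT; apply: ge_sup.
  by exists (N (T 0)), 0 => //=; rewrite -(scale0r 0) NZ Normc.normc0 mul0r.
by move=> _ [u /= u1 <-]; apply: le_trans (bT u) _; rewrite ler_piMr.
Qed.

(** Some bound has to be known beforehand, since [sup] has a default value on unbounded sets. *)
Lemma opnorm_bounded (M : R) : bounded_by N M T ->
  0 <= opnorm N T /\ bounded_by N (opnorm N T) T.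
Proof.
move=> bT.
have ub u : N u <= 1 -> N (T u) <= opnorm N T.
  move=> u1; apply: ub_le_sup; last by exists u.
  exists (Num.max M 0) => _ [v /= v1 <-]; apply: le_trans (bT v) _.
  apply: (@le_trans _ _ (Num.max M 0 * N v)); first by rewrite ler_wpM2r// le_max lexx.
  by rewrite ler_piMr// le_max lexx orbT.
split; first by apply: le_trans (ub 0 _); rewrite // -(scale0r 0) NZ Normc.normc0 mul0r.
move=> u; have [u0|un0] := eqVneq (N u) 0.
  by have := bT u; rewrite u0 !mulr0.
have up : 0 < N u by rewrite lt_def un0 N_ge0.
have h : normc ((N u)^-1)%:C = (N u)^-1 by rewrite normc_real ger0_norm ?invr_ge0.
have := ub (((N u)^-1)%:C *: u); rewrite linearZ /= !NZ h mulVf// => /(_ (lexx _)).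
by rewrite mulrC ler_pdivrMr.
Qed.

End OperatorNorm.

Lemma linear_exists (R : realType) (U V : lmodType R[i]) (f : U -> V) : linear f ->
  exists g : {linear U -> V}, g =1 f.
Proof.
move=> lf; pose L := GRing.isLinear.Build R[i] U V *:%R f lf.
by exists (HB.pack_for {linear U -> V} f L).
Qed.

Section TorusAction.
Context {R : realType} {m : nat} (k : 'I_m -> nat).
Local Notation C := R[i].
Local Notation n := (\sum_(j < m) k j)%N.
Implicit Types (t : 'I_m -> C) (z : 'cV[C]_n).

Definition torus t : 'M[C]_n := \mxdiag_(j < m) ((t j)%:M : 'M[C]_(k j)).

Lemma torus_mul t z : torus t *m z = diag_scale (block_scale t) z.
Proof.
rewrite -[z in LHS]submxcolK mul_mxdiag_mxcol; apply/colP => i.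
by rewrite [LHS]mxE mul_scalar_mx !mxE /block_scale tagnat.sig2K.
Qed.

Lemma torus_invmx t z : (forall j, normc (t j) = 1) ->
  invmx (torus t) *m z = diag_scale (block_scale (fun j => (t j)^-1)) z.
Proof.
move=> t1; have t0 j : t j != 0 by rewrite -normc_gt0 t1 ltr01.
have tK : torus t *m torus (fun j => (t j)^-1) = 1%:M.
  suff e j : col j (torus t *m torus (fun j => (t j)^-1)) = col j 1%:M.
    apply/matrixP => i j; have := congr1 (fun c : 'cV_n => c i 0) (e j).
    by rewrite [col j _ _ _]mxE [col j 1%:M _ _]mxE.
  rewrite !colE -mulmxA mul1mx !torus_mul.
  by apply/colP => i; rewrite !mxE /block_scale mulrA mulfV ?mul1r ?t0.
have [tU _] := mulmx1_unit tK.
by rewrite -torus_mul -[torus _ in RHS](mulKmx tU) tK mulmx1.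
Qed.

Lemma normc_abs (x : C) : (`|x| = 1) <-> (normc x = 1).
Proof.
rewrite normcE_C; split=> [h|->//].
by have := congr1 (@complex.Re R) h.
Qed.

End TorusAction.

(** * Equivariant operators and their families of restrictions *)

Section Isomorphism.
Context {R : realType} {m : nat} (k : 'I_m -> nat) (lambda : R).
Hypothesis lambda_gtN1 : -1 < lambda.
Local Notation C := R[i].
Local Notation n := (\sum_(j < m) k j)%N.
Local Notation A2 := (@bergman R n lambda).
Local Notation N := (@bergman_norm R n lambda).
Local Notation dot := (@bergman_dot R n lambda).
Local Notation index := {ffun 'I_m -> nat}.
Local Notation hpolys := (hpoly_pred k lambda).
Local Notation End := (endomorphism lambda (block_torus R k)).
Local Notation hproj := (hproj (k := k) lambda_gtN1).
Implicit Types (f g q : A2) (kappa : index) (T : End) (S : direct_sum k lambda).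

Lemma normcV1 (t : 'I_m -> C) : (forall j, normc (t j) = 1) -> forall j, normc ((t j)^-1) = 1.
Proof. by move=> t1 j; rewrite Normc.normcV t1 invr1. Qed.

Lemma unitary_action_torus (t : 'I_m -> C) (t1 : forall j, normc (t j) = 1) f g :
  unitary_action (torus k t) f g <-> g = rotation (normc_block_scale (k := k) (normcV1 t1)) f.
Proof.
split=> [h|->] => [|z]; last by rewrite rotationE torus_invmx.
by apply: bergman_ext => z _; rewrite h rotationE torus_invmx.
Qed.

Lemma block_torusP (A : 'M[C]_n) : block_torus R k A <->
  exists t, (forall j, normc (t j) = 1) /\ A = torus k t.
Proof.
by split=> -[t [t1 ->]]; exists t; split=> // j; apply/normc_abs.
Qed.

(** The representation composes with the inverse matrix, so the rotation by [t] is the action of the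
    torus element $t^{-1}$; [tVV] undoes the double inversion. *)
Lemma endomorphism_rotation T (t : 'I_m -> C) (t1 : forall j, normc (t j) = 1) f :
  T (rotation (normc_block_scale (k := k) t1) f) = rotation (normc_block_scale (k := k) t1) (T f).
Proof.
have /asboolP[_ /(_ (torus k (fun j => (t j)^-1)))cT] := endomorphismP T.
have V1 := normcV1 t1.
have c u := @unitary_action_torus _ V1 u.
have tVV (u : A2) : rotation (normc_block_scale (k := k) (normcV1 V1)) u = rotation (normc_block_scale (k := k) t1) u.
  apply: bergman_ext => z _; rewrite !rotationE; congr (u _).
  by apply/colP => i; rewrite !mxE /block_scale invrK.
have := cT _ f _ ((c _ _).2 erefl); rewrite tVV => /(_ _)/(c _ _).1; rewrite tVV; apply.
by apply/block_torusP; exists (fun j => (t j)^-1).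
Qed.

Lemma endomorphism_hpoly T kappa f : f \in hpolys kappa -> T f \in hpolys kappa.
Proof.
move=> fk; apply: (hproj_homogeneous lambda_gtN1) => t t1.
by rewrite -endomorphism_rotation (rotation_hpoly t1 fk) linearZ.
Qed.

Lemma endomorphism_bounded T : exists2 M, 0 <= M & bounded_by N M T.
Proof.
have /asboolP[[M bT] _] := endomorphismP T.
exists (Num.max M 0); first by rewrite le_max lexx orbT.
by move=> f; apply: le_trans (bT f) _; rewrite ler_wpM2r ?bergman_norm_ge0// le_max lexx.
Qed.

Lemma endomorphism_partial T (p : index -> A2) D : T (partial p D) = partial (T \o p) D.
Proof. by rewrite /partial linear_sum. Qed.

Lemma endomorphism_ncvg T (u : nat -> A2) f : ncvg u f -> ncvg (T \o u) (T f).
Proof.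
move=> uf e e0; have [M M0 bT] := endomorphism_bounded T.
have M1 : 0 < M + 1 by rewrite ltr_wpDl.
have [n0 hn] := uf _ (divr_gt0 e0 M1); exists n0 => j /hn; rewrite ltr_pdivlMr//.
apply: le_lt_trans; rewrite -linearB; apply: le_trans (bT _) _.
by rewrite mulrC ler_wpM2l ?bergman_norm_ge0// lerDl.
Qed.

(** Applied termwise to the decomposition of [f], the continuous operator [T] yields a decomposition
    of [T f] with each term still in its own space. *)
Lemma hproj_endomorphism T f kappa : hproj (T f) kappa = T (hproj f kappa).
Proof.
have Th kappa' := endomorphism_hpoly T (hproj_hpoly lambda_gtN1 f kappa').
apply: hproj_unique (Th kappa) _ => q qk.
apply: (dot_ncvg (p := T \o hproj f) Th _ qk).
rewrite (_ : partial _ = T \o partial (hproj f)).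
  exact: endomorphism_ncvg (hproj_cvg lambda_gtN1 f).
by apply/funext => D /=; rewrite endomorphism_partial.
Qed.

(** A relation is used so that the map and its inverse can both be chosen from it: [restricts_total]
    and [restricts_surj] give existence, [restricts_fun] and [restricts_inj] show that the choices
    are inverse to each other. *)
Definition restricts T S := forall kappa (p : hpoly k lambda kappa),
  hpoly_val (component S kappa p) = T (hpoly_val p).

Lemma endomorphism_ext (T T' : End) : (forall f, T f = T' f) -> T = T'.
Proof. by move=> h; apply: val_inj; exact: linear_ext. Qed.

Lemma direct_sum_ext S S' : (forall kappa p, component S kappa p = component S' kappa p) -> S = S'.
Proof.
move=> h; apply: val_inj; apply: functional_extensionality_dep => kappa.
by apply: linear_ext => p; exact: h.
Qed.

Lemma restricts_fun T S S' : restricts T S -> restricts T S' -> S = S'.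
Proof.
by move=> h h'; apply: direct_sum_ext => kappa p; apply: val_inj; rewrite /= h h'.
Qed.

Lemma restricts_inj T T' S : restricts T S -> restricts T' S -> T = T'.
Proof.
move=> h h'; apply: endomorphism_ext => f; apply: (@hproj_ext R m k lambda lambda_gtN1 (T f) (T' f)) => kappa.
rewrite !hproj_endomorphism.
by rewrite -[hproj f kappa]/(hpoly_val (Hpoly (hproj_hpoly lambda_gtN1 f kappa))) -h -h'.
Qed.

Lemma restricts_total T : exists S, restricts T S.
Proof.
have [M M0 bT] := endomorphism_bounded T.
pose r kappa (p : hpoly k lambda kappa) := Hpoly (endomorphism_hpoly T (hpolyP p)).
have rl kappa : linear (@r kappa).
  by move=> a p q; apply: val_inj; rewrite /= linearP.
have [F FE] : exists F : hpoly_family k lambda, forall kappa p, F kappa p = r kappa p.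
  exists (fun kappa => sval (cid (linear_exists (rl kappa)))) => kappa p.
  exact: (svalP (cid (linear_exists (rl kappa)))).
have FP : F \in @direct_sum_pred R m k lambda.
  by apply/asboolP; exists M => kappa p; rewrite /hpoly_norm FE /=; exact: bT.
by exists (DirectSum FP) => kappa p; rewrite /= FE.
Qed.

(** The value at [f] is the series of the images of the components of [f], which [hpoly_series] sums
    with the right bound. Linearity and equivariance are then checked on components, by
    [hproj_ext]. *)
Lemma restricts_surj S : exists T, restricts T S.
Proof.
have /asboolP[M bS] := direct_sumP S.
(* The bound of a family carries no sign, while [hpoly_series] asks for a nonnegative one. *)
pose M0 := Num.max M 0; have M00 : 0 <= M0 by rewrite le_max lexx orbT.
pose P f kappa := Hpoly (hproj_hpoly lambda_gtN1 f kappa).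
have /choice[T TP] : forall f, exists g,
    (forall kappa, hproj g kappa = component S kappa (P f kappa)) /\ N g <= M0 * N f.
  move=> f; apply: hpoly_series => // kappa; first exact: hpolyP.
  apply: le_trans (bS kappa (P f kappa)) _.
  by rewrite ler_wpM2r ?bergman_norm_ge0// le_max lexx.
have Tl : linear T.
  move=> a f g; refine (@hproj_ext R m k lambda lambda_gtN1 _ _ _) => kappa.
  rewrite hproj_combination !(TP _).1 -[RHS]/(hpoly_val (a *: component S kappa (P f kappa) + component S kappa (P g kappa))).
  rewrite -linearP; congr (hpoly_val (component S kappa _)).
  by apply: val_inj; rewrite /= hproj_combination.
have [T' T'E] := linear_exists Tl.
have T'P : T' \in @endomorphism_pred R n lambda (block_torus R k).
  apply/asboolP; split; first by exists M0 => f; rewrite T'E (TP f).2.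
  move=> A /block_torusP[t [t1 ->]] f g /(unitary_action_torus t1) ->.
  apply/(unitary_action_torus t1); rewrite !T'E; refine (@hproj_ext R m k lambda lambda_gtN1 _ _ _) => kappa.
  rewrite hproj_rotation !(TP _).1.
  set c := torus_character _ _.
  rewrite -[RHS]/(hpoly_val (c *: component S kappa (P f kappa))) -linearZ.
  by congr (hpoly_val (component S kappa _)); apply: val_inj; rewrite /= hproj_rotation.
exists (Endomorphism T'P) => kappa p; rewrite /= T'E.
refine (@hproj_ext R m k lambda lambda_gtN1 _ _ _) => kappa'; rewrite (TP _).1.
have [<-|kk] := eqVneq kappa kappa'.
  rewrite (hproj_id lambda_gtN1 (hpolyP _)); congr (hpoly_val (component S kappa _)).
  by apply: val_inj; rewrite /= (hproj_id lambda_gtN1 (hpolyP _)).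
rewrite (hproj_other lambda_gtN1 (hpolyP _) kk) (_ : P _ kappa' = 0) ?linear0//.
by apply: val_inj; rewrite /= (hproj_other lambda_gtN1 (hpolyP _) kk).
Qed.

End Isomorphism.

(** * Adjoints and norms under restriction *)

Section StarStructure.
Context {R : realType} {m : nat} (k : 'I_m -> nat) (lambda : R).
Hypothesis lambda_gtN1 : -1 < lambda.
Local Notation C := R[i].
Local Notation n := (\sum_(j < m) k j)%N.
Local Notation A2 := (@bergman R n lambda).
Local Notation N := (@bergman_norm R n lambda).
Local Notation dot := (@bergman_dot R n lambda).
Local Notation End := (endomorphism lambda (block_torus R k)).
Local Notation hproj := (hproj (k := k) lambda_gtN1).
Implicit Types (f g q : A2) (T : End) (S : direct_sum k lambda).

Definition componentwise_adjoint S S' := forall kappa,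
  is_adjoint (@hpoly_dot R m k lambda kappa) (component S kappa) (component S' kappa).

Lemma componentwise_adjoint_unique S S1 S2 :
  componentwise_adjoint S S1 -> componentwise_adjoint S S2 -> S1 = S2.
Proof.
move=> h1 h2; apply: direct_sum_ext => kappa p; apply/subr0_eq; apply: val_inj.
set d := _ - _; apply: (bergman_norm_eq0 lambda_gtN1); apply/eqP; rewrite -sqrf_eq0.
have : dot (hpoly_val d) (hpoly_val d) = 0.
  rewrite -[X in dot _ X]/(hpoly_val (component S1 kappa p) - hpoly_val (component S2 kappa p)).
  rewrite dotBr; apply/eqP; rewrite subr_eq0; apply/eqP.
  by have := h1 kappa d p; rewrite (h2 kappa d p).
by rewrite dotxx => /(congr1 (@complex.Re R)) /= ->.
Qed.

(** From the components to the operators, the identity is first tested against a vector in one of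
    the spaces, where only the matching component of [f] counts, and then extended to all [g] by
    continuity along its partial sums. *)
Lemma is_adjoint_restricts T (T' : End) S S' : restricts T S -> restricts T' S' ->
  is_adjoint dot T T' <-> componentwise_adjoint S S'.
Proof.
move=> h h'; split=> [a kappa p q|a f g].
  by rewrite /hpoly_dot h h' a.
have hp u kappa : u \in hpoly_pred k lambda kappa -> dot (T f) u = dot f (T' u).
  move=> uk; rewrite (dot_hproj lambda_gtN1 _ uk) hproj_endomorphism.
  rewrite (dot_hproj lambda_gtN1 f (endomorphism_hpoly lambda_gtN1 T' uk)).
  have := a kappa (Hpoly (hproj_hpoly lambda_gtN1 f kappa)) (Hpoly uk).
  by rewrite /hpoly_dot h h'.
(* [ncvg_dot] expresses continuity in the first argument, hence the conjugation. *)
rewrite dot_conj [RHS]dot_conj; congr (_^*%C).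
have c1 := ncvg_dot (T f) (hproj_cvg (k := k) lambda_gtN1 g).
have c2 := ncvg_dot f (endomorphism_ncvg T' (hproj_cvg (k := k) lambda_gtN1 g)).
apply: ccvg_unique c1 _; apply: eq_ccvg c2; exists 0%N => D _ /=.
rewrite endomorphism_partial /partial !dot_suml; apply: eq_bigr => kappa _ /=.
by rewrite dot_conj [RHS]dot_conj (hp _ kappa)// hproj_hpoly.
Qed.

(** No restriction exceeds the norm of [T]. Conversely [hpoly_series], with the supremum as
    constant, bounds [T f] by its components. *)
Lemma opnorm_restricts T S : restricts T S ->
  opnorm N T = sup (range (fun kappa => opnorm (@hpoly_norm R m k lambda kappa) (component S kappa))).
Proof.
move=> h; have [M M0 bT] := endomorphism_bounded T.
have NZ kappa a (p : hpoly k lambda kappa) : hpoly_norm (a *: p) = normc a * hpoly_norm p.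
  by rewrite /hpoly_norm normZ.
have N0 kappa (p : hpoly k lambda kappa) : 0 <= hpoly_norm p by exact: bergman_norm_ge0.
have [T0 TT] := opnorm_bounded (@bergman_norm_ge0 R n lambda) (@normZ R n lambda) bT.
have bS kappa : bounded_by (@hpoly_norm R m k lambda kappa) (opnorm N T) (component S kappa).
  by move=> p; rewrite /hpoly_norm h; exact: TT.
have le kappa := opnorm_le (NZ kappa) T0 (bS kappa).
(* The zero index shows that the set is nonempty, also for [m = 0]. *)
set r := (X in _ = sup X); have r0 : r !=set0.
  by exists (opnorm (@hpoly_norm R m k lambda [ffun=> 0%N]) (component S [ffun=> 0%N])), [ffun=> 0%N].
have rub : ubound r (opnorm N T) by move=> _ [kappa _ <-]; exact: le.
have rle kappa : opnorm (@hpoly_norm R m k lambda kappa) (component S kappa) <= sup r.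
  by apply: ub_le_sup; [exists (opnorm N T)|exists kappa].
have S0 kappa := (opnorm_bounded (N0 kappa) (NZ kappa) (bS kappa)).1.
have SS kappa := (opnorm_bounded (N0 kappa) (NZ kappa) (bS kappa)).2.
apply/eqP; rewrite eq_le; apply/andP; split; last exact: ge_sup.
have sup0 : 0 <= sup r := le_trans (S0 [ffun=> 0%N]) (rle _).
apply: (opnorm_le (@normZ R n lambda) sup0) => f.
have [||g [gE gN]] := @hpoly_series R m k lambda lambda_gtN1 (fun kappa => T (hproj f kappa)) (sup r) f sup0.
- by move=> kappa; apply: (endomorphism_hpoly lambda_gtN1); exact: hproj_hpoly.
- move=> kappa; have := SS kappa (Hpoly (hproj_hpoly lambda_gtN1 f kappa)).
  rewrite /hpoly_norm h /= => /le_trans; apply.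
  by rewrite ler_wpM2r ?bergman_norm_ge0.
rewrite (_ : T f = g)//; refine (@hproj_ext R m k lambda lambda_gtN1 _ _ _) => kappa.
by rewrite hproj_endomorphism gE.
Qed.

End StarStructure.

Theorem proposition4p10 (R : realType) (m : nat) (k : 'I_m -> nat) (lambda : R)
    (lambda_gtN1 : -1 < lambda) (k_gt0 : forall j, (0 < k j)%N) :
  (forall (T : endomorphism lambda (block_torus R k)) (kappa : {ffun 'I_m -> nat})
     (f : bergman (\sum_(j < m) k j)%N lambda),
     f \in hpoly_pred k lambda kappa -> T f \in hpoly_pred k lambda kappa) /\
  (exists Phi : endomorphism lambda (block_torus R k) -> direct_sum k lambda,
     (forall (T : endomorphism lambda (block_torus R k))
        (kappa : {ffun 'I_m -> nat}) (p : hpoly k lambda kappa),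
        hpoly_val (component (Phi T) kappa p) = T (hpoly_val p)) /\
     @cstar_isomorphism R (endomorphism_algebra lambda (block_torus R k))
       (direct_sum_algebra k lambda) Phi).
Proof.
split=> [T kappa f|]; first exact: endomorphism_hpoly.
have /choice[Phi PhiP] := restricts_total lambda_gtN1 (k := k).
have /choice[Psi PsiP] := restricts_surj lambda_gtN1 (k := k).
have PhiL : linear Phi.
  move=> a S T; apply: direct_sum_ext => kappa p; apply: val_inj.
  rewrite /= PhiP.
  rewrite -[RHS]/(a *: hpoly_val (component (Phi S) kappa p) + hpoly_val (component (Phi T) kappa p)).
  by rewrite !PhiP.
exists Phi; split; first exact: PhiP.
split.
- exact: PhiL.
- exists Psi.
    by move=> T; exact: (restricts_inj lambda_gtN1 (PsiP _) (PhiP _)).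
  by move=> S; exact: (restricts_fun (PhiP _) (PsiP _)).
- move=> S T; apply: direct_sum_ext => kappa p; apply: val_inj.
  by rewrite /= !PhiP.
- move=> T /=; rewrite /endomorphism_adj /direct_sum_adj.
  set P := [set T' : endomorphism _ _ | _]; set Q := [set S : direct_sum _ _ | _].
  (* [Phi] matches the adjoints of [T] with those of [Phi T], so they exist on both sides or on
     neither. If they exist, uniqueness identifies the value chosen by [xget] in the direct sum with
     the image of the one chosen for [T]. *)
  have PQ T' : P T' <-> Q (Phi T') := is_adjoint_restricts lambda_gtN1 (PhiP T) (PhiP T').
  have [PT|noT'] := pselect (exists T', P T').
    have e1 := (PQ _).1 (xgetPex 0 PT); have e2 := xgetPex 0 (ex_intro Q _ e1).
    exact: componentwise_adjoint_unique lambda_gtN1 _ _ _ e1 e2.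
  rewrite !xgetPN.
  (* In the other case both sides take the default 0, and linearity gives [Phi 0 = 0]. *)
  + have := PhiL (-1) 0 0; rewrite scaler0 addr0 scaleN1r addNr; exact.
  + move=> S SP; apply: noT'; exists (Psi S).
    by apply/(is_adjoint_restricts lambda_gtN1 (PhiP T) (PsiP S)).
  + by move=> T' T'P; apply: noT'; exists T'.
- by move=> T; rewrite /= /direct_sum_norm (opnorm_restricts lambda_gtN1 (PhiP T)).
Qed.
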